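(* Let $0\le q<1$, $x>0$ and $s\in\mathbb{C}$. The Lambert series $\mathscr{L}_q(s,x)=\sum_{k=1}^\infty \frac{k^s q^{kx}}{1-q^k}$ has the following expansion at $q=1$. (1) For $s\neq 0,-1,-2,\ldots$: $$\mathscr{L}_q(s,x)=\frac{\Gamma(1+s)\,\zeta(1+s,x)}{\left(\log\frac1q\right)^{1+s}}-\sum_{k=0}^\infty\frac{\zeta(1-s-k)}{k!}B_k(x)(\log q)^{k-1}.$$ (2) For $s=0$: $$\mathscr{L}_q(0,x)=\frac{\psi(x)+\log\log\frac1q}{\log q}-\sum_{k=1}^\infty\frac{\zeta(1-k)}{k!}B_k(x)(\log q)^{k-1}.$$ (3) For $s=-m=-1,-2,-3,\ldots$: $$\mathscr{L}_q(-m,x)=\left[m\,\zeta'(1-m,x)+\left(\log\log\frac1q-H_{m-1}\right)B_m(x)\right]\frac{(\log q)^{m-1}}{m!}-\sum_{\substack{k=0\\k\ne m}}^\infty\frac{\zeta(1+m-k)}{k!}B_k(x)(\log q)^{k-1},$$ where $H_{m-1}$ is the $(m-1)$-th harmonic number.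
   Context: $B_k(x)$ are the Bernoulli polynomials, defined by $\frac{te^{xt}}{e^t-1}=\sum_{n=0}^\infty\frac{B_n(x)}{n!}t^n$. $\zeta(s,x)$ is the Hurwitz zeta function, $\zeta(s)=\zeta(s,1)$ is the Riemann zeta function, and $\zeta'(s,x)$ denotes the derivative of $\zeta(s,x)$ with respect to $s$. $\Gamma$ is the gamma function and $\psi=\Gamma'/\Gamma$ is the digamma function. $H_n=\sum_{j=1}^n 1/j$, with $H_0=0$. *)

(* Defs.v *)
From Stdlib Require Import Reals ZArith ClassicalEpsilon.
From Coquelicot Require Import Coquelicot.
Open Scope R_scope.

(* The principal power a^s = exp (s log a), for a > 0. *)
Definition cpow (a : R) (s : C) : C :=
  (RtoC (exp (Re s * ln a)) * (cos (Im s * ln a), sin (Im s * ln a)))%C.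

(* q^y for q >= 0 and y > 0; Stdlib's [Rpower 0 y] is not 0. *)
Definition qpow (q y : R) : R := if Rlt_dec 0 q then Rpower q y else 0.

Definition CSeries (a : nat -> C) : C :=
  (Series (fun n => Re (a n)), Series (fun n => Im (a n))).

Definition lambert_series (q : R) (s : C) (x : R) : C :=
  CSeries (fun n => let k := S n in
    (cpow (INR k) s * RtoC (qpow q (INR k * x) / (1 - q ^ k)))%C).

Definition is_bernoulli (x : R) (b : nat -> R) : Prop :=
  exists r : R, 0 < r /\ forall t : R, t <> 0 -> Rabs t < r ->
    is_pseries (fun n => b n / INR (fact n)) t (t * exp (x * t) / (exp t - 1)).

Definition bernoulli (n : nat) (x : R) : R :=
  epsilon (inhabits (fun _ : nat => 0)) (is_bernoulli x) n.

Definition analytic_on (D : C -> Prop) (f : C -> C) : Prop :=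
  forall z0 : C, D z0 -> exists (a : nat -> C) (r : R), 0 < r /\
    forall z : C, Cmod (z - z0) < r ->
      @is_pseries C_AbsRing C_NormedModule a (z - z0)%C (f z).

(* The analytic continuation of the Dirichlet series to C \ {1};
   the value at s = 1 is unconstrained. *)
Definition is_hurwitz_zeta (x : R) (f : C -> C) : Prop :=
  analytic_on (fun s => s <> RtoC 1) f /\
  forall s : C, 1 < Re s ->
    @is_series C_AbsRing C_NormedModule
      (fun n => cpow (INR n + x) (- s)%C) (f s).

Definition hurwitz_zeta (s : C) (x : R) : C :=
  epsilon (inhabits (fun _ : C => RtoC 0)) (is_hurwitz_zeta x) s.

Definition riemann_zeta (s : C) : C := hurwitz_zeta s 1.

Definition hurwitz_zeta' (s : C) (x : R) : C :=
  C_derive (fun w => hurwitz_zeta w x) s.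

Definition euler_integral (z : C) : C :=
  @RInt_gen C_R_CompleteNormedModule
    (fun t => (cpow t (z - 1) * RtoC (exp (- t)))%C)
    (at_right 0) (Rbar_locally p_infty).

Fixpoint pochhammer (z : C) (n : nat) : C :=
  match n with
  | O => RtoC 1
  | S n' => (pochhammer z n' * (z + INR n'))%C
  end.

(* Euler's integral when Re z > 0, continued to the other z by
   Gamma (z + 1) = z Gamma z: the shift n satisfies Re z + n > 0, and n = 0
   when Re z > 0. *)
Definition Gamma (z : C) : C :=
  let n := Z.to_nat (up (- Re z)) in
  (euler_integral (z + INR n) / pochhammer z n)%C.

Definition digamma (z : C) : C := (C_derive Gamma z / Gamma z)%C.

Definition harmonic (n : nat) : R := sum_n_m (fun j => / INR j) 1 n.

(* f(q) ~ sum_(k >= 0) a_k (log q)^(k-1) as q -> 1-, in Poincare's sense.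
   Such a series in general diverges for every q < 1. *)
Definition expansion_at_1 (f : R -> C) (a : nat -> C) : Prop :=
  forall n : nat,
    @is_domin R R_AbsRing C_AbsRing R_NormedModule C_NormedModule (at_left 1)
      (fun q => powerRZ (ln q) (Z.of_nat n - 1))
      (fun q => (f q - @sum_n C_AbelianMonoid (fun k =>
                   a k * RtoC (powerRZ (ln q) (Z.of_nat k - 1))) n)%C).

(* Main.v *)
Require Import Defs.
From Stdlib Require Import Reals ZArith Lra Lia Psatz ClassicalEpsilon.
From Coquelicot Require Import Coquelicot.
Open Scope R_scope.

(** Put t = - ln q and G(u) = u e^(-xu) / (1 - e^(-u)) = sum_n g_n u^n, where
    g_n = (-1)^n B_n(x) / n!. The k-th term of the Lambert series is
    k^s e^(-kxt) / (1 - e^(-kt)), so t L_q(s,x) = sum_(k >= 1) k^(s-1) G(kt): the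
    theorem is about the sum of a smooth, rapidly decreasing function dilated by a
    small t against a complex power of k.

    Euler-Maclaurin summation writes such a sum as an integral, a boundary term and
    integrals against normalised periodic Bernoulli polynomials. Applied to a pure
    power k^(-w) the same formula is the analytic continuation of zeta(w), with the
    integral giving its polar part 1/(w-1). Hence, after G is replaced by a Taylor
    polynomial plus a remainder, the boundary and kernel terms of the n-th monomial
    add up to g_n t^n times the regular part of zeta(1-s-n), and those of the
    remainder are O(t^N) ([sum_asym]). The one technical point is that kernel
    integrals converge only for very negative exponents; integration by parts lowers
    the exponent and stays inside the family generated from G by u d/du, which makes
    an induction possible ([tail_asym]).

    The remaining integral of u^(s-1) G(tu) over (1,oo) equals t^(-s) times the
    integral of v^(s-1) G(v) over (t,oo). Splitting off Taylor terms on (t,1) gives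
    t^(-s) times the continued Mellin transform of G at s, minus
    sum_n g_n t^n / (s+n), which restores the polar parts of the zeta values; when
    s = -m the n = m term is - g_m t^m ln t instead ([int_asym],
    [power_int_generic], [power_int_log]).

    It remains to evaluate the Mellin transform. For Re s > 0 the geometric series
    gives Gamma(1+s) zeta(1+s,x); multiplied by s(s+1)...(s+N-1) both sides are
    analytic for Re s > -N, so they agree there ([mellin_identity]). This is case
    (1). At s = -m one compares values and first derivatives in that identity, which
    brings in zeta'(1-m,x), the harmonic number from the derivative of the
    product, and Gamma'(1); the latter cancels the constant term of zeta at 1
    ([finite_part]). Both this and the digamma function in case (2) come from: - psi(x)
    is the constant term of zeta(s,x) at s = 1. The two sides satisfy the same
    recurrence in x and both differ from - ln x by O(1/x) ([digamma_int_em]).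

    The Hurwitz zeta function of the statement is any function analytic off s = 1
    that extends the Dirichlet series, so the Euler-Maclaurin continuation must be
    shown to be analytic and every such function must be shown to agree with it.
    Both rest on one-variable power series only: an integral of e^(-s lambda(u))
    has its Taylor expansion under the integral sign ([transform_power_series]), and
    analytic functions propagate their zeros along segments
    ([analytic_at_segment]). *)

(** * Complex sequences and series *)

Definition Clim (u : nat -> C) (l : C) : Prop :=
  forall eps, 0 < eps -> exists N, forall n, (N <= n)%nat -> Cmod (u n - l) < eps.

Fixpoint csum (a : nat -> C) (n : nat) : C :=
  match n with O => RtoC 0 | S m => (csum a m + a m)%C end.

Lemma Cmod_eq0_eps (z : C) : (forall eps, 0 < eps -> Cmod z < eps) -> z = 0.
Proof.
  intros H. apply Cmod_eq_0. destruct (Cmod_ge_0 z) as [h|h]; auto.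
  specialize (H _ h). lra.
Qed.

Lemma Ceq_minus (a b : C) : (a - b = 0)%C -> a = b.
Proof. intros E. replace a with (a - b + b)%C by ring. rewrite E. ring. Qed.

Lemma Clim_unique u l m : Clim u l -> Clim u m -> l = m.
Proof.
  intros Hl Hm. apply Ceq_minus, Cmod_eq0_eps. intros eps He.
  destruct (Hl (eps/2)) as [N1 H1]; [lra|]. destruct (Hm (eps/2)) as [N2 H2]; [lra|].
  specialize (H1 (max N1 N2) ltac:(lia)). specialize (H2 (max N1 N2) ltac:(lia)).
  set (k := u (max N1 N2)) in *.
  replace (l - m)%C with (- (k - l) + (k - m))%C by ring.
  eapply Rle_lt_trans; [apply Cmod_triangle|]. rewrite Cmod_opp. lra.
Qed.

Lemma Clim_ext u v l : (forall n, u n = v n) -> Clim u l -> Clim v l.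
Proof. intros E H eps He. destruct (H eps He) as [N HN]. exists N. intros n Hn.
  rewrite <- E; auto. Qed.

Lemma Clim_const c : Clim (fun _ => c) c.
Proof.
  intros eps He. exists 0%nat. intros n _. replace (c - c)%C with (RtoC 0) by ring.
  rewrite Cmod_0; auto.
Qed.

Lemma Clim_plus u v l m : Clim u l -> Clim v m -> Clim (fun n => u n + v n)%C (l + m)%C.
Proof.
  intros Hl Hm eps He.
  destruct (Hl (eps/2)) as [N1 H1]; [lra|]. destruct (Hm (eps/2)) as [N2 H2]; [lra|].
  exists (max N1 N2). intros n Hn.
  replace (u n + v n - (l + m))%C with ((u n - l) + (v n - m))%C by ring.
  eapply Rle_lt_trans; [apply Cmod_triangle|].
  specialize (H1 n ltac:(lia)); specialize (H2 n ltac:(lia)). lra.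
Qed.

Lemma Clim_scal c u l : Clim u l -> Clim (fun n => c * u n)%C (c * l)%C.
Proof.
  intros Hl eps He. pose proof (Cmod_ge_0 c).
  destruct (Hl (eps / (Cmod c + 1))) as [N HN].
  { apply Rdiv_lt_0_compat; lra. }
  exists N. intros n Hn. replace (c * u n - c * l)%C with (c * (u n - l))%C by ring.
  rewrite Cmod_mult. specialize (HN n Hn). pose proof (Cmod_ge_0 (u n - l)).
  assert (eps = (Cmod c + 1) * (eps / (Cmod c + 1))) as E by (field; lra).
  rewrite E at 1. nra.
Qed.

Lemma Clim_opp u l : Clim u l -> Clim (fun n => - u n)%C (- l)%C.
Proof.
  intros H. apply (Clim_scal (-(1))%C) in H.
  replace (- l)%C with (- (1) * l)%C by ring.
  apply Clim_ext with (2 := H). intro; ring.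
Qed.

Lemma Clim_minus u v l m : Clim u l -> Clim v m -> Clim (fun n => u n - v n)%C (l - m)%C.
Proof. intros. apply Clim_plus; auto. apply Clim_opp; auto. Qed.

Lemma Clim_Cmod_le u l B : Clim u l -> (exists N, forall n, (N <= n)%nat -> Cmod (u n) <= B) ->
  Cmod l <= B.
Proof.
  intros H [N HN]. apply le_epsilon. intros eps He. destruct (H eps He) as [N1 H1].
  specialize (H1 (max N N1) ltac:(lia)). specialize (HN (max N N1) ltac:(lia)).
  set (k := u (max N N1)) in *.
  replace l with (k + - (k - l))%C by ring.
  eapply Rle_trans; [apply Cmod_triangle|]. rewrite Cmod_opp. lra.
Qed.

Lemma Clim_bound0 u (b : nat -> R) : (forall n, Cmod (u n) <= b n) -> is_lim_seq b 0 -> Clim u 0.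
Proof.
  intros Hb Hl eps He. apply is_lim_seq_spec in Hl. destruct (Hl (mkposreal eps He)) as [N HN].
  exists N. intros n Hn. specialize (HN n Hn). simpl in HN. rewrite Rminus_0_r in HN.
  replace (u n - 0)%C with (u n) by ring. specialize (Hb n). apply Rabs_def2 in HN. lra.
Qed.

Lemma Clim_bound u l (b : nat -> R) : (forall n, Cmod (u n - l) <= b n) -> is_lim_seq b 0 ->
  Clim u l.
Proof.
  intros Hb Hl. assert (Clim (fun n => u n - l)%C 0) by (eapply Clim_bound0; eauto).
  pose proof (Clim_plus _ _ _ _ H (Clim_const l)) as K. replace (0 + l)%C with l in K by ring.
  apply Clim_ext with (2 := K). intro; ring.
Qed.

Lemma Cmod_parts (z : C) : Cmod z <= Rabs (Re z) + Rabs (Im z).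
Proof.
  replace z with (RtoC (Re z) + Ci * RtoC (Im z))%C.
  - eapply Rle_trans; [apply Cmod_triangle|]. rewrite Cmod_mult, Cmod_Ci, !Cmod_R. simpl.
    unfold Re, Im; simpl. right.
    replace (fst z + (0 * snd z - 1 * 0)) with (fst z) by ring.
    replace (0 + (0 * 0 + 1 * snd z)) with (snd z) by ring. ring.
  - destruct z; unfold Re, Im, Ci; apply injective_projections; simpl; ring.
Qed.

Lemma im_le_Cmod z : Rabs (Im z) <= Cmod z.
Proof. pose proof (Rmax_Cmod z). unfold Im. eapply Rle_trans; [apply Rmax_r|eauto]. Qed.

Lemma Clim_parts u l : Clim u l <-> is_lim_seq (fun n => Re (u n)) (Re l) /\
  is_lim_seq (fun n => Im (u n)) (Im l).
Proof.
  split.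
  - intros H; split; apply is_lim_seq_spec; intros [eps He]; destruct (H eps He) as [N HN];
    exists N; intros n Hn; simpl.
    + eapply Rle_lt_trans; [|apply (HN n Hn)]. eapply Rle_trans; [|apply re_le_Cmod]. right.
      f_equal.
    + eapply Rle_lt_trans; [|apply (HN n Hn)]. eapply Rle_trans; [|apply im_le_Cmod]. right.
      f_equal.
  - intros [H1 H2] eps He. apply is_lim_seq_spec in H1. apply is_lim_seq_spec in H2.
    assert (0 < eps / 2) as He2 by lra.
    destruct (H1 (mkposreal _ He2)) as [N1 K1]. destruct (H2 (mkposreal _ He2)) as [N2 K2].
    exists (max N1 N2). intros n Hn. specialize (K1 n ltac:(lia)). specialize (K2 n ltac:(lia)).
    simpl in *.
    eapply Rle_lt_trans; [apply Cmod_parts|].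
    change (Re (u n - l)) with (Re (u n) - Re l). change (Im (u n - l)) with (Im (u n) - Im l).
    lra.
Qed.

Lemma csum_ext a b n : (forall k, (k < n)%nat -> a k = b k) -> csum a n = csum b n.
Proof. induction n; intros H; simpl; auto. rewrite IHn, H; auto. Qed.

Lemma csum_plus a b n : csum (fun k => a k + b k)%C n = (csum a n + csum b n)%C.
Proof. induction n; simpl; [ring|rewrite IHn; ring]. Qed.

Lemma csum_scal c a n : csum (fun k => c * a k)%C n = (c * csum a n)%C.
Proof. induction n; simpl; [ring|rewrite IHn; ring]. Qed.

Lemma csum_shift a n : csum a (S n) = (a 0%nat + csum (fun k => a (S k)) n)%C.
Proof. induction n; [simpl; ring|]. change (csum a (S (S n))) with (csum a (S n) + a (S n))%C.
  rewrite IHn. simpl. ring. Qed.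

Lemma csum_telescope f n : csum (fun k => f (S k) - f k)%C n = (f n - f 0%nat)%C.
Proof. induction n; simpl; [ring|rewrite IHn; ring]. Qed.

Lemma csum_Cmod_le a (b : nat -> R) n : (forall k, (k <= n)%nat -> Cmod (a k) <= b k) ->
  Cmod (csum a (S n)) <= sum_n b n.
Proof.
  intros H. change (csum a (S n)) with (csum a n + a n)%C. induction n.
  - rewrite sum_O. simpl. replace (0 + a 0%nat)%C with (a 0%nat) by ring. auto.
  - rewrite sum_Sn. eapply Rle_trans; [apply Cmod_triangle|]. apply Rplus_le_compat; auto.
Qed.

Lemma csum_sum_n a n : csum a (S n) = @sum_n C_AbelianMonoid a n.
Proof.
  induction n. - rewrite sum_O. simpl. ring.
  - rewrite sum_Sn, <- IHn. reflexivity.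
Qed.

Lemma csum_Re a n : Re (csum a (S n)) = sum_n (fun k => Re (a k)) n.
Proof. induction n. - rewrite sum_O. simpl. unfold Re; simpl; ring. - rewrite sum_Sn, <- IHn.
  reflexivity. Qed.
Lemma csum_Im a n : Im (csum a (S n)) = sum_n (fun k => Im (a k)) n.
Proof. induction n. - rewrite sum_O. simpl. unfold Im; simpl; ring. - rewrite sum_Sn, <- IHn.
  reflexivity. Qed.

Definition is_cseries a l := Clim (csum a) l.

Lemma Clim_incr u l : Clim (fun n => u (S n)) l <-> Clim u l.
Proof.
  split; intros H eps He; destruct (H eps He) as [N HN].
  - exists (S N). intros [|n] Hn; [lia|]. apply HN; lia.
  - exists N. intros n Hn. apply HN; lia.
Qed.

Lemma is_cseries_parts a l : is_cseries a l <-> is_series (fun n => Re (a n)) (Re l) /\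
  is_series (fun n => Im (a n)) (Im l).
Proof.
  unfold is_cseries. rewrite <- Clim_incr, Clim_parts.
  change (is_series (fun n => Re (a n)) (Re l)) with (is_lim_seq (sum_n (fun n => Re (a n))) (Re
  l)).
  change (is_series (fun n => Im (a n)) (Im l)) with (is_lim_seq (sum_n (fun n => Im (a n))) (Im
  l)).
  split; intros [H1 H2]; (split; [revert H1|revert H2]); apply is_lim_seq_ext; intro n;
  rewrite ?csum_Re, ?csum_Im; reflexivity.
Qed.

Lemma is_cseries_iff a l : is_cseries a l <-> @is_series C_AbsRing C_NormedModule a l.
Proof.
  unfold is_cseries. rewrite <- Clim_incr. split.
  - intros H. apply filterlim_locally. intros [eps He]. destruct (H eps He) as [N HN].
    exists N. intros n Hn. apply C_NormedModule_mixin_compat1. simpl.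
    specialize (HN n Hn). rewrite csum_sum_n in HN. exact HN.
  - intros H eps He. pose proof (proj1 (filterlim_locally _ _) H) as H'. clear H.
    rename H' into H.
    assert (0 < eps / sqrt 2) as He2 by (apply Rdiv_lt_0_compat; auto; apply sqrt_lt_R0; lra).
    destruct (H (mkposreal _ He2)) as [N HN]. exists N. intros n Hn. specialize (HN n Hn).
    apply C_NormedModule_mixin_compat2 in HN. simpl in HN.
    rewrite csum_sum_n. replace (sqrt 2 * (eps / sqrt 2)) with eps in HN; [exact HN|].
    field. apply Rgt_not_eq, sqrt_lt_R0; lra.
Qed.

Lemma CSeries_unique a l : is_cseries a l -> CSeries a = l.
Proof.
  rewrite is_cseries_parts. intros [H1 H2]. unfold CSeries.
  rewrite (is_series_unique _ _ H1), (is_series_unique _ _ H2). destruct l; reflexivity.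
Qed.

Lemma is_cseries_plus a b l m : is_cseries a l -> is_cseries b m ->
  is_cseries (fun n => a n + b n)%C (l + m)%C.
Proof. intros. eapply Clim_ext; [intro; symmetry; apply csum_plus|]. apply Clim_plus; auto. Qed.
Lemma is_cseries_scal c a l : is_cseries a l -> is_cseries (fun n => c * a n)%C (c * l)%C.
Proof. intros. eapply Clim_ext; [intro; symmetry; apply csum_scal|]. apply Clim_scal; auto. Qed.
Lemma is_cseries_ext a b l : (forall n, a n = b n) -> is_cseries a l -> is_cseries b l.
Proof. intros E. apply Clim_ext. intro; apply csum_ext; auto. Qed.

Lemma is_cseries_dominated a (b : nat -> R) : (forall n, Cmod (a n) <= b n) -> ex_series b ->
  exists l, is_cseries a l /\ Cmod l <= Series b.
Proof.
  intros Hb Hs.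
  assert (ex_series (fun n => Re (a n))) as [p Hp].
  { apply (ex_series_le (V:=R_CompleteNormedModule)) with b; auto. intro n.
    eapply Rle_trans; [apply re_le_Cmod|apply Hb]. }
  assert (ex_series (fun n => Im (a n))) as [q Hq].
  { apply (ex_series_le (V:=R_CompleteNormedModule)) with b; auto. intro n.
    eapply Rle_trans; [apply im_le_Cmod|apply Hb]. }
  exists (p, q). assert (is_cseries a (p, q)) as K by (apply is_cseries_parts; auto). split; auto.
  eapply Clim_Cmod_le; [exact K|]. exists 1%nat. intros [|n] Hn; [lia|].
  eapply Rle_trans; [apply csum_Cmod_le; intros; apply Hb|].
  assert (forall n, 0 <= b n) as Hp0 by (intro k; eapply Rle_trans; [apply Cmod_ge_0|apply Hb]).
  destruct Hs as [sb HS]. rewrite (is_series_unique _ _ HS).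
  apply (is_lim_seq_incr_compare (sum_n b)); [exact HS|].
  intro k. rewrite sum_Sn. unfold plus; simpl. specialize (Hp0 (S k)). lra.
Qed.

Lemma is_cseries_term0 a l : is_cseries a l -> Clim a 0.
Proof.
  intros H. pose proof (Clim_minus _ _ _ _ (proj2 (Clim_incr _ _) H) H) as K. simpl in K.
  replace (l - l)%C with (RtoC 0) in K by ring. apply Clim_ext with (2 := K). intro; ring.
Qed.

Lemma Clim_bounded u l : Clim u l -> exists B, 0 < B /\ forall n, Cmod (u n) <= B.
Proof.
  intros H. destruct (H 1 Rlt_0_1) as [N HN].
  assert (forall M, exists B, 0 < B /\ forall n, (n < M)%nat -> Cmod (u n) <= B) as F.
  { induction M as [|M [B [HB HM]]]. - exists 1; split; [lra|intros; lia].
    - exists (B + Cmod (u M)). pose proof (Cmod_ge_0 (u M)). split; [lra|]. intros n Hn.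
      destruct (Nat.eq_dec n M) as [->|]; [lra|]. specialize (HM n ltac:(lia)). lra. }
  destruct (F N) as [B [HB K]]. pose proof (Cmod_ge_0 l). exists (B + Cmod l + 1). split; [lra|].
  intros n.
  destruct (le_lt_dec N n) as [h|h].
  - specialize (HN n h). replace (u n) with ((u n - l) + l)%C by ring.
    eapply Rle_trans; [apply Cmod_triangle|]. lra.
  - specialize (K n h). lra.
Qed.

(** * Analytic functions and the identity theorem *)

Definition has_power_series (f : C -> C) (z0 : C) (a : nat -> C) (r : R) : Prop :=
  0 < r /\ forall z, Cmod (z - z0) < r -> is_cseries (fun n => a n * (z - z0) ^ n)%C (f z).

Definition analytic_at (f : C -> C) (z0 : C) : Prop := exists a r, has_power_series f z0 a r.

Lemma analytic_on_iff D f : analytic_on D f <-> forall z, D z -> analytic_at f z.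
Proof.
  assert (forall (a : nat -> C) z z0 l, is_cseries (fun n => a n * (z - z0) ^ n)%C l <->
    @is_pseries C_AbsRing C_NormedModule a (z - z0)%C l) as E.
  { intros a z z0 l. rewrite is_cseries_iff. unfold is_pseries.
    split; apply is_series_ext; intro n;
      [change (a n * (z - z0) ^ n = (z - z0) ^ n * a n)%C|change ((z - z0) ^ n * a n = a n * (z -
      z0) ^ n)%C]; ring. }
  split; intros H z Hz; destruct (H z Hz) as [a [r [Hr K]]]; exists a, r; split; auto;
  intros w Hw; apply E, K, Hw.
Qed.

Lemma is_cseries_shift a l n : is_cseries a l ->
  is_cseries (fun k => a (n + k)%nat) (l - csum a n)%C.
Proof.
  intros H. assert (forall k, csum (fun k => a (n + k)%nat) k = (csum a (n + k) - csum a n)%C) as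
  E.
  { induction k. - rewrite Nat.add_0_r. simpl. ring.
    - simpl. rewrite IHk. replace (n + S k)%nat with (S (n + k)) by lia. simpl. ring. }
  eapply Clim_ext; [intro k; symmetry; apply E|]. apply Clim_minus; [|apply Clim_const].
  intros eps He. destruct (H eps He) as [N HN]. exists N. intros k Hk. apply HN. lia.
Qed.

Lemma power_series_coef_bound f z0 a r rho : has_power_series f z0 a r -> 0 < rho < r ->
  exists K, 0 < K /\ forall n, Cmod (a n) * rho ^ n <= K.
Proof.
  intros [Hr H] Hrho. specialize (H (z0 + RtoC rho)%C).
  replace (z0 + RtoC rho - z0)%C with (RtoC rho) in H by ring.
  rewrite Cmod_R, Rabs_pos_eq in H by lra. specialize (H (proj2 Hrho)).
  apply is_cseries_term0 in H. destruct (Clim_bounded _ _ H) as [K [HK HB]].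
  exists K. split; auto. intro n. specialize (HB n).
  rewrite Cmod_mult, Cmod_pow, Cmod_R, Rabs_pos_eq in HB by lra. exact HB.
Qed.

Lemma is_series_half : is_series (fun n => (1/2)^n) 2.
Proof. pose proof (is_series_geom (1/2)) as H. replace (/ (1 - 1/2)) with 2 in H by field.
  apply H. rewrite Rabs_pos_eq; lra. Qed.

(** Coefficients are bounded by K / (r/2)^n because the terms tend to 0 on the
    circle of radius r/2; the tail is then dominated by a geometric series of ratio
    1/2. *)
Lemma power_series_tail f z0 a r n : has_power_series f z0 a r -> exists K rho, 0 < K /\
  0 < rho < r /\ forall z, Cmod (z - z0) <= rho ->
  Cmod (f z - csum (fun k => a k * (z - z0) ^ k)%C n) <= K * Cmod (z - z0) ^ n.
Proof.
  intros H. pose proof H as [Hr H0].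
  destruct (power_series_coef_bound f z0 a r (r/2) H ltac:(lra)) as [K [HK HB]].
  assert (0 < (r/2)^n) as Hp by (apply pow_lt; lra).
  exists (K / (r/2)^n * 2), (r/4). repeat split; try lra.
  { apply Rmult_lt_0_compat; [apply Rdiv_lt_0_compat; auto|lra]. }
  intros z Hz. set (w := (z - z0)%C) in *.
  assert (is_cseries (fun n => a n * w ^ n)%C (f z)) as S by (apply H0; fold w; lra).
  apply (is_cseries_shift _ _ n) in S.
  destruct (is_cseries_dominated (fun k => a (n + k)%nat * w ^ (n + k))%C (fun k => K / (r/2)^n *
  Cmod w ^ n * (1/2)^k)) as [l [Hl Bl]].
  - intro k. rewrite Cmod_mult, Cmod_pow, pow_add. specialize (HB (n + k)%nat).
    pose proof (Cmod_ge_0 w). rewrite pow_add in HB.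
    assert (Cmod w ^ k <= (r/4)^k) by (apply pow_incr; lra).
    assert ((r/4)^k = (r/2)^k * (1/2)^k) as E by (rewrite <- Rpow_mult_distr; f_equal; field).
    assert (0 <= Cmod w ^ n) by (apply pow_le; auto). assert (0 < (1/2)^k) by (apply pow_lt; lra).
    assert (0 < (r/2)^k) by (apply pow_lt; lra). pose proof (Cmod_ge_0 (a (n+k)%nat)).
    apply Rle_trans with (Cmod (a (n+k)%nat) * (Cmod w ^ n * ((r/2)^k * (1/2)^k))).
    { apply Rmult_le_compat_l; auto. apply Rmult_le_compat_l; auto. rewrite <- E; auto. }
    apply Rle_trans with (Cmod (a (n+k)%nat) * ((r/2)^n * (r/2)^k) * (Cmod w ^ n * (1/2)^k /
    (r/2)^n)).
    { right. field. lra. }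
    replace (K / (r/2)^n * Cmod w ^ n * (1/2)^k) with (K * (Cmod w ^ n * (1/2)^k / (r/2)^n)) by
    (field; lra).
    apply Rmult_le_compat_r; auto. apply Rmult_le_pos; [apply Rmult_le_pos; lra|].
    left; apply Rinv_0_lt_compat; auto.
  - exists (K / (r/2)^n * Cmod w ^ n * 2). apply (is_series_scal_l _ _ _ is_series_half).
  - rewrite (Clim_unique _ _ _ S Hl).
    assert (is_series (fun k => K / (r/2)^n * Cmod w ^ n * (1/2)^k) (K / (r/2)^n * Cmod w ^ n *
    2)) as HS
      by (apply (is_series_scal_l _ _ _ is_series_half)).
    eapply Rle_trans; [exact Bl|]. apply is_series_unique in HS. right.
    etransitivity; [exact HS|ring].
Qed.

Lemma csum_0 (a : nat -> C) n : (forall k, (k < n)%nat -> a k = 0) -> csum a n = 0.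
Proof. induction n; simpl; intros H; auto. rewrite IHn, H; auto. ring. Qed.

(** If a_n is the first nonzero coefficient, f is about a_n (tau w)^n on the ray,
    which does not vanish for small tau. *)
Lemma power_series_vanish f z0 a r (w : C) delta : has_power_series f z0 a r -> w <> 0 ->
  0 < delta -> (forall tau, 0 < tau < delta -> f (z0 + RtoC tau * w)%C = 0) -> forall n, a n = 0.
Proof.
  intros H Hw Hd Hf n. induction n as [n IH] using lt_wf_ind.
  destruct (power_series_tail f z0 a r (S n) H) as [K [rho [HK [Hrho HT]]]].
  assert (0 < Cmod w) as Hw' by (apply Cmod_gt_0; auto).
  apply Cmod_eq0_eps. intros eps He.
  (* The three bounds keep the point on the ray of zeros, inside the disc of the
     tail estimate, and the tail below eps. *)
  set (tau := Rmin (delta/2) (Rmin (rho / Cmod w) (eps / (2 * K * Cmod w)))).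
  assert (0 < tau) as Ht.
  { apply Rmin_glb_lt; [lra|]. apply Rmin_glb_lt; apply Rdiv_lt_0_compat; try lra.
    apply Rmult_lt_0_compat; lra. }
  assert (tau < delta) by (unfold tau; eapply Rle_lt_trans; [apply Rmin_l|lra]).
  assert (tau * Cmod w <= rho).
  { apply Rle_trans with (rho / Cmod w * Cmod w); [|right; field; lra].
    apply Rmult_le_compat_r; [lra|].
    unfold tau. eapply Rle_trans; [apply Rmin_r|apply Rmin_l]. }
  assert (K * (tau * Cmod w) < eps).
  { apply Rle_lt_trans with (K * (eps / (2 * K * Cmod w) * Cmod w)).
    - apply Rmult_le_compat_l; [lra|]. apply Rmult_le_compat_r; [lra|]. unfold tau.
      eapply Rle_trans; [apply Rmin_r|apply Rmin_r].
    - replace (K * (eps / (2 * K * Cmod w) * Cmod w)) with (eps / 2) by (field; lra). lra. }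
  specialize (HT (z0 + RtoC tau * w)%C). replace (z0 + RtoC tau * w - z0)%C with (RtoC tau * w)%C
  in HT by ring.
  rewrite Cmod_mult, Cmod_R, Rabs_pos_eq in HT by lra. specialize (HT ltac:(auto)).
  rewrite Hf in HT by lra. simpl csum in HT. rewrite csum_0 in HT by (intros k Hk;
  rewrite IH by auto; ring).
  replace (0 - (0 + a n * (RtoC tau * w) ^ n))%C with (- (a n * (RtoC tau * w) ^ n))%C in HT by
  ring.
  rewrite Cmod_opp, Cmod_mult, Cmod_pow, Cmod_mult, Cmod_R, Rabs_pos_eq in HT by lra.
  set (y := tau * Cmod w) in *. assert (0 < y) by (apply Rmult_lt_0_compat; auto).
  assert (0 < y ^ n) by (apply pow_lt; auto). simpl in HT.
  apply Rle_lt_trans with (K * y); auto.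
  apply Rmult_le_reg_r with (y ^ n); auto. rewrite Rmult_assoc. exact HT.
Qed.

Lemma analytic_at_vanish f z0 (w : C) delta : analytic_at f z0 -> w <> 0 -> 0 < delta ->
  (forall tau, 0 < tau < delta -> f (z0 + RtoC tau * w)%C = 0) -> exists r, 0 < r /\
  forall z, Cmod (z - z0) < r -> f z = 0.
Proof.
  intros [a [r H]] Hw Hd Hf. exists r. split; [apply H|]. intros z Hz.
  pose proof (power_series_vanish _ _ _ _ _ _ H Hw Hd Hf) as Ha.
  pose proof (proj2 H z Hz) as S. symmetry. eapply Clim_unique; [|exact S].
  eapply Clim_ext; [|apply Clim_const]. intro n. simpl. symmetry. apply csum_0. intros k _.
  rewrite Ha. ring.
Qed.

(** The identity theorem in the only form needed below: along a segment, zeros near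
    one end propagate to the other end. This replaces connectedness of the domain,
    as the points to be compared can be joined by horizontal segments. *)
Lemma analytic_at_segment f z0 (w : C) delta :
  (forall tau, 0 <= tau <= 1 -> analytic_at f (z0 + RtoC tau * w)%C) -> 0 < delta ->
  (forall tau, 0 <= tau < delta -> f (z0 + RtoC tau * w)%C = 0) -> f (z0 + w)%C = 0.
Proof.
  intros Ha Hd Hf.
  destruct (excluded_middle_informative (w = 0)) as [->|Hw].
  { specialize (Hf 0 ltac:(lra)). replace (z0 + 0)%C with (z0 + RtoC 0 * 0)%C by ring. auto. }
  set (E := fun b => 0 <= b <= 1 /\ forall tau, 0 <= tau < b -> f (z0 + RtoC tau * w)%C = 0).
  (* T is the last parameter up to which f vanishes; vanishing on a disc around the
     point T then contradicts T < 1. *)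
  destruct (completeness E) as [T [HT1 HT2]].
  { exists 1. intros b Hb. apply Hb. }
  { exists 0. split; [lra|]. intros; lra. }
  assert (Rmin delta 1 <= T) as HT0.
  { apply HT1. pose proof (Rmin_l delta 1). pose proof (Rmin_r delta 1).
    assert (0 < Rmin delta 1) by (apply Rmin_glb_lt; lra).
    split; [lra|]. intros tau Ht; apply Hf; lra. }
  assert (0 < T) as HTp by (eapply Rlt_le_trans; [|exact HT0]; apply Rmin_glb_lt; lra).
  assert (T <= 1) as HTle by (apply HT2; intros b Hb; apply Hb).
  assert (forall tau, 0 <= tau < T -> f (z0 + RtoC tau * w)%C = 0) as HTf.
  { intros tau Ht. destruct (excluded_middle_informative (exists b,
    E b /\ tau < b)) as [[b [Hb Hb2]]|N].
    - apply Hb; lra.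
    - exfalso. assert (T <= tau); [|lra]. apply HT2. intros b Hb.
      destruct (Rle_lt_dec b tau); auto. exfalso; apply N; exists b; auto. }
  destruct (analytic_at_vanish f (z0 + RtoC T * w)%C (- w)%C T) as [r [Hr Hz]].
  - apply Ha; lra.
  - intro E0. apply Hw. replace w with (- - w)%C by ring. rewrite E0. ring.
  - auto.
  - intros tau Ht. replace (z0 + T * w + tau * - w)%C with (z0 + RtoC (T - tau) * w)%C by
    (rewrite RtoC_minus; ring).
    apply HTf. lra.
  - assert (0 < Cmod w) as Hw' by (apply Cmod_gt_0; auto).
    assert (forall tau, Rabs (tau - T) < r / Cmod w -> f (z0 + RtoC tau * w)%C = 0) as HN.
    { intros tau Ht. apply Hz. replace (z0 + tau * w - (z0 + T * w))%C with (RtoC (tau - T) *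
      w)%C by (rewrite RtoC_minus; ring).
      rewrite Cmod_mult, Cmod_R. apply Rlt_le_trans with (r / Cmod w * Cmod w); [|right; field;
      lra].
      apply Rmult_lt_compat_r; auto. }
    assert (0 < r / Cmod w) by (apply Rdiv_lt_0_compat; auto).
    destruct (Rle_lt_or_eq_dec _ _ HTle) as [h|h].
    + exfalso. set (b := Rmin 1 (T + r / Cmod w / 2)).
      assert (b <= 1) by apply Rmin_l. assert (b <= T + r / Cmod w / 2) by apply Rmin_r.
      assert (T < b) by (apply Rmin_glb_lt; lra).
      assert (E b) as Eb. { split; [lra|]. intros tau Ht. destruct (Rlt_le_dec tau T).
      - apply HTf; lra.
        - apply HN. rewrite Rabs_pos_eq; lra. }
      specialize (HT1 b Eb). lra.
    + replace (z0 + w)%C with (z0 + RtoC 1 * w)%C by ring. apply HN. rewrite h.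
      rewrite Rminus_diag, Rabs_R0. auto.
Qed.

Lemma analytic_at_ext_loc f g z0 rho : 0 < rho -> (forall z, Cmod (z - z0) < rho -> f z = g z) ->
  analytic_at f z0 -> analytic_at g z0.
Proof.
  intros Hr E [a [r [H0 H]]]. exists a, (Rmin r rho). split; [apply Rmin_glb_lt; auto|].
  intros z Hz. pose proof (Rmin_l r rho); pose proof (Rmin_r r rho). rewrite <- E by lra.
  apply H; lra.
Qed.

Lemma analytic_at_ext f g z0 : (forall z, f z = g z) -> analytic_at f z0 -> analytic_at g z0.
Proof. intros E. apply (analytic_at_ext_loc f g z0 1); auto; lra. Qed.

Lemma analytic_at_plus f g z0 : analytic_at f z0 -> analytic_at g z0 ->
  analytic_at (fun z => f z + g z)%C z0.
Proof.
  intros [a [r [Hr H]]] [b [r' [Hr' H']]]. exists (fun n => a n + b n)%C, (Rmin r r').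
  split; [apply Rmin_glb_lt; auto|].
  intros z Hz. pose proof (Rmin_l r r'); pose proof (Rmin_r r r').
  eapply is_cseries_ext; [|apply is_cseries_plus; [apply H; lra|apply H'; lra]].
  intro n; simpl; ring.
Qed.

Lemma is_cseries_finite (a : nat -> C) n : (forall k, (n <= k)%nat -> a k = 0) ->
  is_cseries a (csum a n).
Proof.
  intros H. assert (forall m, csum a (n + m) = csum a n) as E.
  { induction m. - rewrite Nat.add_0_r; auto. - replace (n + S m)%nat with (S (n + m)) by lia.
    simpl. rewrite IHm, H by lia. ring. }
  intros eps He. exists n. intros m Hm. replace m with (n + (m - n))%nat by lia. rewrite E.
  replace (csum a n - csum a n)%C with (RtoC 0) by ring. rewrite Cmod_0; auto.
Qed.

Lemma analytic_at_const c z0 : analytic_at (fun _ => c) z0.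
Proof.
  exists (fun n => match n with O => c | _ => RtoC 0 end), 1. split; [lra|]. intros z _.
  pose proof (is_cseries_finite (fun n => match n with O => c | _ => RtoC 0 end * (z - z0) ^ n)%C
  1) as K. simpl in K.
  replace (0 + c * 1)%C with c in K by ring. apply K. intros [|k] Hk; [lia|ring].
Qed.

Lemma analytic_at_id z0 : analytic_at (fun z => z) z0.
Proof.
  exists (fun n => match n with O => z0 | 1%nat => RtoC 1 | _ => RtoC 0 end), 1. split; [lra|].
  intros z _.
  pose proof (is_cseries_finite (fun n => match n with O => z0 | 1%nat => RtoC 1 | _ => RtoC 0
  end * (z - z0) ^ n)%C 2) as K. simpl in K.
  replace (0 + z0 * 1 + 1 * ((z - z0) * 1))%C with z in K by ring. apply K.
  intros [|[|k]] Hk; [lia|lia|ring].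
Qed.

Lemma analytic_at_shift f c z0 : analytic_at f (z0 + c)%C ->
  analytic_at (fun z => f (z + c))%C z0.
Proof.
  intros [a [r [Hr H]]]. exists a, r. split; auto. intros z Hz.
  specialize (H (z + c)%C). replace (z + c - (z0 + c))%C with (z - z0)%C in H by ring. auto.
Qed.

Lemma analytic_at_opp_arg f z0 : analytic_at f (- z0)%C -> analytic_at (fun z => f (- z))%C z0.
Proof.
  intros [a [r [Hr H]]]. exists (fun n => (-(1))^n * a n)%C, r. split; auto. intros z Hz.
  specialize (H (- z)%C). replace (- z - - z0)%C with (- (1) * (z - z0))%C in H by ring.
  rewrite Cmod_mult, Cmod_m1, Rmult_1_l in H. eapply is_cseries_ext; [|apply H; auto].
  intro n; simpl. rewrite Cpow_mult_l. ring.
Qed.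

Lemma power_series_abs f z0 a r z : has_power_series f z0 a r -> Cmod (z - z0) < r ->
  ex_series (fun n => Cmod (a n * (z - z0) ^ n)).
Proof.
  intros H Hz. set (w := (z - z0)%C) in *. pose proof (Cmod_ge_0 w).
  set (rho := (Cmod w + r) / 2). destruct (power_series_coef_bound _ _ _ _ rho H) as [K [HK HB]];
  [unfold rho; lra|].
  assert (0 < rho) by (unfold rho; lra).
  apply (ex_series_le (V:=R_CompleteNormedModule)) with (fun n => K * (Cmod w / rho) ^ n).
  - intro n. rewrite Cmod_mult, Cmod_pow. unfold norm; simpl; unfold abs; simpl.
    pose proof (Cmod_ge_0 (a n)). assert (0 <= Cmod w ^ n) by (apply pow_le; auto).
    rewrite Rabs_pos_eq by (apply Rmult_le_pos; auto). specialize (HB n).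
    unfold Rdiv. rewrite Rpow_mult_distr, pow_inv. assert (0 < rho ^ n) by (apply pow_lt; auto).
    replace (Cmod (a n) * Cmod w ^ n) with (Cmod (a n) * rho ^ n * (Cmod w ^ n * / rho ^ n)) by
    (field; lra).
    apply Rmult_le_compat_r; auto. apply Rmult_le_pos; auto. left; apply Rinv_0_lt_compat; auto.
  - exists (K * / (1 - Cmod w / rho)). refine (is_series_scal_l K (fun n => (Cmod w / rho) ^ n) _
    _). apply is_series_geom.
    rewrite Rabs_pos_eq by (apply Rmult_le_pos; [auto|left; apply Rinv_0_lt_compat; auto]).
    apply Rmult_lt_reg_r with rho; auto. unfold Rdiv. rewrite Rmult_assoc, Rinv_l by lra.
    unfold rho in *; lra.
Qed.

Lemma csum_sum_f_R0_Re a n : Re (csum a (S n)) = sum_f_R0 (fun k => Re (a k)) n.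
Proof. rewrite csum_Re. apply sum_n_Reals. Qed.
Lemma csum_sum_f_R0_Im a n : Im (csum a (S n)) = sum_f_R0 (fun k => Im (a k)) n.
Proof. rewrite csum_Im. apply sum_n_Reals. Qed.

(** Reduced to the real theorem on Cauchy products, applied to the four products of
    real and imaginary parts. *)
Lemma is_cseries_mult a b la lb : is_cseries a la -> is_cseries b lb ->
  ex_series (fun n => Cmod (a n)) -> ex_series (fun n => Cmod (b n)) ->
  is_cseries (fun n => csum (fun k => a k * b (n - k)%nat)%C (S n)) (la * lb)%C.
Proof.
  intros Ha Hb Aa Ab. apply is_cseries_parts in Ha. apply is_cseries_parts in Hb.
  destruct Ha as [Ha1 Ha2], Hb as [Hb1 Hb2].
  assert (forall u : nat -> C, ex_series (fun n => Cmod (u n)) -> ex_series (fun n => Rabs (Re (u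
  n))) /\ ex_series (fun n => Rabs (Im (u n)))) as D.
  { intros u Hu. split; apply (ex_series_le (V:=R_CompleteNormedModule)) with (2 := Hu); intro n;
    unfold norm; simpl; unfold abs; simpl; rewrite Rabs_Rabsolu.
    apply re_le_Cmod. apply im_le_Cmod. }
  destruct (D a Aa) as [Da1 Da2]. destruct (D b Ab) as [Db1 Db2].
  apply is_cseries_parts. split.
  - eapply is_series_ext; [|apply (is_series_minus _ _ _ _ (is_series_mult _ _ _ _ Ha1 Hb1 Da1
    Db1) (is_series_mult _ _ _ _ Ha2 Hb2 Da2 Db2))].
    intro n. rewrite csum_sum_f_R0_Re. unfold plus, opp; simpl. 
    match goal with |- ?p + - ?q = _ => change (p - q = sum_f_R0 (fun k => Re (a k * b (n -
    k)%nat)%C) n) end.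
    rewrite <- minus_sum. apply sum_eq. intros i _. reflexivity.
  - eapply is_series_ext; [|apply (is_series_plus _ _ _ _ (is_series_mult _ _ _ _ Ha1 Hb2 Da1
    Db2) (is_series_mult _ _ _ _ Ha2 Hb1 Da2 Db1))].
    intro n. rewrite csum_sum_f_R0_Im. unfold plus; simpl. rewrite <- plus_sum. apply sum_eq.
    intros i _. reflexivity.
Qed.

Lemma analytic_at_mult f g z0 : analytic_at f z0 -> analytic_at g z0 ->
  analytic_at (fun z => f z * g z)%C z0.
Proof.
  intros [a [r Hf]] [b [r' Hg]]. exists (fun n => csum (fun k => a k * b (n - k)%nat)%C (S n)),
  (Rmin r r').
  pose proof (Rmin_l r r'); pose proof (Rmin_r r r').
  split; [apply Rmin_glb_lt; [apply Hf|apply Hg]|]. intros z Hz.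
  eapply is_cseries_ext; [|apply is_cseries_mult; [apply Hf; lra|apply Hg;
  lra|eapply power_series_abs; eauto; lra|eapply power_series_abs; eauto; lra]].
  intro n. cbv beta. rewrite Cmult_comm, <- csum_scal. apply csum_ext. intros k Hk. simpl.
  replace n with (k + (n - k))%nat at 3 by lia. rewrite Cpow_add_r. ring.
Qed.

Lemma analytic_at_scal c f z0 : analytic_at f z0 -> analytic_at (fun z => c * f z)%C z0.
Proof. intros. apply analytic_at_mult; auto. apply analytic_at_const. Qed.
Lemma analytic_at_opp f z0 : analytic_at f z0 -> analytic_at (fun z => - f z)%C z0.
Proof. intros H. eapply analytic_at_ext; [|apply (analytic_at_scal (-(1))%C _ _ H)].
  intro; simpl; ring. Qed.
Lemma analytic_at_minus f g z0 : analytic_at f z0 -> analytic_at g z0 ->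
  analytic_at (fun z => f z - g z)%C z0.
Proof. intros. apply analytic_at_plus; auto. apply analytic_at_opp; auto. Qed.

Lemma is_cseries_geom z : Cmod z < 1 -> is_cseries (fun n => z ^ n)%C (/ (1 - z))%C.
Proof.
  intros H. assert (1 - z <> 0)%C as N. { intro E.
  assert (z = 1) by (replace z with (1 - (1 - z))%C by ring; rewrite E; ring). subst.
  rewrite Cmod_1 in H; lra. }
  apply Clim_bound with (fun n => Cmod z ^ n / Cmod (1 - z)).
  - intro n. assert (csum (fun n => z ^ n)%C n = (1 - z ^ n) / (1 - z))%C as ->.
    { induction n; simpl; [|rewrite IHn]; field; auto. }
    replace ((1 - z ^ n) / (1 - z) - / (1 - z))%C with (- (z ^ n / (1 - z)))%C by (field; auto).
    rewrite Cmod_opp, Cmod_div, Cmod_pow by auto. lra.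
  - replace (Finite 0) with (Rbar_mult 0 (/ Cmod (1 - z))) by (simpl; f_equal; ring).
    apply is_lim_seq_scal_r. apply is_lim_seq_geom. rewrite Rabs_pos_eq; auto. apply Cmod_ge_0.
Qed.

Lemma analytic_at_inv (z0 : C) : z0 <> 0 -> analytic_at (fun z => / z)%C z0.
Proof.
  intros Hz0. assert (0 < Cmod z0) by (apply Cmod_gt_0; auto).
  exists (fun n => / z0 * (- / z0) ^ n)%C, (Cmod z0). split; auto. intros z Hz.
  assert (z <> 0). { intros ->. replace (0 - z0)%C with (- z0)%C in Hz by ring.
  rewrite Cmod_opp in Hz; lra. }
  apply is_cseries_ext with (fun n => / z0 * (- / z0 * (z - z0)) ^ n)%C; [intro n;
  rewrite Cpow_mult_l; ring|].
  replace (/ z)%C with (/ z0 * / (1 - (- / z0 * (z - z0))))%C.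
  - apply is_cseries_scal, is_cseries_geom. rewrite Cmod_mult, Cmod_opp, Cmod_inv by auto.
    apply Rmult_lt_reg_l with (Cmod z0); auto. rewrite <- Rmult_assoc, Rinv_r by lra. lra.
  - field; auto.
Qed.

(** * First order expansions *)
(** A quadratic error term makes products and translations work without any limit
    argument, and it determines both the value and the derivative
    ([first_order_unique], [first_order_deriv]). *)
Definition first_order (f : C -> C) (z0 f0 f1 : C) : Prop :=
  exists K rho, 0 < K /\ 0 < rho /\ forall z, Cmod (z - z0) <= rho ->
    Cmod (f z - (f0 + f1 * (z - z0))) <= K * Cmod (z - z0) ^ 2.

Lemma power_series_first_order f z0 a r : has_power_series f z0 a r ->
  first_order f z0 (a 0%nat) (a 1%nat).
Proof.
  intros H. destruct (power_series_tail f z0 a r 2 H) as [K [rho [HK [Hr HT]]]]. exists K, rho.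
  repeat split; try tauto.
  intros z Hz. specialize (HT z Hz). simpl csum in HT.
  replace (0 + a 0%nat * 1 + a 1%nat * ((z - z0) * 1))%C with (a 0%nat + a 1%nat * (z - z0))%C in
  HT by ring. auto.
Qed.

Lemma first_order_value f z0 f0 f1 : first_order f z0 f0 f1 -> f z0 = f0.
Proof.
  intros [K [rho [HK [Hr H]]]]. specialize (H z0). replace (z0 - z0)%C with (RtoC 0) in H by ring.
  rewrite Cmod_0 in H. specialize (H ltac:(lra)). simpl in H.
  apply Ceq_minus, Cmod_eq_0. replace (f z0 - f0)%C with (f z0 - (f0 + f1 * 0))%C by ring.
  pose proof (Cmod_ge_0 (f z0 - (f0 + f1 * 0))%C). lra.
Qed.

Lemma analytic_at_first_order f z0 : analytic_at f z0 -> exists f1, first_order f z0 (f z0) f1.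
Proof.
  intros [a [r H]]. exists (a 1%nat). pose proof (power_series_first_order _ _ _ _ H) as K.
  rewrite (first_order_value _ _ _ _ K). auto.
Qed.

Lemma first_order_deriv f z0 f0 f1 : first_order f z0 f0 f1 -> C_derive f z0 = f1.
Proof.
  intros H. pose proof (first_order_value _ _ _ _ H) as E. apply is_C_derive_unique. split.
  - apply is_linear_scal_l.
  - intros x Hx. pose proof (is_filter_lim_locally_unique (V:=AbsRing_NormedModule C_AbsRing) _ _
    Hx) as Ex. subst x.
    destruct H as [K [rho [HK [Hr H]]]]. intros [eps He].
    assert (0 < Rmin rho (eps / K)) as Hd by (apply Rmin_glb_lt; auto; apply Rdiv_lt_0_compat;
    auto).
    exists (mkposreal _ Hd). intros z Hz.
    change (Cmod (z - z0) < Rmin rho (eps/K)) in Hz.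
    pose proof (Rmin_l rho (eps/K)); pose proof (Rmin_r rho (eps/K)).
    change (Cmod (f z - f z0 - (z - z0) * f1) <= eps * Cmod (z - z0)).
    rewrite E. replace (f z - f0 - (z - z0) * f1)%C with (f z - (f0 + f1 * (z - z0)))%C by ring.
    eapply Rle_trans; [apply H; lra|]. simpl. pose proof (Cmod_ge_0 (z - z0)).
    rewrite Rmult_1_r, <- Rmult_assoc. apply Rmult_le_compat_r; auto.
    replace eps with (K * (eps / K)) by (field; lra). apply Rmult_le_compat_l; lra.
Qed.

Lemma first_order_unique f z0 f0 f1 g0 g1 : first_order f z0 f0 f1 -> first_order f z0 g0 g1 ->
  f0 = g0 /\ f1 = g1.
Proof.
  intros H H'. split. rewrite <- (first_order_value _ _ _ _ H).
  apply (first_order_value _ _ _ _ H').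
  rewrite <- (first_order_deriv _ _ _ _ H). apply (first_order_deriv _ _ _ _ H').
Qed.

Lemma first_order_loc f g z0 f0 f1 d : 0 < d -> (forall z, Cmod (z - z0) < d -> f z = g z) ->
  first_order f z0 f0 f1 -> first_order g z0 f0 f1.
Proof.
  intros Hd E [K [rho [HK [Hr H]]]]. exists K, (Rmin rho (d/2)).
  repeat split; auto; [apply Rmin_glb_lt; lra|].
  intros z Hz. pose proof (Rmin_l rho (d/2)); pose proof (Rmin_r rho (d/2)). rewrite <- E by lra.
  apply H; lra.
Qed.

Lemma first_order_plus f g z0 f0 f1 g0 g1 : first_order f z0 f0 f1 -> first_order g z0 g0 g1 ->
  first_order (fun z => f z + g z)%C z0 (f0 + g0)%C (f1 + g1)%C.
Proof.
  intros [K [rho [HK [Hr H]]]] [K' [rho' [HK' [Hr' H']]]]. exists (K + K'), (Rmin rho rho').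
  repeat split; [lra|apply Rmin_glb_lt; auto|].
  intros z Hz. pose proof (Rmin_l rho rho'); pose proof (Rmin_r rho rho').
  specialize (H z ltac:(lra)); specialize (H' z ltac:(lra)).
  replace (f z + g z - (f0 + g0 + (f1 + g1) * (z - z0)))%C with ((f z - (f0 + f1 * (z - z0))) +
  (g z - (g0 + g1 * (z - z0))))%C by ring.
  eapply Rle_trans; [apply Cmod_triangle|]. lra.
Qed.

Lemma first_order_mult f g z0 f0 f1 g0 g1 : first_order f z0 f0 f1 -> first_order g z0 g0 g1 ->
  first_order (fun z => f z * g z)%C z0 (f0 * g0)%C (f1 * g0 + f0 * g1)%C.
Proof.
  intros [K [rho [HK [Hr H]]]] [K' [rho' [HK' [Hr' H']]]].
  set (m := Rmin 1 (Rmin rho rho')).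
  assert (m <= 1) by apply Rmin_l. assert (m <= rho) by (eapply Rle_trans;
  [apply Rmin_r|apply Rmin_l]).
  assert (m <= rho') by (eapply Rle_trans; [apply Rmin_r|apply Rmin_r]).
  assert (0 < m) by (apply Rmin_glb_lt; [lra|apply Rmin_glb_lt; auto]).
  pose proof (Cmod_ge_0 f0). pose proof (Cmod_ge_0 f1). pose proof (Cmod_ge_0 g0).
  pose proof (Cmod_ge_0 g1).
  exists (Cmod f1 * Cmod g1 + (Cmod f0 + Cmod f1) * K' + K * (Cmod g0 + Cmod g1 + K') + 1), m.
  repeat split; auto.
  { assert (0 <= (Cmod f0 + Cmod f1) * K') by (apply Rmult_le_pos; lra).
    assert (0 <= K * (Cmod g0 + Cmod g1 + K')) by (apply Rmult_le_pos; lra).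
    assert (0 <= Cmod f1 * Cmod g1) by (apply Rmult_le_pos; lra). lra. }
  intros z Hz. specialize (H z ltac:(lra)); specialize (H' z ltac:(lra)).
  set (w := (z - z0)%C) in *. set (A := (f0 + f1 * w)%C) in *. set (B := (g0 + g1 * w)%C) in *.
  replace (f z * g z - (f0 * g0 + (f1 * g0 + f0 * g1) * w))%C with
    (f1 * g1 * w ^ 2 + (A * (g z - B) + (f z - A) * (B + (g z - B))))%C by (unfold A, B; simpl;
    ring).
  pose proof (Cmod_ge_0 w). set (y := Cmod w) in *.
  assert (y ^ 2 <= 1) by (simpl; nra). assert (0 <= y ^ 2) by (simpl; nra).
  assert (Cmod A <= Cmod f0 + Cmod f1). { eapply Rle_trans; [apply Cmod_triangle|].
  rewrite Cmod_mult. fold y. nra. }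
  assert (Cmod B <= Cmod g0 + Cmod g1). { eapply Rle_trans; [apply Cmod_triangle|].
  rewrite Cmod_mult. fold y. nra. }
  eapply Rle_trans; [apply Cmod_triangle|]. rewrite !Cmod_mult, Cmod_pow. fold y.
  eapply Rle_trans; [apply Rplus_le_compat_l, Cmod_triangle|]. rewrite !Cmod_mult.
  assert (Cmod (B + (g z - B)) <= Cmod g0 + Cmod g1 + K').
  { eapply Rle_trans; [apply Cmod_triangle|]. assert (K' * y ^ 2 <= K' * 1) by (apply
    Rmult_le_compat_l; lra). lra. }
  assert (Cmod A * Cmod (g z - B) <= (Cmod f0 + Cmod f1) * (K' * y ^ 2)) by (apply
  Rmult_le_compat; auto using Cmod_ge_0).
  assert (Cmod (f z - A) * Cmod (B + (g z - B)) <= (K * y ^ 2) * (Cmod g0 + Cmod g1 + K')) by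
  (apply Rmult_le_compat; auto using Cmod_ge_0).
  lra.
Qed.

Lemma first_order_const c z0 : first_order (fun _ => c) z0 c 0.
Proof.
  exists 1, 1. repeat split; try lra. intros z _.
  replace (c - (c + 0 * (z - z0)))%C with (RtoC 0) by ring. rewrite Cmod_0.
  rewrite Rmult_1_l. apply pow2_ge_0.
Qed.
Lemma first_order_id z0 : first_order (fun z => z) z0 z0 1.
Proof.
  exists 1, 1. repeat split; try lra. intros z _.
  replace (z - (z0 + 1 * (z - z0)))%C with (RtoC 0) by ring. rewrite Cmod_0.
  rewrite Rmult_1_l. apply pow2_ge_0.
Qed.
Lemma first_order_shift f c z0 f0 f1 : first_order f (z0 + c)%C f0 f1 ->
  first_order (fun z => f (z + c))%C z0 f0 f1.
Proof.
  intros [K [rho [HK [Hr H]]]]. exists K, rho. repeat split; auto. intros z Hz.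
  specialize (H (z + c)%C).
  replace (z + c - (z0 + c))%C with (z - z0)%C in H by ring. auto.
Qed.

(** * Componentwise calculus *)

(** Derivatives, continuity and integrals are taken componentwise, so that every
    fact reduces to the real one; the price is the factor 2 in [cint_norm]. *)
Definition ccont (f : R -> C) (t : R) : Prop :=
  continuous (fun u => Re (f u)) t /\ continuous (fun u => Im (f u)) t.
Definition cder (f : R -> C) (t : R) (l : C) : Prop :=
  is_derive (fun u => Re (f u)) t (Re l) /\ is_derive (fun u => Im (f u)) t (Im l).
Definition cint (f : R -> C) (a b : R) : C := (RInt (fun u => Re (f u)) a b,
  RInt (fun u => Im (f u)) a b).

Ltac continuity_by_derive := apply (ex_derive_continuous (V:=R_NormedModule)); auto_derive.

Lemma rcont_plus (f g : R -> R) t : continuous f t -> continuous g t ->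
  continuous (fun u => f u + g u) t.
Proof. intros. apply (continuous_plus f g); auto. Qed.
Lemma rcont_minus (f g : R -> R) t : continuous f t -> continuous g t ->
  continuous (fun u => f u - g u) t.
Proof. intros. apply (continuous_minus f g); auto. Qed.
Lemma rcont_mult (f g : R -> R) t : continuous f t -> continuous g t ->
  continuous (fun u => f u * g u) t.
Proof. intros. apply (continuous_mult f g); auto. Qed.

Lemma ccont_const c t : ccont (fun _ => c) t.
Proof. split; apply continuous_const. Qed.
Lemma ccont_RtoC (f : R -> R) t : continuous f t -> ccont (fun u => RtoC (f u)) t.
Proof. intros; split; simpl; auto. apply continuous_const. Qed.
Lemma ccont_plus f g t : ccont f t -> ccont g t -> ccont (fun u => f u + g u)%C t.
Proof. intros [? ?] [? ?]; split; simpl; apply rcont_plus; auto. Qed.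
Lemma ccont_mult f g t : ccont f t -> ccont g t -> ccont (fun u => f u * g u)%C t.
Proof. intros [? ?] [? ?]; split; simpl; [apply rcont_minus|apply rcont_plus]; apply rcont_mult;
  auto. Qed.
Lemma ccont_minus f g t : ccont f t -> ccont g t -> ccont (fun u => f u - g u)%C t.
Proof. intros [? ?] [? ?]; split; simpl; apply rcont_minus; auto. Qed.
Lemma ccont_pow f n t : ccont f t -> ccont (fun u => f u ^ n)%C t.
Proof. intros; induction n; simpl. - apply ccont_const.
  - apply (ccont_mult f (fun u => f u ^ n)%C); auto. Qed.
Lemma ccont_csum (f : nat -> R -> C) n t : (forall k, ccont (f k) t) ->
  ccont (fun u => csum (fun k => f k u) n) t.
Proof. intros; induction n; simpl. - apply ccont_const. - apply ccont_plus; auto. Qed.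
Lemma ccont_comp f (g : R -> R) t : continuous g t -> ccont f (g t) -> ccont (fun u => f (g u)) t.
Proof. intros H [? ?]; split; [apply (continuous_comp g (fun u => Re (f u)))|apply
  (continuous_comp g (fun u => Im (f u)))]; auto. Qed.
Lemma ccont_ext_loc f g t : locally t (fun u => f u = g u) -> ccont f t -> ccont g t.
Proof.
  intros E [H1 H2]; split; [eapply continuous_ext_loc; [|exact H1]|eapply continuous_ext_loc;
  [|exact H2]];
    apply filter_imp with (2 := E); intros u Hu; rewrite Hu; auto.
Qed.

Lemma rder_plus (f g : R -> R) t l m : is_derive f t l -> is_derive g t m ->
  is_derive (fun u => f u + g u) t (l + m).
Proof. intros. apply (is_derive_plus (V:=R_NormedModule) f g); auto. Qed.
Lemma rder_minus (f g : R -> R) t l m : is_derive f t l -> is_derive g t m ->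
  is_derive (fun u => f u - g u) t (l - m).
Proof. intros. apply (is_derive_minus (V:=R_NormedModule) f g); auto. Qed.
Lemma rder_mult (f g : R -> R) t l m : is_derive f t l -> is_derive g t m ->
  is_derive (fun u => f u * g u) t (l * g t + f t * m).
Proof. apply Derive.is_derive_mult. Qed.
Lemma rder_eq (f : R -> R) t l m : is_derive f t l -> l = m -> is_derive f t m.
Proof. intros H <-; auto. Qed.

Lemma cder_eq (f : R -> C) t l m : cder f t l -> l = m -> cder f t m.
Proof. intros H <-; auto. Qed.

Lemma cder_const c t : cder (fun _ => c) t 0.
Proof. split; apply (is_derive_const (V:=R_NormedModule)). Qed.
Lemma cder_RtoC (f : R -> R) t l : is_derive f t l -> cder (fun u => RtoC (f u)) t (RtoC l).
Proof. intros; split; simpl; auto. apply (is_derive_const (V:=R_NormedModule)). Qed.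
Lemma cder_plus f g t l m : cder f t l -> cder g t m -> cder (fun u => f u + g u)%C t (l + m)%C.
Proof. intros [? ?] [? ?]; split; [apply (rder_plus (fun u => Re (f u)) (fun u => Re (g
  u)))|apply (rder_plus (fun u => Im (f u)) (fun u => Im (g u)))]; auto. Qed.
Lemma cder_minus f g t l m : cder f t l -> cder g t m -> cder (fun u => f u - g u)%C t (l - m)%C.
Proof. intros [? ?] [? ?]; split; [apply (rder_minus (fun u => Re (f u)) (fun u => Re (g
  u)))|apply (rder_minus (fun u => Im (f u)) (fun u => Im (g u)))]; auto. Qed.
Lemma cder_mult f g t l m : cder f t l -> cder g t m ->
  cder (fun u => f u * g u)%C t (l * g t + f t * m)%C.
Proof.
  intros [H1 H2] [H3 H4]; split.
  - eapply rder_eq; [apply (rder_minus _ _ _ _ _ (rder_mult _ _ _ _ _ H1 H3) (rder_mult _ _ _ _ _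
    H2 H4))|]. unfold Re, Im; simpl; ring.
  - eapply rder_eq; [apply (rder_plus _ _ _ _ _ (rder_mult _ _ _ _ _ H1 H4) (rder_mult _ _ _ _ _
    H2 H3))|]. unfold Re, Im; simpl; ring.
Qed.
Lemma cder_scal c f t l : cder f t l -> cder (fun u => c * f u)%C t (c * l)%C.
Proof. intros H. replace (c * l)%C with (0 * f t + c * l)%C by ring. apply cder_mult; auto.
  apply cder_const. Qed.
Lemma cder_comp f (g : R -> R) t l m : cder f (g t) l -> is_derive g t m ->
  cder (fun u => f (g u)) t (RtoC m * l)%C.
Proof.
  intros [H1 H2] H. split.
  - eapply rder_eq; [apply (is_derive_comp (fun u => Re (f u)) g); [exact H1|exact H]|].
    unfold scal; simpl; unfold mult; simpl; unfold Re, Im; simpl; ring.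
  - eapply rder_eq; [apply (is_derive_comp (fun u => Im (f u)) g); [exact H2|exact H]|].
    unfold scal; simpl; unfold mult; simpl; unfold Re, Im; simpl; ring.
Qed.
Lemma cder_ext f g t l : (forall u, f u = g u) -> cder f t l -> cder g t l.
Proof. intros E [H1 H2]; split. apply is_derive_ext with (2 := H1); intro; rewrite E; auto.
  apply is_derive_ext with (2 := H2); intro; rewrite E; auto. Qed.
Lemma cder_ccont f t l : cder f t l -> ccont f t.
Proof. intros [H1 H2]; split; apply (ex_derive_continuous (V:=R_NormedModule)); eexists; eauto.
  Qed.

Lemma cex_RInt f a b : a <= b -> (forall u, a <= u <= b -> ccont f u) ->
  ex_RInt (fun u => Re (f u)) a b /\ ex_RInt (fun u => Im (f u)) a b.
Proof.
  intros Hab H. split; apply (ex_RInt_continuous (V:=R_CompleteNormedModule)); intros z Hz;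
  rewrite Rmin_left, Rmax_right in Hz by auto; apply H; auto.
Qed.

Lemma cint_plus f g a b : a <= b -> (forall u, a <= u <= b -> ccont f u) ->
  (forall u, a <= u <= b -> ccont g u) -> cint (fun u => f u + g u)%C a b =
  (cint f a b + cint g a b)%C.
Proof.
  intros Hab Hf Hg. destruct (cex_RInt _ _ _ Hab Hf), (cex_RInt _ _ _ Hab Hg). unfold cint.
  apply injective_projections; simpl; apply (RInt_plus (V:=R_CompleteNormedModule)); auto.
Qed.

Lemma cint_scal c f a b : a <= b -> (forall u, a <= u <= b -> ccont f u) ->
  cint (fun u => c * f u)%C a b = (c * cint f a b)%C.
Proof.
  intros Hab Hf. destruct (cex_RInt _ _ _ Hab Hf) as [H1 H2]. unfold cint.
  assert (forall k (g : R -> R), ex_RInt g a b -> ex_RInt (fun u => k * g u) a b) as S.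
  { intros k g Hg. apply (ex_RInt_scal (V:=R_NormedModule) g); auto. }
  assert (forall k (g : R -> R), ex_RInt g a b -> RInt (fun u => k * g u) a b = k * RInt g a b)
  as S'.
  { intros k g Hg. apply (RInt_scal (V:=R_CompleteNormedModule) g); auto. }
  apply injective_projections; simpl.
  - unfold Re, Im in *; simpl. rewrite <- (S' _ _ H1), <- (S' _ _ H2).
    apply (RInt_minus (V:=R_CompleteNormedModule)); apply S; auto.
  - unfold Re, Im in *; simpl. rewrite <- (S' _ _ H1), <- (S' _ _ H2).
    apply (RInt_plus (V:=R_CompleteNormedModule)); apply S; auto.
Qed.

Lemma cint_ext f g a b : a <= b -> (forall u, a < u < b -> f u = g u) -> cint f a b = cint g a b.
Proof.
  intros Hab H. unfold cint. f_equal; apply RInt_ext; rewrite Rmin_left, Rmax_right by auto;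
  intros u Hu; rewrite H; auto.
Qed.

Lemma cint_norm f (g : R -> R) a b : a <= b -> (forall u, a <= u <= b -> ccont f u) ->
  (forall u, a <= u <= b -> continuous g u) -> (forall u, a <= u <= b -> Cmod (f u) <= g u) ->
  Cmod (cint f a b) <= 2 * RInt g a b.
Proof.
  intros Hab Hf Hg H. destruct (cex_RInt _ _ _ Hab Hf) as [H1 H2].
  assert (ex_RInt g a b) as H3.
  { apply (ex_RInt_continuous (V:=R_CompleteNormedModule)); intros z Hz;
    rewrite Rmin_left, Rmax_right in Hz by auto; auto. }
  eapply Rle_trans; [apply Cmod_parts|]. unfold cint; unfold Re at 1; unfold Im at 1; simpl.
  assert (Rabs (RInt (fun u => Re (f u)) a b) <= RInt g a b).
  { apply (norm_RInt_le (V:=R_NormedModule) (fun u => Re (f u)) g a b); auto;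
    try (apply (RInt_correct (V:=R_CompleteNormedModule)); auto).
    intros u Hu. eapply Rle_trans; [apply re_le_Cmod|apply H; auto]. }
  assert (Rabs (RInt (fun u => Im (f u)) a b) <= RInt g a b).
  { apply (norm_RInt_le (V:=R_NormedModule) (fun u => Im (f u)) g a b); auto;
    try (apply (RInt_correct (V:=R_CompleteNormedModule)); auto).
    intros u Hu. eapply Rle_trans; [apply im_le_Cmod|apply H; auto]. }
  lra.
Qed.

Lemma cint_norm_const f B a b : a <= b -> (forall u, a <= u <= b -> ccont f u) ->
  (forall u, a <= u <= b -> Cmod (f u) <= B) -> Cmod (cint f a b) <= 2 * ((b - a) * B).
Proof.
  intros Hab Hf H. eapply Rle_trans; [apply (cint_norm f (fun _ => B)); auto|].
  - intros; apply continuous_const. - rewrite RInt_const. right. reflexivity.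
Qed.

Lemma cint_FTC F f a b : a <= b -> (forall u, a <= u <= b -> cder F u (f u)) ->
  (forall u, a <= u <= b -> ccont f u) -> cint f a b = (F b - F a)%C.
Proof.
  intros Hab HF Hf. unfold cint. apply injective_projections; simpl.
  - apply is_RInt_unique. apply (is_RInt_derive (V:=R_CompleteNormedModule) (fun u => Re (F u)));
    rewrite Rmin_left, Rmax_right by auto; intros u Hu; [apply HF|apply Hf]; auto.
  - apply is_RInt_unique. apply (is_RInt_derive (V:=R_CompleteNormedModule) (fun u => Im (F u)));
    rewrite Rmin_left, Rmax_right by auto; intros u Hu; [apply HF|apply Hf]; auto.
Qed.

Lemma cint_Chasles f a b c : a <= b <= c -> (forall u, a <= u <= c -> ccont f u) ->
  (cint f a b + cint f b c)%C = cint f a c.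
Proof.
  intros Hab Hf. destruct (cex_RInt f a b) as [? ?]; [lra|intros; apply Hf; lra|].
  destruct (cex_RInt f b c) as [? ?]; [lra|intros; apply Hf; lra|].
  apply injective_projections; simpl; apply (RInt_Chasles (V:=R_CompleteNormedModule)); auto.
Qed.

Lemma cint_comp_lin f u v a b : 0 < u -> a <= b ->
  (forall y, a <= y <= b -> ccont f (u * y + v)) ->
  cint (fun y => RtoC u * f (u * y + v)%R)%C a b = cint f (u * a + v) (u * b + v).
Proof.
  intros Hu Hab Hf.
  assert (forall y, u * a + v <= y <= u * b + v -> ccont f y) as Hf'.
  { intros y Hy. replace y with (u * ((y - v) / u) + v) by (field; lra). apply Hf.
    split; apply Rmult_le_reg_l with u; auto; replace (u * ((y - v) / u)) with (y - v) by (field;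
    lra); lra. }
  destruct (cex_RInt f (u * a + v) (u * b + v)) as [? ?]; auto. { nra. }
  apply injective_projections; simpl; etransitivity.
  - apply RInt_ext. intros y _. unfold Re; simpl. rewrite Rmult_0_l, Rminus_0_r. reflexivity.
  - apply (RInt_comp_lin (V:=R_CompleteNormedModule) (fun u => Re (f u))); auto.
  - apply RInt_ext. intros y _. unfold Im; simpl. rewrite Rmult_0_l, Rplus_0_r. reflexivity.
  - apply (RInt_comp_lin (V:=R_CompleteNormedModule) (fun u => Im (f u))); auto.
Qed.

(** * Complex exponential and powers *)
Definition cexp (z : C) : C := (exp (Re z) * cos (Im z), exp (Re z) * sin (Im z)).

Lemma cexp_plus a b : cexp (a + b)%C = (cexp a * cexp b)%C.
Proof.
  unfold cexp. change (Re (a + b)%C) with (Re a + Re b). change (Im (a + b)%C) with (Im a + Im b).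
  rewrite exp_plus, cos_plus, sin_plus. apply injective_projections; simpl; ring.
Qed.
Lemma cexp_0 : cexp 0 = 1.
Proof. unfold cexp. simpl. rewrite exp_0, cos_0, sin_0. apply injective_projections; simpl; ring.
  Qed.
Lemma cexp_RtoC a : cexp (RtoC a) = RtoC (exp a).
Proof. unfold cexp. simpl. rewrite cos_0, sin_0. apply injective_projections; simpl; ring. Qed.
Lemma Cmod_cexp z : Cmod (cexp z) = exp (Re z).
Proof.
  unfold Cmod, cexp; simpl. set (e := exp (Re z)). assert (0 < e) by apply exp_pos.
  replace (e * cos (Im z) * (e * cos (Im z) * 1) + e * sin (Im z) * (e * sin (Im z) * 1)) with (e
  * e).
  - apply sqrt_square; lra.
  - pose proof (sin2_cos2 (Im z)) as K. unfold Rsqr in K.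
    replace (e * e) with (e * e * (sin (Im z) * sin (Im z) + cos (Im z) * cos (Im z))) by
    (rewrite K; ring). ring.
Qed.

Lemma cder_cexp (f : R -> C) t l : cder f t l -> cder (fun u => cexp (f u)) t (l * cexp (f t))%C.
Proof.
  intros [H1 H2]. split; unfold cexp; simpl.
  - eapply rder_eq; [apply rder_mult|].
    + apply (is_derive_comp exp (fun u => Re (f u))); [apply is_derive_exp|exact H1].
    + apply (is_derive_comp cos (fun u => Im (f u))); [apply is_derive_cos|exact H2].
    + unfold scal; simpl; unfold mult; simpl. unfold Re, Im; simpl; ring.
  - eapply rder_eq; [apply rder_mult|].
    + apply (is_derive_comp exp (fun u => Re (f u))); [apply is_derive_exp|exact H1].
    + apply (is_derive_comp sin (fun u => Im (f u))); [apply is_derive_sin|exact H2].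
    + unfold scal; simpl; unfold mult; simpl. unfold Re, Im; simpl; ring.
Qed.

Lemma ccont_cexp f t : ccont f t -> ccont (fun u => cexp (f u)) t.
Proof.
  intros [H1 H2]. split; unfold cexp; simpl; apply rcont_mult.
  - apply (continuous_comp (fun u => Re (f u)) exp); auto. apply continuous_exp.
  - apply (continuous_comp (fun u => Im (f u)) cos); auto. apply continuous_cos.
  - apply (continuous_comp (fun u => Re (f u)) exp); auto. apply continuous_exp.
  - apply (continuous_comp (fun u => Im (f u)) sin); auto. apply continuous_sin.
Qed.

Definition cexp_poly (n : nat) (z : C) : C := csum (fun k => z ^ k / RtoC (INR (fact k)))%C n.

Lemma RtoC_fact_neq n : RtoC (INR (fact n)) <> 0.
Proof. intro E. apply RtoC_inj in E. apply (INR_fact_neq_0 n E). Qed.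

Lemma Re_le_Cmod z : Re z <= Cmod z.
Proof. eapply Rle_trans; [apply Rle_abs|apply re_le_Cmod]. Qed.

Lemma cder_id_scal z t : cder (fun u => RtoC u * z)%C t z.
Proof.
  apply cder_eq with (RtoC 1 * z + RtoC t * 0)%C; [|ring]. apply cder_mult; [|apply cder_const].
  apply cder_RtoC. apply (is_derive_id (K:=R_AbsRing)).
Qed.

Lemma cder_pow f t l n : cder f t l ->
  cder (fun u => f u ^ (S n))%C t (RtoC (INR (S n)) * l * f t ^ n)%C.
Proof.
  intros H. induction n.
  - simpl. replace (RtoC 1 * l * 1)%C with l by ring. apply cder_ext with f; auto.
    intro; simpl; ring.
  - apply cder_ext with (fun u => f u * f u ^ (S n))%C; [reflexivity|].
    replace (RtoC (INR (S (S n))) * l * f t ^ S n)%C with (l * f t ^ S n + f t * (RtoC (INR (S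
    n)) * l * f t ^ n))%C.
    + apply (cder_mult f (fun u => f u ^ S n)%C); auto.
    + rewrite (S_INR (S n)), RtoC_plus. change (f t ^ S n)%C with (f t * f t ^ n)%C. ring.
Qed.

Lemma cder_cexp_poly z t n :
  cder (fun u => cexp_poly (S n) (RtoC u * z)%C) t (z * cexp_poly n (RtoC t * z))%C.
Proof.
  induction n.
  - apply cder_ext with (fun _ => 1%C). { intro u. unfold cexp_poly; simpl. field. }
    unfold cexp_poly; simpl. replace (z * 0)%C with (RtoC 0) by ring. apply cder_const.
  - change (cder (fun u => cexp_poly (S n) (RtoC u * z) + (RtoC u * z) ^ (S n) / RtoC (INR (fact
    (S n))))%C t (z * (cexp_poly n (RtoC t * z) + (RtoC t * z) ^ n / RtoC (INR (fact n))))%C).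
    replace (z * (cexp_poly n (RtoC t * z) + (RtoC t * z) ^ n / RtoC (INR (fact n))))%C with
      (z * cexp_poly n (RtoC t * z) + / RtoC (INR (fact (S n))) * (RtoC (INR (S n)) * z * (RtoC t
      * z) ^ n))%C.
    + apply cder_plus; auto. eapply cder_ext; [|apply cder_scal;
      apply (cder_pow (fun u => RtoC u * z)%C); apply cder_id_scal]. intro u.
      simpl; unfold Cdiv; ring.
    + rewrite fact_simpl, mult_INR, RtoC_mult. field. split; [apply RtoC_fact_neq|].
      intro E; apply RtoC_inj in E. apply (not_0_INR (S n)); auto.
Qed.

(** By induction on n along the segment from 0 to z, as the error of order n + 1 is
    the integral of z times the error of order n. Each integration can cost a
    factor 2, because integrals are estimated componentwise; hence the 2^n. *)
Lemma cexp_taylor n z : Cmod (cexp z - cexp_poly n z) <= (2 * Cmod z) ^ n / INR (fact n) * exp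
  (Cmod z).
Proof.
  revert z. induction n; intro z.
  - unfold cexp_poly; simpl. replace (cexp z - 0)%C with (cexp z) by ring. rewrite Cmod_cexp.
    replace (1 / 1 * exp (Cmod z)) with (exp (Cmod z)) by field.
    destruct (Rle_lt_or_eq_dec _ _ (Re_le_Cmod z)) as [h|h]; [left; apply exp_increasing;
    auto|rewrite h; lra].
  - assert (cexp z - cexp_poly (S n) z = cint (fun u => z * (cexp (RtoC u * z) - cexp_poly n
    (RtoC u * z))) 0 1)%C as ->.
    { rewrite (cint_FTC (fun u => cexp (RtoC u * z) - cexp_poly (S n) (RtoC u * z))%C); try lra.
      - replace (RtoC 1 * z)%C with z by ring. replace (RtoC 0 * z)%C with (RtoC 0) by ring.
        rewrite cexp_0.
        assert (cexp_poly (S n) 0 = 1) as ->.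
        { unfold cexp_poly. rewrite csum_shift.
          rewrite (csum_ext _ (fun _ => RtoC 0 * 0)%C) by (intros; simpl; unfold Cdiv; ring).
          rewrite csum_scal. simpl. field. }
        ring.
      - intros u _. replace (z * (cexp (RtoC u * z) - cexp_poly n (RtoC u * z)))%C with (z * cexp
        (RtoC u * z) - z * cexp_poly n (RtoC u * z))%C by ring.
        apply cder_minus. apply (cder_cexp (fun u => RtoC u * z)%C). apply cder_id_scal.
        apply cder_cexp_poly.
      - intros u _. assert (ccont (fun u => RtoC u * z)%C u) by (eapply cder_ccont, cder_id_scal).
        apply ccont_mult; [apply ccont_const|]. apply ccont_minus; [apply ccont_cexp; auto|].
        apply (ccont_csum (fun k u => (RtoC u * z) ^ k / RtoC (INR (fact k)))%C). intro k.
        apply (ccont_mult (fun u => (RtoC u * z) ^ k)%C); [apply ccont_pow;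
        auto|apply ccont_const]. }
    set (M := Cmod z * ((2 * Cmod z) ^ n / INR (fact n) * exp (Cmod z))).
    eapply Rle_trans; [apply (cint_norm _ (fun u => M * u ^ n)); [lra| | |]|].
    + intros u _. assert (ccont (fun u => RtoC u * z)%C u) by (eapply cder_ccont, cder_id_scal).
        apply ccont_mult; [apply ccont_const|]. apply ccont_minus; [apply ccont_cexp; auto|].
        apply (ccont_csum (fun k u => (RtoC u * z) ^ k / RtoC (INR (fact k)))%C). intro k.
        apply (ccont_mult (fun u => (RtoC u * z) ^ k)%C); [apply ccont_pow;
        auto|apply ccont_const].
    + intros u _. continuity_by_derive. auto.
    + intros u Hu. rewrite Cmod_mult. unfold M. rewrite Rmult_assoc.
      apply Rmult_le_compat_l; [apply Cmod_ge_0|].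
      eapply Rle_trans; [apply IHn|]. rewrite Cmod_mult, Cmod_R, Rabs_pos_eq by lra.
      pose proof (Cmod_ge_0 z). replace (2 * (u * Cmod z)) with (2 * Cmod z * u) by ring.
      rewrite Rpow_mult_distr.
      assert (exp (u * Cmod z) <= exp (Cmod z)).
      { destruct (Req_dec (u * Cmod z) (Cmod z)) as [E|E]; [rewrite E; lra|].
        left; apply exp_increasing. nra. }
      assert (0 <= (2 * Cmod z) ^ n * u ^ n / INR (fact n)).
      { apply Rmult_le_pos. apply Rmult_le_pos; apply pow_le; lra.
        left; apply Rinv_0_lt_compat, INR_fact_lt_0. }
      replace ((2 * Cmod z) ^ n / INR (fact n) * exp (Cmod z) * u ^ n) with ((2 * Cmod z) ^ n * u
      ^ n / INR (fact n) * exp (Cmod z)) by (unfold Rdiv; ring).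
      apply Rmult_le_compat_l; auto.
    + assert (RInt (fun u => M * u ^ n) 0 1 = M * 1 ^ S n / INR (S n) - M * 0 ^ S n / INR (S n))
      as ->.
      { apply is_RInt_unique. apply (is_RInt_derive (V:=R_CompleteNormedModule) (fun u => M * u ^
        S n / INR (S n))).
        - intros u _. pose proof (S_INR n) as E. auto_derive; auto. simpl in E |- *. rewrite E.
          field. pose proof (pos_INR n). lra.
        - intros u _. continuity_by_derive. auto. }
      rewrite pow1, pow_i by lia. rewrite fact_simpl, mult_INR. right. unfold M. simpl pow. field.
      split; [apply INR_fact_neq_0|]. apply not_0_INR; auto.
Qed.

Lemma cpow_cexp a s : cpow a s = cexp (s * RtoC (ln a))%C.
Proof.
  assert (Re (s * RtoC (ln a))%C = Re s * ln a) as E1 by (unfold Re, Im; simpl; ring).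
  assert (Im (s * RtoC (ln a))%C = Im s * ln a) as E2 by (unfold Re, Im; simpl; ring).
  unfold cpow, cexp. rewrite E1, E2. apply injective_projections; simpl; ring.
Qed.

Lemma cpow_plus a s w : cpow a (s + w)%C = (cpow a s * cpow a w)%C.
Proof. rewrite !cpow_cexp, <- cexp_plus. f_equal. ring. Qed.

Lemma cpow_neq0 a s : cpow a s <> 0.
Proof. intro E. assert (Cmod (cpow a s) = 0) as K by (rewrite E; apply Cmod_0).
  rewrite cpow_cexp, Cmod_cexp in K. pose proof (exp_pos (Re (s * RtoC (ln a))%C)). lra. Qed.

Lemma Cmod_cpow a s : Cmod (cpow a s) = Rpower a (Re s).
Proof. rewrite cpow_cexp, Cmod_cexp. unfold Rpower. f_equal. unfold Re, Im; simpl; ring. Qed.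

Lemma cpow_R a (r : R) : cpow a (RtoC r) = RtoC (Rpower a r).
Proof. rewrite cpow_cexp, <- RtoC_mult, cexp_RtoC. reflexivity. Qed.

Lemma cpow_INR a n : 0 < a -> cpow a (RtoC (INR n)) = RtoC (a ^ n).
Proof. intros. rewrite cpow_R, Rpower_pow; auto. Qed.

Lemma cpow_0 a : cpow a 0 = 1.
Proof. rewrite cpow_cexp. replace (0 * RtoC (ln a))%C with (RtoC 0) by ring. apply cexp_0. Qed.

Lemma cpow_1 a : 0 < a -> cpow a 1 = RtoC a.
Proof. intros. rewrite cpow_R, Rpower_1; auto. Qed.

Lemma cpow_mult_base a b s : 0 < a -> 0 < b -> cpow (a * b) s = (cpow a s * cpow b s)%C.
Proof. intros. rewrite !cpow_cexp, ln_mult, <- cexp_plus, RtoC_plus by auto. f_equal. ring. Qed.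

Lemma cpow_opp a s : cpow a (- s)%C = (/ cpow a s)%C.
Proof.
  assert (cpow a (- s) * cpow a s = 1)%C as E by (rewrite <- cpow_plus;
  replace (- s + s)%C with (RtoC 0) by ring; apply cpow_0).
  rewrite <- (Cmult_1_l (/ cpow a s)), <- E. field. apply cpow_neq0.
Qed.

Lemma cpow_1_l s : cpow 1 s = 1.
Proof. rewrite cpow_cexp, ln_1. replace (s * 0)%C with (RtoC 0) by ring. apply cexp_0. Qed.

Lemma cder_cpow s t : 0 < t -> cder (fun u => cpow u s) t (s * cpow t (s - 1))%C.
Proof.
  intros Ht. apply cder_ext with (fun u => cexp (s * RtoC (ln u))%C).
  { intro; rewrite cpow_cexp; auto. }
  apply cder_eq with (s * RtoC (/ t) * cexp (s * RtoC (ln t)))%C.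
  - apply (cder_cexp (fun u => s * RtoC (ln u))%C). apply cder_scal, cder_RtoC.
    auto_derive; auto. field; lra.
  - rewrite <- cpow_cexp. unfold Cminus. rewrite cpow_plus, cpow_opp, cpow_1, RtoC_inv by lra.
    ring.
Qed.

Lemma ccont_cpow s t : 0 < t -> ccont (fun u => cpow u s) t.
Proof. intros. eapply cder_ccont, cder_cpow; auto. Qed.

Lemma cder_cpow_shift s c t : 0 < t + c ->
  cder (fun u => cpow (u + c) s) t (s * cpow (t + c) (s - 1))%C.
Proof.
  intros H. eapply cder_eq; [apply (cder_comp (fun u => cpow u s) (fun u => u + c));
  [apply cder_cpow; auto|]|].
  - auto_derive; auto. - ring.
Qed.

Lemma exp_le x y : x <= y -> exp x <= exp y.
Proof. intros [H|H]; [left; apply exp_increasing; auto|subst; lra]. Qed.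

Lemma pow_fact_exp n y : 0 <= y -> y ^ n / INR (fact n) <= exp y.
Proof.
  intros Hy. pose proof (is_exp_Reals y) as H. unfold is_pseries in H.
  assert (forall k, 0 <= scal (pow_n y k) (/ INR (fact k))) as Hp.
  { intro k. change (0 <= y ^ k * / INR (fact k)).
    apply Rmult_le_pos; [apply pow_le; auto|left; apply Rinv_0_lt_compat, INR_fact_lt_0]. }
  apply Rle_trans with (sum_n (fun k => scal (pow_n y k) (/ INR (fact k))) n).
  - destruct n.
    + rewrite sum_O. right. reflexivity.
    + rewrite sum_Sn. unfold plus; simpl. rewrite <- (Rplus_0_l (_ / _)). apply Rplus_le_compat.
      * clear H. induction n; [rewrite sum_O; auto|rewrite sum_Sn; apply Rplus_le_le_0_compat;
        auto].
      * right. reflexivity.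
  - apply (is_lim_seq_incr_compare (sum_n (fun k => scal (pow_n y k) (/ INR (fact k)))));
    [exact H|].
    intro k. rewrite sum_Sn. unfold plus; simpl. specialize (Hp (S k)). simpl in Hp. lra.
Qed.

(** * Analyticity of integral transforms *)
(** L f l reads: the linear functional L takes the value l at f. The functionals in
    mind are an improper integral and the series of integrals in [em_series]; they
    are defined only where they converge, and so L is a relation. The function exp
    (- Re s0 lam + r |lam|) dominates the kernel for all s in the disc of radius r.
    *)
Section Transform.
Variables (L : (R -> C) -> C -> Prop) (dom : R -> Prop) (lam : R -> R) (s0 : C) (r N : R).
Hypothesis Hr : 0 < r.
Hypothesis Llin : forall f g c l m, L f l -> L g m -> L (fun u => f u + c * g u)%C (l + c * m)%C.
Hypothesis Luniq : forall f l m, L f l -> L f m -> l = m.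
Hypothesis Lext : forall f g l, (forall u, f u = g u) -> L f l -> L g l.
Hypothesis Ldom : forall f B, 0 <= B -> (forall u, dom u -> ccont f u) ->
  (forall u, dom u -> Cmod (f u) <= B * exp (- Re s0 * lam u + r * Rabs (lam u))) ->
  exists l, L f l /\ Cmod l <= B * N.
Hypothesis lamc : forall u, dom u -> continuous lam u.

(** The Taylor expansion of s |-> e^(-s lam) at s0 is integrated term by term. For
    |s - s0| < r/4 its n-th remainder is at most (2 |s - s0| |lam|)^n / n! times an
    exponential, and (r |lam| / 2)^n / n! <= e^(r |lam| / 2), so it is at most (4
    |s - s0| / r)^n times the dominating function. The second part identifies the
    derivative at s0 as the integral of the differentiated kernel. *)
Lemma transform_power_series F :
  (forall s, Cmod (s - s0) < r -> L (fun u => cexp (- s * RtoC (lam u)))%C (F s)) ->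
  exists a, has_power_series F s0 a (r/4) /\
  L (fun u => - RtoC (lam u) * cexp (- s0 * RtoC (lam u)))%C (a 1%nat).
Proof.
  intros HF.
  (* The n-th Taylor coefficient of s |-> e^(-s lam) at s0. *)
  set (T := fun n u => ((- RtoC (lam u)) ^ n / RtoC (INR (fact n)) * cexp (- s0 * RtoC (lam
  u)))%C).
  assert (lc : forall u, dom u -> ccont (fun u => - RtoC (lam u))%C u).
  { intros u Hu. apply (ccont_ext_loc (fun u => RtoC (-1) * RtoC (lam u))%C).
    { apply filter_forall. intro t. apply injective_projections; simpl; ring. }
    apply ccont_mult; [apply ccont_const|]. apply ccont_RtoC; auto. }
  assert (lc2 : forall s u, dom u -> ccont (fun u => cexp (- s * RtoC (lam u)))%C u).
  { intros s u Hu. apply (ccont_cexp (fun u => - s * RtoC (lam u))%C).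
    apply ccont_mult; [apply ccont_const|apply ccont_RtoC; auto]. }
  assert (lc3 : forall n u, dom u -> ccont (T n) u).
  { intros n u Hu. unfold T. apply ccont_mult; [|apply lc2; auto].
    apply (ccont_mult (fun u => (- RtoC (lam u)) ^ n)%C); [apply ccont_pow;
    auto|apply ccont_const]. }
  assert (Mexp : forall s u, Cmod (cexp (- s * RtoC (lam u))) = exp (- Re s * lam u)).
  { intros s u. rewrite Cmod_cexp. f_equal. unfold Re, Im; simpl; ring. }
  assert (HT : forall n, exists l, L (T n) l).
  { intro n. destruct (Ldom (T n) (/ r ^ n)) as [l [Hl _]].
    - left. apply Rinv_0_lt_compat, pow_lt; auto.
    - auto.
    - intros u Hu. unfold T. rewrite Cmod_mult, Mexp, Cmod_div, Cmod_pow, Cmod_opp,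
      !Cmod_R by apply RtoC_fact_neq.
      rewrite (Rabs_pos_eq (INR _)) by apply pos_INR.
      rewrite exp_plus, (Rmult_comm (exp _)), <- Rmult_assoc.
      apply Rmult_le_compat_r; [left; apply exp_pos|].
      pose proof (pow_fact_exp n (r * Rabs (lam u))) as K. rewrite Rpow_mult_distr in K.
      assert (0 < r ^ n) by (apply pow_lt; auto). apply Rmult_le_reg_l with (r ^ n); auto.
      rewrite <- (Rmult_assoc (r ^ n) (/ _)), Rinv_r, Rmult_1_l by lra. unfold Rdiv in *.
      rewrite <- Rmult_assoc. apply K.
      apply Rmult_le_pos; [lra|apply Rabs_pos].
    - exists l; auto. }
  set (a := fun n => proj1_sig (constructive_indefinite_description _ (HT n))).
  assert (Ha : forall n, L (T n) (a n)) by (intro n;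
  apply (proj2_sig (constructive_indefinite_description _ (HT n)))).
  exists a. split.
  - split; [lra|]. intros z Hz. set (w := (z - s0)%C) in *. pose proof (Cmod_ge_0 w).
    assert (L0 : L (fun _ => RtoC 0) 0).
    { pose proof (Llin _ _ (-(1))%C _ _ (Ha 0%nat) (Ha 0%nat)) as K.
      replace (a 0%nat + - (1) * a 0%nat)%C with (RtoC 0) in K by ring. apply Lext with (2 := K).
      intro; ring. }
    assert (LS : forall n, L (fun u => cexp (- s0 * RtoC (lam u)) * cexp_poly n (- w * RtoC (lam
    u)))%C (csum (fun k => a k * w ^ k)%C n)).
    { induction n.
      - apply Lext with (2 := L0). intro u. unfold cexp_poly; simpl. ring.
      - simpl. rewrite (Cmult_comm (a n)). apply Lext with (2 := Llin _ _ (w ^ n)%C _ _ IHn (Ha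
        n)). intro u.
        unfold T, cexp_poly. simpl csum.
        replace (- w * RtoC (lam u))%C with (w * - RtoC (lam u))%C by ring. rewrite !Cpow_mult_l.
        unfold Cdiv. ring. }
    apply Clim_bound with (fun n => (4 * Cmod w / r) ^ n * N).
    + intro n. assert (Hzr : Cmod (z - s0) < r) by (fold w; lra).
      pose proof (Llin _ _ (-(1))%C _ _ (LS n) (HF z Hzr)) as K.
      destruct (Ldom (fun u => cexp (- s0 * RtoC (lam u)) * cexp_poly n (- w * RtoC (lam u)) + -
      (1) * cexp (- z * RtoC (lam u)))%C ((4 * Cmod w / r) ^ n)) as [l [Hl Bl]].
      * apply pow_le. apply Rmult_le_pos; [lra|left; apply Rinv_0_lt_compat; auto].
      * intros u Hu. apply ccont_plus; [|apply ccont_mult; [apply ccont_const|auto]].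
        apply ccont_mult; [auto|]. apply (ccont_csum (fun k u => (- w * RtoC (lam u)) ^ k / RtoC
        (INR (fact k)))%C). intro k.
        apply (ccont_mult (fun u => (- w * RtoC (lam u)) ^ k)%C);
        [apply ccont_pow|apply ccont_const].
        apply ccont_mult; [apply ccont_const|apply ccont_RtoC; auto].
      * intros u Hu. replace (- z * RtoC (lam u))%C with (- s0 * RtoC (lam u) + - w * RtoC (lam
        u))%C by (unfold w; ring).
        rewrite cexp_plus.
        replace (cexp (- s0 * RtoC (lam u)) * cexp_poly n (- w * RtoC (lam u)) + - (1) * (cexp (-
        s0 * RtoC (lam u)) * cexp (- w * RtoC (lam u))))%C
          with (- (cexp (- s0 * RtoC (lam u)) * (cexp (- w * RtoC (lam u)) - cexp_poly n (- w *
          RtoC (lam u)))))%C by ring.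
        rewrite Cmod_opp, Cmod_mult, Mexp.
        set (y := Rabs (lam u)). assert (0 <= y) by apply Rabs_pos.
        rewrite exp_plus, <- Rmult_assoc, (Rmult_comm _ (exp (- Re s0 * lam u))), Rmult_assoc.
        apply Rmult_le_compat_l; [left; apply exp_pos|].
        eapply Rle_trans; [apply cexp_taylor|]. rewrite Cmod_mult, Cmod_opp, Cmod_R. fold y.
        replace (2 * (Cmod w * y)) with (4 * Cmod w / r * (r / 2 * y)) by (field; lra).
        rewrite Rpow_mult_distr. unfold Rdiv at 1. rewrite !Rmult_assoc. apply Rmult_le_compat_l.
        { apply pow_le. apply Rmult_le_pos; [lra|left; apply Rinv_0_lt_compat; auto]. }
        rewrite <- Rmult_assoc.
        apply Rle_trans with (exp (r / 2 * y) * exp (r / 4 * y)).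
        -- apply Rmult_le_compat; [|left; apply exp_pos|apply pow_fact_exp; nra|].
           ++ apply Rmult_le_pos; [apply pow_le; nra|left; apply Rinv_0_lt_compat, INR_fact_lt_0].
           ++ apply exp_le. nra.
        -- rewrite <- exp_plus. apply exp_le. nra.
      * rewrite <- (Luniq _ _ _ K Hl) in Bl.
        replace (csum (fun k => a k * w ^ k)%C n - F z)%C with (csum (fun k => a k * w ^ k)%C n +
        - (1) * F z)%C by ring. exact Bl.
    + replace (Finite 0) with (Rbar_mult 0 N) by (simpl; f_equal; ring).
      apply is_lim_seq_scal_r, is_lim_seq_geom.
      rewrite Rabs_pos_eq by (apply Rmult_le_pos; [lra|left; apply Rinv_0_lt_compat; auto]).
      apply Rmult_lt_reg_r with r; auto. unfold Rdiv. rewrite Rmult_assoc, Rinv_l by lra. lra.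
  - apply Lext with (2 := Ha 1%nat). intro u. unfold T. simpl. field.
Qed.
End Transform.

(** * Improper integrals *)
Lemma half_pos e : 0 < e -> 0 < e / 2. Proof. lra. Qed.
Lemma third_pos e : 0 < e -> 0 < e / 3. Proof. lra. Qed.
Lemma sixteenth_pos e : 0 < e -> 0 < e / 16. Proof. lra. Qed.

(** The two endpoints run along filters, so that one theory covers integrals over
    (0,1), (1,oo) and (0,oo); dom is a set that eventually contains the interval of
    integration. *)
Definition interval_filters (Fa Fb : (R -> Prop) -> Prop) (dom : R -> Prop) : Prop :=
  ProperFilter Fa /\ ProperFilter Fb /\
  filter_prod Fa Fb (fun ab => fst ab <= snd ab /\ forall u, fst ab <= u <= snd ab -> dom u).

Definition is_rint_gen Fa Fb (f : R -> R) (l : R) := forall eps, 0 < eps ->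
  filter_prod Fa Fb (fun ab => Rabs (RInt f (fst ab) (snd ab) - l) < eps).
Definition is_cint_gen Fa Fb (f : R -> C) (l : C) := forall eps, 0 < eps ->
  filter_prod Fa Fb (fun ab => Cmod (cint f (fst ab) (snd ab) - l) < eps).

Section Improper.
Variables (Fa Fb : (R -> Prop) -> Prop) (dom : R -> Prop).
Hypothesis G : interval_filters Fa Fb dom.

Local Instance FFa : ProperFilter Fa. Proof. apply G. Qed.
Local Instance FFb : ProperFilter Fb. Proof. apply G. Qed.
Local Instance FFab : ProperFilter (filter_prod Fa Fb). Proof. apply filter_prod_proper. Qed.

Lemma is_cint_gen_unique f l m : is_cint_gen Fa Fb f l -> is_cint_gen Fa Fb f m -> l = m.
Proof.
  intros Hl Hm. apply Ceq_minus, Cmod_eq0_eps. intros eps He.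
  destruct (filter_ex _ (filter_and _ _ (Hl _ (half_pos _ He)) (Hm _ (half_pos _ He)))) as [ab
  [H1 H2]].
  set (k := cint f (fst ab) (snd ab)) in *.
  replace (l - m)%C with (- (k - l) + (k - m))%C by ring.
  eapply Rle_lt_trans; [apply Cmod_triangle|]. rewrite Cmod_opp. lra.
Qed.

Lemma is_cint_gen_ext f g l : (forall u, dom u -> f u = g u) -> is_cint_gen Fa Fb f l ->
  is_cint_gen Fa Fb g l.
Proof.
  intros E H eps He. apply filter_imp with (2 := filter_and _ _ (proj2 (proj2 G)) (H eps He)).
  intros [a b] [[Hab Hd] K]. simpl in *. rewrite <- (cint_ext f g); auto. intros u Hu.
  apply E, Hd. lra.
Qed.

Lemma is_cint_gen_zero : is_cint_gen Fa Fb (fun _ => RtoC 0) 0.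
Proof.
  intros eps He. apply filter_imp with (2 := proj2 (proj2 G)). intros [a b] [h1 _]; simpl in *.
  rewrite (cint_FTC (fun _ => RtoC 0)); auto using cder_const, ccont_const.
  replace (0 - 0 - 0)%C with (RtoC 0) by ring. rewrite Cmod_0; auto.
Qed.

Lemma is_cint_gen_plus f g l m : (forall u, dom u -> ccont f u) ->
  (forall u, dom u -> ccont g u) -> is_cint_gen Fa Fb f l -> is_cint_gen Fa Fb g m ->
  is_cint_gen Fa Fb (fun u => f u + g u)%C (l + m)%C.
Proof.
  intros Cf Cg Hl Hm eps He.
  apply filter_imp with (2 := filter_and _ _ (proj2 (proj2 G)) (filter_and _ _ (Hl _ (half_pos _
  He)) (Hm _ (half_pos _ He)))).
  intros [a b] [[Hab Hd] [H1 H2]]; simpl in *. rewrite cint_plus by auto.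
  replace (cint f a b + cint g a b - (l + m))%C with ((cint f a b - l) + (cint g a b - m))%C by
  ring.
  eapply Rle_lt_trans; [apply Cmod_triangle|]. lra.
Qed.

Lemma is_cint_gen_scal c f l : (forall u, dom u -> ccont f u) -> is_cint_gen Fa Fb f l ->
  is_cint_gen Fa Fb (fun u => c * f u)%C (c * l)%C.
Proof.
  intros Cf Hl eps He. pose proof (Cmod_ge_0 c).
  assert (0 < eps / (Cmod c + 1)) as He' by (apply Rdiv_lt_0_compat; lra).
  apply filter_imp with (2 := filter_and _ _ (proj2 (proj2 G)) (Hl _ He')).
  intros [a b] [[Hab Hd] H1]; simpl in *. rewrite cint_scal by auto.
  replace (c * cint f a b - c * l)%C with (c * (cint f a b - l))%C by ring. rewrite Cmod_mult.
  pose proof (Cmod_ge_0 (cint f a b - l)).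
  assert (eps = (Cmod c + 1) * (eps / (Cmod c + 1))) as E by (field; lra). rewrite E. nra.
Qed.

Lemma is_cint_gen_FTC Fn f la lb : (forall u, dom u -> cder Fn u (f u)) ->
  (forall u, dom u -> ccont f u) ->
  (forall eps, 0 < eps -> Fa (fun u => Cmod (Fn u - la) < eps)) ->
  (forall eps, 0 < eps -> Fb (fun u => Cmod (Fn u - lb) < eps)) ->
  is_cint_gen Fa Fb f (lb - la)%C.
Proof.
  intros HF Cf Ha Hb eps He.
  assert (filter_prod Fa Fb (fun ab => Cmod (Fn (fst ab) - la) < eps/2 /\ Cmod (Fn (snd ab) - lb)
  < eps/2)) as K.
  { apply Filter_prod with (1 := Ha _ (half_pos _ He)) (2 := Hb _ (half_pos _ He)). auto. }
  apply filter_imp with (2 := filter_and _ _ (proj2 (proj2 G)) K).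
  intros [a b] [[Hab Hd] [H1 H2]]; simpl in *. rewrite (cint_FTC Fn); auto.
  replace (Fn b - Fn a - (lb - la))%C with ((Fn b - lb) + - (Fn a - la))%C by ring.
  eapply Rle_lt_trans; [apply Cmod_triangle|]. rewrite Cmod_opp. lra.
Qed.

Lemma is_rint_gen_FTC (Fn f : R -> R) la lb : (forall u, dom u -> is_derive Fn u (f u)) ->
  (forall u, dom u -> continuous f u) -> filterlim Fn Fa (locally la) ->
  filterlim Fn Fb (locally lb) -> is_rint_gen Fa Fb f (lb - la).
Proof.
  intros HF Cf Ha Hb eps He. assert (0 < eps/2) as He2 by lra.
  assert (filter_prod Fa Fb (fun ab => Rabs (Fn (fst ab) - la) < eps/2 /\ Rabs (Fn (snd ab) - lb)
  < eps/2)) as K.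
  { apply Filter_prod with (1 := proj1 (filterlim_locally _ _) Ha (mkposreal _ He2)) (2 := proj1
    (filterlim_locally _ _) Hb (mkposreal _ He2)). auto. }
  apply filter_imp with (2 := filter_and _ _ (proj2 (proj2 G)) K).
  intros [a b] [[Hab Hd] [H1 H2]]; simpl in *.
  rewrite (is_RInt_unique f a b (Fn b - Fn a)).
  - replace (Fn b - Fn a - (lb - la)) with ((Fn b - lb) + - (Fn a - la)) by ring.
    eapply Rle_lt_trans; [apply Rabs_triang|]. rewrite Rabs_Ropp. lra.
  - apply (is_RInt_derive (V:=R_CompleteNormedModule)); rewrite Rmin_left, Rmax_right by auto;
    auto.
Qed.

Lemma rex_RInt (g : R -> R) a b : a <= b -> (forall u, a <= u <= b -> continuous g u) ->
  ex_RInt g a b.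
Proof. intros Hab Hg. apply (ex_RInt_continuous (V:=R_CompleteNormedModule)); intros z Hz;
  rewrite Rmin_left, Rmax_right in Hz by auto; auto. Qed.

(** Both endpoints are moved one after the other: the resulting change is the
    integral of f over a short piece, at most twice that of g. So the net of
    integrals is Cauchy. *)
Lemma is_cint_gen_dominated f (g : R -> R) N : (forall u, dom u -> ccont f u) ->
  (forall u, dom u -> continuous g u) -> (forall u, dom u -> Cmod (f u) <= g u) ->
  is_rint_gen Fa Fb g N -> exists l, is_cint_gen Fa Fb f l /\ Cmod l <= 2 * N.
Proof.
  intros Cf Cg Hfg HN.
  assert (Cauchy : forall eps, 0 < eps -> exists P, filter_prod Fa Fb P /\ forall p q,
  P p -> P q ->
     Cmod (cint f (fst p) (snd p) - cint f (fst q) (snd q)) < eps).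
  { intros eps He.
    destruct (filter_and _ _ (proj2 (proj2 G)) (HN _ (sixteenth_pos _ He))) as [P Q HP HQ H].
    exists (fun p => P (fst p) /\ Q (snd p)). split.
    { apply Filter_prod with (1 := HP) (2 := HQ); auto. }
    assert (S1 : forall a b b', P a -> Q b -> Q b' -> b <= b' -> Cmod (cint f a b' - cint f a b)
    < eps/2).
    { intros a b b' Ha Hb Hb' Hbb. destruct (H a b Ha Hb) as [[h1 h2] h3].
      destruct (H a b' Ha Hb') as [[h4 h5] h6]. simpl in *.
      assert (0 <= RInt g b b' <= eps/8) as K.
      { pose proof (RInt_Chasles (V:=R_CompleteNormedModule) g a b b' ltac:(apply rex_RInt;
        auto) ltac:(apply rex_RInt; auto; intros; apply Cg, h5; lra)) as E.
        unfold plus in E; simpl in E. apply Rabs_def2 in h3. apply Rabs_def2 in h6. split; [|lra].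
        apply RInt_ge_0; auto. apply rex_RInt; auto; intros; apply Cg, h5; lra.
        intros u Hu. eapply Rle_trans; [apply Cmod_ge_0|apply Hfg, h5; lra]. }
      rewrite <- (cint_Chasles f a b b') by (auto; intros; apply Cf, h5; lra).
      replace (cint f a b + cint f b b' - cint f a b)%C with (cint f b b') by ring.
      eapply Rle_lt_trans; [apply (cint_norm f g); auto; intros; [apply Cf, h5; lra|apply Cg, h5;
      lra|apply Hfg, h5; lra]|]. lra. }
    assert (S2 : forall a a' b, P a -> P a' -> Q b -> a <= a' -> Cmod (cint f a b - cint f a' b)
    < eps/2).
    { intros a a' b Ha Ha' Hb Haa. destruct (H a b Ha Hb) as [[h1 h2] h3].
      destruct (H a' b Ha' Hb) as [[h4 h5] h6]. simpl in *.
      assert (0 <= RInt g a a' <= eps/8) as K.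
      { pose proof (RInt_Chasles (V:=R_CompleteNormedModule) g a a' b ltac:(apply rex_RInt; auto;
        intros; apply Cg, h2; lra) ltac:(apply rex_RInt; auto)) as E.
        unfold plus in E; simpl in E. apply Rabs_def2 in h3. apply Rabs_def2 in h6. split; [|lra].
        apply RInt_ge_0; auto. apply rex_RInt; auto; intros; apply Cg, h2; lra.
        intros u Hu. eapply Rle_trans; [apply Cmod_ge_0|apply Hfg, h2; lra]. }
      rewrite <- (cint_Chasles f a a' b) by (auto; intros; apply Cf, h2; lra).
      replace (cint f a a' + cint f a' b - cint f a' b)%C with (cint f a a') by ring.
      eapply Rle_lt_trans; [apply (cint_norm f g); auto; intros; [apply Cf, h2; lra|apply Cg, h2;
      lra|apply Hfg, h2; lra]|]. lra. }
    intros [a b] [a' b'] [Ha Hb] [Ha' Hb']; simpl in *.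
    replace (cint f a b - cint f a' b')%C with ((cint f a b - cint f a b') + (cint f a b' - cint
    f a' b'))%C by ring.
    eapply Rle_lt_trans; [apply Cmod_triangle|].
    assert (Cmod (cint f a b - cint f a b') < eps/2).
    { destruct (Rle_dec b b'). - replace (cint f a b - cint f a b')%C with (- (cint f a b' - cint
      f a b))%C by ring. rewrite Cmod_opp. auto. - apply S1; auto; lra. }
    assert (Cmod (cint f a b' - cint f a' b') < eps/2).
    { destruct (Rle_dec a a'). - auto. - replace (cint f a b' - cint f a' b')%C with (- (cint f
      a' b' - cint f a b'))%C by ring. rewrite Cmod_opp. apply S2; auto; lra. }
    lra. }
  assert (Parts : exists l, is_cint_gen Fa Fb f l).
  { destruct (proj1 (filterlim_locally_cauchy (U:=R_CompleteSpace) (F:=filter_prod Fa Fb) (fun p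
    => Re (cint f (fst p) (snd p))))) as [x Hx].
    { intros [eps He]. destruct (Cauchy eps He) as [P [HP K]]. exists P; split; auto.
      intros p q Hp Hq.
      eapply Rle_lt_trans; [|apply (K q p Hq Hp)]. eapply Rle_trans; [|apply re_le_Cmod].
      right; reflexivity. }
    destruct (proj1 (filterlim_locally_cauchy (U:=R_CompleteSpace) (F:=filter_prod Fa Fb) (fun p
    => Im (cint f (fst p) (snd p))))) as [y Hy].
    { intros [eps He]. destruct (Cauchy eps He) as [P [HP K]]. exists P; split; auto.
      intros p q Hp Hq.
      eapply Rle_lt_trans; [|apply (K q p Hq Hp)]. eapply Rle_trans; [|apply im_le_Cmod].
      right; reflexivity. }
    exists (x, y). intros eps He. assert (0 < eps / 2) as He2 by lra.
    pose proof (proj1 (filterlim_locally _ _) Hx (mkposreal _ He2)) as K1.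
    pose proof (proj1 (filterlim_locally _ _) Hy (mkposreal _ He2)) as K2.
    apply filter_imp with (2 := filter_and _ _ K1 K2). intros p [k1 k2].
    change (Rabs (Re (cint f (fst p) (snd p)) - x) < eps/2) in k1.
    change (Rabs (Im (cint f (fst p) (snd p)) - y) < eps/2) in k2.
    eapply Rle_lt_trans; [apply Cmod_parts|].
    change (Rabs (Re (cint f (fst p) (snd p)) - x) + Rabs (Im (cint f (fst p) (snd p)) - y) <
    eps). lra. }
  destruct Parts as [l Hl]. exists l. split; auto.
  apply le_epsilon. intros eps He.
  destruct (filter_ex _ (filter_and _ _ (proj2 (proj2 G)) (filter_and _ _ (Hl _ (third_pos _ He))
  (HN _ (third_pos _ He))))) as [[a b] [[h1 h2] [h3 h4]]]; simpl in *.
  apply Rabs_def2 in h4.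
  assert (Cmod (cint f a b) <= 2 * RInt g a b) by (apply cint_norm; auto).
  replace l with (cint f a b + - (cint f a b - l))%C by ring.
  eapply Rle_trans; [apply Cmod_triangle|]. rewrite Cmod_opp. lra.
Qed.
End Improper.

(** * Euler-Maclaurin summation *)
(** B_j(v)/j!: each is the primitive of the previous one that has mean 0 on [0,1].
    *)
Fixpoint em_kernel (j : nat) (v : R) : R :=
  match j with
  | O => 1
  | S i => RInt (em_kernel i) 0 v - RInt (fun w => RInt (em_kernel i) 0 w) 0 1
  end.

Lemma em_kernel_cont_der j : (forall v, continuous (em_kernel j) v) /\
  (forall v, is_derive (em_kernel (S j)) v (em_kernel j v)).
Proof.
  induction j as [|j [IH1 IH2]].
  - assert (C0 : forall v, continuous (em_kernel 0) v) by (intro; apply continuous_const).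
    split; auto.
    intro v. simpl. eapply rder_eq; [apply rder_minus;
    [|apply (is_derive_const (V:=R_NormedModule))]|].
    + apply (is_derive_RInt (V:=R_NormedModule) (fun _ => 1) (fun b => RInt (fun _ => 1) 0 b) 0
      v).
      * apply filter_forall. intro b. apply (RInt_correct (V:=R_CompleteNormedModule)),
        ex_RInt_const.
      * apply continuous_const.
    + unfold zero; simpl. ring.
  - assert (C1 : forall v, continuous (em_kernel (S j)) v).
    { intro v. apply (ex_derive_continuous (V:=R_NormedModule)). eexists; apply IH2. }
    split; auto. intro v.
    apply is_derive_ext with (fun v => RInt (em_kernel (S j)) 0 v - RInt (fun w => RInt
    (em_kernel (S j)) 0 w) 0 1); [reflexivity|].
    eapply rder_eq; [apply rder_minus; [|apply (is_derive_const (V:=R_NormedModule))]|].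
    + apply (is_derive_RInt (V:=R_NormedModule) (em_kernel (S j)) (fun b => RInt (em_kernel (S
      j)) 0 b) 0 v); auto.
      apply filter_forall. intro b. apply (RInt_correct (V:=R_CompleteNormedModule)).
      apply (ex_RInt_continuous (V:=R_CompleteNormedModule)); auto.
    + unfold zero; simpl. ring.
Qed.
Lemma em_kernel_cont j v : continuous (em_kernel j) v. Proof. apply em_kernel_cont_der. Qed.
Lemma em_kernel_der j v : is_derive (em_kernel (S j)) v (em_kernel j v). Proof.
  apply em_kernel_cont_der. Qed.

Lemma em_kernel_int j : RInt (em_kernel j) 0 1 = em_kernel (S j) 1 - em_kernel (S j) 0.
Proof.
  apply is_RInt_unique. apply (is_RInt_derive (V:=R_CompleteNormedModule) (em_kernel (S j)));
  intros; [apply em_kernel_der|apply em_kernel_cont].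
Qed.

Lemma em_kernel_mean0 j : RInt (em_kernel (S j)) 0 1 = 0.
Proof.
  set (c := RInt (fun w => RInt (em_kernel j) 0 w) 0 1).
  transitivity (RInt (fun v => minus (RInt (em_kernel j) 0 v) c) 0 1); [reflexivity|].
  assert (ex_RInt (fun w => RInt (em_kernel j) 0 w) 0 1) as E.
  { apply (ex_RInt_continuous (V:=R_CompleteNormedModule)). intros z _.
    apply (continuous_ext (fun w => em_kernel (S j) w + c)). { intro w.
    change (RInt (em_kernel j) 0 w - c + c = RInt (em_kernel j) 0 w). ring. }
    apply rcont_plus; [apply em_kernel_cont|apply continuous_const]. }
  rewrite (RInt_minus (V:=R_CompleteNormedModule)); auto; [|apply ex_RInt_const].
  rewrite RInt_const. change (c + - ((1 - 0) * c) = 0). ring.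
Qed.

Lemma em_kernel_periodic j : em_kernel (S (S j)) 1 = em_kernel (S (S j)) 0.
Proof. pose proof (em_kernel_int (S j)) as H. rewrite em_kernel_mean0 in H. lra. Qed.

(** The exceptional case j = 1 of periodicity: the jump of the sawtooth is what
    turns integrals into values at the integers. *)
Lemma em_kernel_jump : em_kernel 1 1 = em_kernel 1 0 + 1.
Proof.
  pose proof (em_kernel_int 0) as H. simpl em_kernel at 1 in H. rewrite RInt_const in H.
  unfold scal in H; simpl in H; unfold mult in H; simpl in H.
  change (em_kernel 1 1 = em_kernel 1 0 + 1). simpl em_kernel. lra.
Qed.

Lemma em_kernel_bound j : exists B, 0 < B /\ forall v, 0 <= v <= 1 -> Rabs (em_kernel j v) <= B.
Proof.
  induction j as [|j [B [HB H]]].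
  - exists 1. split; [lra|]. intros v _. simpl. rewrite Rabs_R1. lra.
  - assert (K : forall v, 0 <= v <= 1 -> Rabs (RInt (em_kernel j) 0 v) <= B).
    { intros v Hv. eapply Rle_trans; [apply (abs_RInt_le_const (em_kernel j) 0 v B); try lra|].
      - apply (ex_RInt_continuous (V:=R_CompleteNormedModule)); intros; apply em_kernel_cont.
      - intros t Ht; apply H; lra.
      - nra. }
    exists (2 * B). split; [lra|]. intros v Hv.
    change (em_kernel (S j) v) with (RInt (em_kernel j) 0 v - RInt (fun w => RInt (em_kernel j) 0
    w) 0 1).
    assert (Rabs (RInt (fun w => RInt (em_kernel j) 0 w) 0 1) <= B).
    { eapply Rle_trans; [apply (abs_RInt_le_const (fun w => RInt (em_kernel j) 0 w) 0 1 B);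
      try lra|lra].
      - apply (ex_RInt_continuous (V:=R_CompleteNormedModule)). intros z _.
        apply (continuous_ext (fun w => em_kernel (S j) w + RInt (fun w => RInt (em_kernel j) 0
        w) 0 1)). { intro w. change (RInt (em_kernel j) 0 w - RInt (fun w => RInt (em_kernel j) 0
        w) 0 1 + RInt (fun w => RInt (em_kernel j) 0 w) 0 1 = RInt (em_kernel j) 0 w). ring. }
        apply rcont_plus; [apply em_kernel_cont|apply continuous_const].
      - intros t Ht; apply K; lra. }
    specialize (K v Hv). unfold Rminus. eapply Rle_trans; [apply Rabs_triang|].
    rewrite Rabs_Ropp. lra.
Qed.

Definition em_int (j : nat) (F : R -> C) : C := cint (fun v => RtoC (em_kernel j v) * F v)%C 0 1.

Lemma em_int_cont j F : (forall v, 0 <= v <= 1 -> ccont F v) -> forall v, 0 <= v <= 1 ->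
  ccont (fun v => RtoC (em_kernel j v) * F v)%C v.
Proof. intros H v Hv. apply ccont_mult; auto. apply ccont_RtoC, em_kernel_cont. Qed.

Lemma em_int_plus j F H : (forall v, 0 <= v <= 1 -> ccont F v) ->
  (forall v, 0 <= v <= 1 -> ccont H v) -> em_int j (fun v => F v + H v)%C =
  (em_int j F + em_int j H)%C.
Proof.
  intros. unfold em_int. rewrite <- cint_plus; try lra; try (apply em_int_cont; auto).
  apply cint_ext; [lra|]. intros; ring.
Qed.

Lemma em_int_scal j c F : (forall v, 0 <= v <= 1 -> ccont F v) -> em_int j (fun v => c * F v)%C =
  (c * em_int j F)%C.
Proof.
  intros. unfold em_int. rewrite <- cint_scal; try lra; try (apply em_int_cont; auto).
  apply cint_ext; [lra|]. intros; ring.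
Qed.

Lemma em_int_ext j F H : (forall v, 0 < v < 1 -> F v = H v) -> em_int j F = em_int j H.
Proof. intros E. apply cint_ext; [lra|]. intros u Hu. rewrite E; auto. Qed.

Lemma em_int_step j F dF : (forall v, 0 <= v <= 1 -> cder F v (dF v)) ->
  (forall v, 0 <= v <= 1 -> ccont dF v) ->
  em_int j F = (RtoC (em_kernel (S j) 1) * F 1 - RtoC (em_kernel (S j) 0) * F 0 - em_int (S j)
  dF)%C.
Proof.
  intros HF Hd. assert (CF : forall v, 0 <= v <= 1 -> ccont F v) by (intros; eapply cder_ccont;
  eauto).
  rewrite <- (cint_FTC (fun v => RtoC (em_kernel (S j) v) * F v)%C (fun v => RtoC (em_kernel j v)
  * F v + RtoC (em_kernel (S j) v) * dF v)%C); try lra.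
  - rewrite cint_plus; try lra; try (apply em_int_cont; auto). unfold em_int. ring.
  - intros v Hv. apply (cder_mult (fun v => RtoC (em_kernel (S j) v)) F); auto.
    apply cder_RtoC, em_kernel_der.
  - intros v Hv. apply ccont_plus; apply em_int_cont; auto.
Qed.

Lemma em_int_bound j : exists B, 0 < B /\ forall F M, (forall v, 0 <= v <= 1 -> ccont F v) ->
  (forall v, 0 <= v <= 1 -> Cmod (F v) <= M) -> Cmod (em_int j F) <= B * M.
Proof.
  destruct (em_kernel_bound j) as [B [HB H]]. exists (2 * B). split; [lra|]. intros F M CF HM.
  eapply Rle_trans; [apply (cint_norm_const _ (B * M)); try lra; [apply em_int_cont; auto|]|lra].
  intros v Hv. rewrite Cmod_mult, Cmod_R. apply Rmult_le_compat; auto using Rabs_pos, Cmod_ge_0.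
Qed.

(** The integral over (0,oo) of f against the periodic extension of B_j/j!, taken
    as the series of the integrals over [k, k + 1], so that no improper integral is
    needed. *)
Definition em_series (j : nat) (f : R -> C) (l : C) : Prop := is_cseries (fun k => em_int j (fun
  v => f (INR k + v))) l.

Lemma INR_plus_nonneg (k : nat) v : 0 <= v <= 1 -> 0 <= INR k + v.
Proof. pose proof (pos_INR k). lra. Qed.

Lemma ccont_add f (a v : R) : ccont f (a + v) -> ccont (fun v => f (a + v)) v.
Proof. intros. apply (ccont_comp f (fun v => a + v)); auto.
  apply rcont_plus; [apply continuous_const|apply continuous_id]. Qed.

Lemma cder_add f (a v : R) l : cder f (a + v) l -> cder (fun v => f (a + v)) v l.
Proof. intros. eapply cder_eq; [apply (cder_comp f (fun v => a + v)); eauto; auto_derive; auto|].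
  ring. Qed.

Lemma em_series_lin j f g c l m : (forall u, 0 <= u -> ccont f u) ->
  (forall u, 0 <= u -> ccont g u) -> em_series j f l -> em_series j g m ->
  em_series j (fun u => f u + c * g u)%C (l + c * m)%C.
Proof.
  intros Cf Cg Hl Hm. unfold em_series. eapply is_cseries_ext; [|apply is_cseries_plus;
  [exact Hl|apply is_cseries_scal with (1 := Hm)]].
  intro k. cbv beta.
  assert (H1 : forall v, 0 <= v <= 1 -> ccont (fun v => f (INR k + v)) v) by (intros;
  apply ccont_add, Cf, INR_plus_nonneg; auto).
  assert (H2 : forall v, 0 <= v <= 1 -> ccont (fun v => g (INR k + v)) v) by (intros;
  apply ccont_add, Cg, INR_plus_nonneg; auto).
  rewrite <- em_int_scal, <- em_int_plus; auto. intros. apply ccont_mult; auto. apply ccont_const.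
Qed.

Lemma em_series_scal j f c l : (forall u, 0 <= u -> ccont f u) -> em_series j f l ->
  em_series j (fun u => c * f u)%C (c * l)%C.
Proof.
  intros Cf Hl. unfold em_series. eapply is_cseries_ext; [|apply is_cseries_scal with (1 := Hl)].
  intro k. cbv beta. rewrite <- em_int_scal; auto. intros.
  apply ccont_add, Cf, INR_plus_nonneg; auto.
Qed.

Lemma em_series_ext j f g l : (forall u, 0 < u -> f u = g u) -> em_series j f l ->
  em_series j g l.
Proof. intros E. apply is_cseries_ext. intro k. apply em_int_ext. intros v Hv. apply E.
  pose proof (pos_INR k); lra. Qed.

Lemma em_series_unique j f l m : em_series j f l -> em_series j f m -> l = m.
Proof. apply Clim_unique. Qed.

Lemma em_series_dominated j : exists B, 0 < B /\
  forall f (b : nat -> R), (forall u, 0 <= u -> ccont f u) ->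
  (forall k v, 0 <= v <= 1 -> Cmod (f (INR k + v)) <= b k) -> ex_series b ->
  exists l, em_series j f l /\ Cmod l <= B * Series b.
Proof.
  destruct (em_int_bound j) as [B [HB H]]. exists B. split; auto. intros f b Cf Hb Hs.
  destruct (is_cseries_dominated (fun k => em_int j (fun v => f (INR k + v))) (fun k => B * b k))
  as [l [Hl Bl]].
  - intro k. apply H; auto. intros v Hv. apply ccont_add, Cf, INR_plus_nonneg; auto.
  - apply (ex_series_scal_l (V:=R_NormedModule) B b); auto.
  - exists l. split; auto. rewrite Series_scal_l in Bl. auto.
Qed.

Lemma is_cseries_telescope f : Clim f 0 -> is_cseries (fun k => f (S k) - f k)%C (- f 0%nat)%C.
Proof.
  intros H. eapply Clim_ext; [intro n; symmetry; apply csum_telescope|].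
  replace (- f 0%nat)%C with (0 - f 0%nat)%C by ring. apply Clim_minus; auto. apply Clim_const.
Qed.

(** Integration by parts on each [k, k + 1]. For j >= 1 the next kernel is
    periodic, so the boundary terms telescope to the one at 0. *)
Lemma em_series_step j f df m : (forall u, 0 <= u -> cder f u (df u)) ->
  (forall u, 0 <= u -> ccont df u) -> Clim (fun k => f (INR k)) 0 -> em_series (S (S j)) df m ->
  em_series (S j) f (- RtoC (em_kernel (S (S j)) 0) * f 0 - m)%C.
Proof.
  intros Hf Hd H0 Hm. set (c := RtoC (em_kernel (S (S j)) 0)).
  pose proof (is_cseries_scal c _ _ (is_cseries_telescope _ H0)) as T. simpl (INR 0) in T.
  pose proof (is_cseries_plus _ _ _ _ T (is_cseries_scal (-(1))%C _ _ Hm)) as K.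
  replace (- c * f 0 - m)%C with (c * - f 0%R + - (1) * m)%C by ring.
  eapply is_cseries_ext; [|exact K]. intro k. cbv beta.
  rewrite (em_int_step (S j) _ (fun v => df (INR k + v))).
  - rewrite em_kernel_periodic. fold c. rewrite Rplus_0_r, <- S_INR. ring.
  - intros v Hv. apply cder_add, Hf, INR_plus_nonneg; auto.
  - intros v Hv. apply ccont_add, Hd, INR_plus_nonneg; auto.
Qed.

(** Euler-Maclaurin summation. Integration by parts with the kernel 1 produces f (k
    + 1) B_1(1) - f k B_1(0), which is f k plus a telescoping term. *)
Lemma sum_EM f df m I : (forall u, 0 <= u -> cder f u (df u)) ->
  (forall u, 0 <= u -> ccont df u) -> Clim (fun k => f (INR k)) 0 -> em_series 1 df m ->
  Clim (fun k => cint f 0 (INR k)) I ->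
  is_cseries (fun k => f (INR k)) (I + RtoC (em_kernel 1 1) * f 0 + m)%C.
Proof.
  intros Hf Hd H0 Hm HI. assert (Cf : forall u, 0 <= u -> ccont f u) by (intros;
  eapply cder_ccont; eauto).
  assert (S0 : is_cseries (fun k => em_int 0 (fun v => f (INR k + v))) I).
  { eapply Clim_ext; [|exact HI]. intro n. cbv beta. symmetry. induction n.
    - simpl. unfold cint. rewrite !RInt_point. reflexivity.
    - cbn [csum].
      rewrite IHn. pose proof (pos_INR n). rewrite S_INR,
      <- (cint_Chasles f 0 (INR n) (INR n + 1)); [|lra|intros; apply Cf; lra]. f_equal.
      unfold em_int. simpl em_kernel.
      transitivity (cint (fun y => RtoC 1 * f (1 * y + INR n)%R)%C 0 1).
      + apply cint_ext; [lra|]. intros u _. do 2 f_equal. ring.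
      + rewrite (cint_comp_lin f 1 (INR n) 0 1); try lra. f_equal; ring.
        intros y Hy. apply Cf. lra. }
  pose proof (is_cseries_scal (- RtoC (em_kernel 1 1))%C _ _ (is_cseries_telescope _ H0)) as T.
  simpl (INR 0) in T.
  pose proof (is_cseries_plus _ _ _ _ (is_cseries_plus _ _ _ _ S0 T) Hm) as K.
  replace (I + RtoC (em_kernel 1 1) * f 0 + m)%C with (I + - RtoC (em_kernel 1 1) * - f 0%R +
  m)%C by ring.
  eapply is_cseries_ext; [|exact K]. intro k. cbv beta.
  rewrite (em_int_step 0 _ (fun v => df (INR k + v))).
  - rewrite Rplus_0_r, <- S_INR, em_kernel_jump, RtoC_plus. ring.
  - intros v Hv. apply cder_add, Hf, INR_plus_nonneg; auto.
  - intros v Hv. apply ccont_add, Hd, INR_plus_nonneg; auto.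
Qed.

Lemma series_inv_sq x : 0 < x -> ex_series (fun k => / (INR k + x) ^ 2) /\
  Series (fun k => / (INR k + x) ^ 2) <= / x ^ 2 + / x.
Proof.
  intros Hx.
  assert (T : is_series (fun k => / (INR k + x) - / (INR (S k) + x)) (/ x)).
  { change (is_lim_seq (sum_n (fun k => / (INR k + x) - / (INR (S k) + x))) (/ x)).
    apply (is_lim_seq_ext (fun n => / x - / (INR (S n) + x))).
    - induction n. + rewrite sum_O. simpl INR. rewrite Rplus_0_l. reflexivity.
      + rewrite sum_Sn, <- IHn. unfold plus; simpl plus.
        change (/ x - / (INR (S (S n)) + x) = (/ x - / (INR (S n) + x)) + (/ (INR (S n) + x) - /
        (INR (S (S n)) + x))). ring.
    - replace (Finite (/ x)) with (Rbar_minus (/ x) 0) by (simpl; f_equal; ring).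
      apply is_lim_seq_minus'; [apply is_lim_seq_const|].
      apply (is_lim_seq_inv (fun n => INR (S n) + x) p_infty); [|discriminate].
      apply is_lim_seq_plus with (l1 := p_infty) (l2 := x); [|apply is_lim_seq_const|reflexivity].
      apply -> (is_lim_seq_incr_1 INR). apply is_lim_seq_INR. }
  assert (B : forall k, 0 <= / (INR (S k) + x) ^ 2 <= / (INR k + x) - / (INR (S k) + x)).
  { intro k. rewrite S_INR. pose proof (pos_INR k). set (y := INR k + x).
    replace (INR k + 1 + x) with (y + 1) by (unfold y; ring).
    assert (0 < y) by (unfold y; lra). split.
    - left. apply Rinv_0_lt_compat, pow_lt. lra.
    - replace (/ y - / (y + 1)) with (/ (y * (y + 1))) by (field; lra).
      apply Rinv_le_contravar; [|simpl]; nra. }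
  assert (E : ex_series (fun k => / (INR (S k) + x) ^ 2)).
  { apply (ex_series_le (V:=R_CompleteNormedModule)) with (2 := ex_intro _ _ T). intro k.
    unfold norm; simpl; unfold abs; simpl.
    rewrite Rabs_pos_eq by apply B. apply B. }
  assert (E' : ex_series (fun k => / (INR k + x) ^ 2)) by (apply (ex_series_incr_1 (fun k => /
  (INR k + x) ^ 2)); auto).
  split; auto. rewrite Series_incr_1; auto. apply Rplus_le_compat.
  - simpl INR. rewrite Rplus_0_l. lra.
  - rewrite <- (is_series_unique _ _ T). apply Series_le; auto. eexists; eauto.
Qed.

Lemma Rpower_bound2 x y e : 0 < x <= y -> e <= -2 -> Rpower y e <= Rpower x (e + 2) * / y ^ 2.
Proof.
  intros Hx He. replace e with ((e + 2) + - INR 2) at 1 by (simpl; ring).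
  rewrite Rpower_plus, Rpower_Ropp, Rpower_pow by lra. apply Rmult_le_compat_r.
  - left; apply Rinv_0_lt_compat, pow_lt; lra.
  - unfold Rpower. apply exp_le. assert (ln x <= ln y) by (destruct (Req_dec x y); [subst;
    lra|left; apply ln_increasing; lra]). nra.
Qed.

Lemma Clim_cpow_0 x s : 0 < x -> 0 < Re s -> Clim (fun k => cpow (INR k + x) (- s)) 0.
Proof.
  intros Hx Hs eps He. destruct (INR_unbounded (exp (- ln eps / Re s))) as [N HN]. exists N.
  intros n Hn.
  replace (cpow (INR n + x) (- s) - 0)%C with (cpow (INR n + x) (- s)) by ring.
  rewrite Cmod_cpow. change (Re (- s)) with (- Re s). unfold Rpower.
  rewrite <- (exp_ln eps) by auto. apply exp_increasing.
  assert (- ln eps / Re s < ln (INR n + x)).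
  { rewrite <- (ln_exp (- ln eps / Re s)). apply ln_increasing; [apply exp_pos|].
    apply le_INR in Hn. lra. }
  apply Rmult_lt_compat_l with (r := Re s) in H; auto.
  replace (Re s * (- ln eps / Re s)) with (- ln eps) in H by (field; lra). lra.
Qed.

Lemma ccont_cpow_shift s x u : 0 < u + x -> ccont (fun u => cpow (u + x) s) u.
Proof. intros. eapply cder_ccont, cder_cpow_shift; auto. Qed.

Lemma inv_sq_le x k v : 0 < x -> 0 <= v <= 1 -> / (INR k + v + x) ^ 2 <= / (INR k + x) ^ 2.
Proof.
  intros. pose proof (pos_INR k). apply Rinv_le_contravar; [apply pow_lt; lra|].
  apply pow_incr; lra.
Qed.

Lemma em_series_dominated2 x j : 0 < x -> exists B, 0 < B /\ forall f M, 0 <= M ->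
  (forall u, 0 <= u -> ccont f u) -> (forall u, 0 <= u -> Cmod (f u) <= M * / (u + x) ^ 2) ->
  exists l, em_series j f l /\ Cmod l <= M * B.
Proof.
  intros Hx. destruct (em_series_dominated j) as [B [HB H]].
  destruct (series_inv_sq x Hx) as [E _].
  exists (B * (Series (fun k => / (INR k + x) ^ 2) + 1)).
  assert (0 <= Series (fun k => / (INR k + x) ^ 2)) as HS.
  { destruct (is_cseries_dominated (fun _ => RtoC 0) (fun k => / (INR k + x) ^ 2)) as [l [_ Hl]];
    auto.
    - intro n. rewrite Cmod_0. left; apply Rinv_0_lt_compat, pow_lt. pose proof (pos_INR n). lra.
    - eapply Rle_trans; [apply Cmod_ge_0|exact Hl]. }
  split. { apply Rmult_lt_0_compat; lra. }
  intros f M HM Cf Hf.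
  destruct (H f (fun k => M * / (INR k + x) ^ 2)) as [l [Hl Bl]]; auto.
  - intros k v Hv. eapply Rle_trans; [apply Hf, INR_plus_nonneg; auto|].
    apply Rmult_le_compat_l; auto. apply inv_sq_le; auto.
  - apply (ex_series_scal_l (V:=R_NormedModule) M); auto.
  - exists l. split; auto. eapply Rle_trans; [exact Bl|]. rewrite Series_scal_l.
    set (S := Series _) in *. assert (0 <= B * M) by (apply Rmult_le_pos; lra). nra.
Qed.

(** * The Hurwitz zeta function *)
(** The continuation in s of the integral of (u + x)^(-s) against the j-th kernel,
    j >= 1. K counts the integrations by parts that are carried out before the
    series is summed; each replaces s by s + 1, so the value is meaningful as soon
    as Re s + K >= 2, and then it does not depend on K. *)
Fixpoint em_rem_upto (x : R) (K : nat) (j : nat) (s : C) : C :=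
  match K with
  | O => CSeries (fun k => em_int j (fun v => cpow (INR k + v + x) (- s)))
  | S K' => (- RtoC (em_kernel (S j) 0) * cpow x (- s) + s * em_rem_upto x K' (S j) (s + 1))%C
  end.

Lemma em_rem_base_series x j s : 0 < x -> 2 <= Re s ->
  em_series j (fun u => cpow (u + x) (- s)) (em_rem_upto x 0 j s).
Proof.
  intros Hx Hs. destruct (em_series_dominated2 x j Hx) as [B [HB H]].
  destruct (H (fun u => cpow (u + x) (- s)) (Rpower x (- Re s + 2))) as [l [Hl _]].
  - left; apply exp_pos.
  - intros u Hu. apply ccont_cpow_shift; lra.
  - intros u Hu. rewrite Cmod_cpow. change (Re (- s)) with (- Re s). apply Rpower_bound2; lra.
  - simpl. rewrite (CSeries_unique _ _ Hl). exact Hl.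
Qed.

(** One integration by parts under the series; this is the base case, and the
    recursion carries it to every K. *)
Lemma em_rem_upto_S x K : 0 < x -> forall j s, (1 <= j)%nat -> 2 <= Re s + INR K ->
  em_rem_upto x (S K) j s = em_rem_upto x K j s.
Proof.
  intros Hx. induction K; intros j s Hj Hs.
  - simpl INR in Hs. rewrite Rplus_0_r in Hs. destruct j as [|j]; [lia|].
    assert (H1 : em_series (S (S j)) (fun u => cpow (u + x) (- (s + 1))) (em_rem_upto x 0 (S (S
    j)) (s + 1)))
      by (apply em_rem_base_series; auto; change (Re (s + 1)) with (Re s + 1); lra).
    assert (H2 : em_series (S (S j)) (fun u => - s * cpow (u + x) (- s - 1))%C (- s * em_rem_upto
    x 0 (S (S j)) (s + 1))%C).
    { apply (em_series_scal _ _ (- s)%C) in H1; [|intros; apply ccont_cpow_shift; lra].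
      apply em_series_ext with (2 := H1). intros u _. cbv beta.
      replace (- (s + 1))%C with (- s - 1)%C by ring. reflexivity. }
    apply em_series_step with (f := fun u => cpow (u + x) (- s)) in H2.
    + pose proof (em_series_unique _ _ _ _ H2 (em_rem_base_series x (S j) s Hx ltac:(lra))) as E.
      rewrite <- E.
      change (em_rem_upto x 1 (S j) s) with (- RtoC (em_kernel (S (S j)) 0) * cpow x (- s) + s *
      em_rem_upto x 0 (S (S j)) (s + 1))%C. cbv beta. rewrite Rplus_0_l. ring.
    + intros u Hu. apply cder_cpow_shift; lra.
    + intros u Hu. apply ccont_mult; [apply ccont_const|apply ccont_cpow_shift; lra].
    + apply Clim_cpow_0; lra.
  - change (em_rem_upto x (S (S K)) j s) with (- RtoC (em_kernel (S j) 0) * cpow x (- s) + s *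
    em_rem_upto x (S K) (S j) (s + 1))%C.
    rewrite IHK; [reflexivity|lia|]. rewrite S_INR in Hs. change (Re (s + 1)) with (Re s + 1).
    lra.
Qed.

Lemma em_rem_upto_indep x K K' j s : 0 < x -> (1 <= j)%nat -> 2 <= Re s + INR K ->
  (K <= K')%nat -> em_rem_upto x K' j s = em_rem_upto x K j s.
Proof.
  intros Hx Hj Hs HK. induction HK; auto. rewrite em_rem_upto_S; auto. apply le_INR in HK. lra.
Qed.

(** The number of integrations by parts varies with s so that one definition serves
    all s; locally it can be replaced by a constant ([em_rem_eq]). *)
Definition em_rem (x : R) (j : nat) (s : C) : C := em_rem_upto x (Z.to_nat (up (2 - Re s))) j s.

Lemma lt_to_nat_up r : r < INR (Z.to_nat (up r)).
Proof.
  destruct (archimed r) as [H _]. destruct (Z.le_gt_cases 0 (up r)).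
  - rewrite INR_IZR_INZ, Z2Nat.id; auto; lra.
  - replace (Z.to_nat (up r)) with 0%nat by lia. simpl. apply Rlt_trans with (IZR (up r)); auto.
    apply IZR_lt; lia.
Qed.

Lemma em_rem_eq x K j s : 0 < x -> (1 <= j)%nat -> 2 <= Re s + INR K ->
  em_rem x j s = em_rem_upto x K j s.
Proof.
  intros Hx Hj Hs. unfold em_rem. pose proof (lt_to_nat_up (2 - Re s)).
  set (K' := Z.to_nat (up (2 - Re s))) in *.
  destruct (Nat.le_ge_cases K K') as [h|h]; [|symmetry]; apply em_rem_upto_indep; auto; lra.
Qed.

Lemma em_rem_rec x j s : 0 < x -> (1 <= j)%nat ->
  em_rem x j s = (- RtoC (em_kernel (S j) 0) * cpow x (- s) + s * em_rem x (S j) (s + 1))%C.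
Proof.
  intros Hx Hj. set (K := Z.to_nat (up (2 - Re s))). pose proof (lt_to_nat_up (2 - Re s)).
  fold K in H.
  rewrite (em_rem_eq x (S K) j s), (em_rem_eq x K (S j) (s + 1)); auto; try lra.
  - change (Re (s + 1)) with (Re s + 1). lra.
  - rewrite S_INR. lra.
Qed.

Lemma em_rem_series x j s : 0 < x -> (1 <= j)%nat -> 2 <= Re s ->
  em_series j (fun u => cpow (u + x) (- s)) (em_rem x j s).
Proof. intros. rewrite (em_rem_eq x 0) by (auto; simpl; lra).
  apply em_rem_base_series; auto; lra. Qed.

Lemma analytic_at_cexp c z0 : analytic_at (fun s => cexp (s * RtoC c)) z0.
Proof.
  destruct (transform_power_series (fun f l => f 0 = l) (fun u => u = 0) (fun _ => - c) z0 1 (exp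
  (- Re z0 * - c + 1 * Rabs (- c)))) with (F := fun s => cexp (s * RtoC c)) as [a [Ha _]].
  - lra.
  - intros f g c0 l m <- <-. reflexivity.
  - intros f l m <- <-. reflexivity.
  - intros f g l E <-. auto.
  - intros f B HB _ Hf. exists (f 0). split; auto.
  - intros; apply continuous_const.
  - intros s _. f_equal. rewrite RtoC_opp. ring.
  - eexists; eexists; eauto.
Qed.

Lemma analytic_at_cpow a z0 : analytic_at (fun s => cpow a s) z0.
Proof. eapply analytic_at_ext; [|apply (analytic_at_cexp (ln a))].
  intro; rewrite cpow_cexp; auto. Qed.

(** One of the two exponentials on the right dominates, according to the sign of y.
    It turns the domination required by [transform_power_series] into two powers of
    u + x. *)
Lemma exp_abs_le c r y : 0 <= r ->
  exp (- c * y + r * Rabs y) <= exp (- (c - r) * y) + exp (- (c + r) * y).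
Proof.
  intros Hr. pose proof (exp_pos (- (c - r) * y)). pose proof (exp_pos (- (c + r) * y)).
  destruct (Rle_dec 0 y).
  - rewrite Rabs_pos_eq by auto. replace (- c * y + r * y) with (- (c - r) * y) by ring. lra.
  - rewrite Rabs_left by lra. replace (- c * y + r * - y) with (- (c + r) * y) by ring. lra.
Qed.

Lemma em_rem_base_analytic x j s0 : 0 < x -> 2 < Re s0 -> analytic_at (em_rem_upto x 0 j) s0.
Proof.
  intros Hx Hs. set (r := Re s0 - 2). destruct (em_series_dominated2 x j Hx) as [B [HB HD]].
  set (M := Rpower x (- (Re s0 - r) + 2) + Rpower x (- (Re s0 + r) + 2)).
  assert (HM : 0 <= M) by (apply Rplus_le_le_0_compat; left; apply exp_pos).
  destruct (transform_power_series (fun f l => (forall u,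
  0 <= u -> ccont f u) /\ em_series j f l) (fun u => 0 <= u) (fun u => ln (u + x)) s0 r (M * B))
    with (F := em_rem_upto x 0 j) as [a [Ha _]].
  - unfold r; lra.
  - intros f g c l m [Cf Hf] [Cg Hg]. split.
    + intros u Hu. apply ccont_plus; auto. apply ccont_mult; auto. apply ccont_const.
    + apply em_series_lin; auto.
  - intros f l m [_ H1] [_ H2]. eapply em_series_unique; eauto.
  - intros f g l E [C H]. split.
    + intros u Hu. apply (ccont_ext_loc f); auto. apply filter_forall; auto.
    + eapply em_series_ext; eauto.
  - intros f C HC Cf Hf. destruct (HD f (C * M)) as [l [Hl Bl]]; auto.
    + apply Rmult_le_pos; auto.
    + intros u Hu. eapply Rle_trans; [apply Hf; auto|]. rewrite Rmult_assoc.
      apply Rmult_le_compat_l; auto.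
      eapply Rle_trans; [apply exp_abs_le; unfold r; lra|]. unfold M. rewrite Rmult_plus_distr_r.
      apply Rplus_le_compat; apply Rpower_bound2; unfold r; lra.
    + exists l. split; [split; auto|]. rewrite <- Rmult_assoc. auto.
  - intros u Hu. continuity_by_derive. lra.
  - intros s Hs2.
    assert (2 < Re s).
    { pose proof (re_le_Cmod (s - s0)) as K. change (Re (s - s0)) with (Re s - Re s0) in K.
      apply Rabs_le_between in K. unfold r in *; lra. }
    split.
    + intros u Hu. apply (ccont_ext_loc (fun u => cpow (u + x) (- s))); [|apply ccont_cpow_shift;
      lra].
      apply filter_forall. intro t. rewrite cpow_cexp; auto.
    + eapply em_series_ext; [|apply em_rem_base_series; auto; lra]. intros u _. simpl.
      rewrite cpow_cexp; auto.
  - eexists; eexists; eauto.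
Qed.

Lemma em_rem_upto_analytic x K : 0 < x -> forall j s0, 2 < Re s0 + INR K ->
  analytic_at (em_rem_upto x K j) s0.
Proof.
  intros Hx. induction K; intros j s0 Hs.
  - apply em_rem_base_analytic; auto. simpl in Hs; lra.
  - simpl em_rem_upto. apply analytic_at_plus.
    + apply analytic_at_scal. apply (analytic_at_opp_arg (fun s => cpow x s)).
      apply analytic_at_cpow.
    + apply analytic_at_mult; [apply analytic_at_id|].
      apply (analytic_at_shift (em_rem_upto x K (S j))). apply IHK.
      change (Re (s0 + 1)) with (Re s0 + 1). rewrite S_INR in Hs. lra.
Qed.

Lemma Re_close s s0 d : Cmod (s - s0) < d -> Rabs (Re s - Re s0) < d.
Proof. intros H. eapply Rle_lt_trans; [|exact H]. apply (re_le_Cmod (s - s0)). Qed.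

Lemma em_rem_analytic x j s0 : 0 < x -> (1 <= j)%nat -> analytic_at (em_rem x j) s0.
Proof.
  intros Hx Hj. set (K := Z.to_nat (up (3 - Re s0))). pose proof (lt_to_nat_up (3 - Re s0)).
  fold K in H.
  apply (analytic_at_ext_loc (em_rem_upto x K j) _ _ 1); [lra| |apply em_rem_upto_analytic; auto;
  lra].
  intros s Hs. symmetry. apply em_rem_eq; auto. apply Re_close in Hs. apply Rabs_def2 in Hs. lra.
Qed.

(** The zeta function minus its integral term x^(1-s)/(s-1): an entire function. *)
Definition zeta_reg (x : R) (s : C) : C := (RtoC (em_kernel 1 1) * cpow x (- s) - s * em_rem x 1
  (s + 1))%C.
Definition zeta_em (x : R) (s : C) : C := (cpow x (1 - s) / (s - 1) + zeta_reg x s)%C.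

Lemma zeta_reg_analytic x s0 : 0 < x -> analytic_at (zeta_reg x) s0.
Proof.
  intros Hx. apply analytic_at_minus.
  - apply analytic_at_scal. apply (analytic_at_opp_arg (fun s => cpow x s)).
    apply analytic_at_cpow.
  - apply analytic_at_mult; [apply analytic_at_id|]. apply (analytic_at_shift (em_rem x 1)).
    apply em_rem_analytic; auto.
Qed.

Lemma zeta_em_analytic x (s0 : C) : 0 < x -> s0 <> 1 -> analytic_at (zeta_em x) s0.
Proof.
  intros Hx H1. apply analytic_at_plus; [|apply zeta_reg_analytic; auto]. apply analytic_at_mult.
  - eapply analytic_at_ext; [|apply (analytic_at_shift (fun s => cpow x (- s)) (-(1))%C)].
    + intro z. cbv beta. f_equal. ring.
    + apply (analytic_at_opp_arg (fun s => cpow x s)), analytic_at_cpow.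
  - apply (analytic_at_shift (fun z => / z)%C (-(1))%C). apply analytic_at_inv. intro E. apply H1.
    replace s0 with (s0 + - (1) + 1)%C by ring. rewrite E. ring.
Qed.

(** Euler-Maclaurin summation of (u + x)^(-s), whose integral over (0,oo) is
    x^(1-s)/(s-1). *)
Lemma zeta_em_dirichlet x s : 0 < x -> 1 < Re s ->
  is_cseries (fun n => cpow (INR n + x) (- s)) (zeta_em x s).
Proof.
  intros Hx Hs. set (f := fun u => cpow (u + x) (- s)).
  assert (Hs1 : (s - 1)%C <> 0). { intro E. assert (Re (s - 1) = 0) as K by (rewrite E;
  reflexivity). change (Re (s - 1)) with (Re s - 1) in K. lra. }
  assert (H2 : em_series 1 (fun u => - s * cpow (u + x) (- s - 1))%C (- s * em_rem x 1 (s +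
  1))%C).
  { assert (H1 : em_series 1 (fun u => cpow (u + x) (- (s + 1))) (em_rem x 1 (s + 1)))
      by (apply em_rem_series; auto; change (Re (s + 1)) with (Re s + 1); lra).
    apply (em_series_scal _ _ (- s)%C) in H1; [|intros; apply ccont_cpow_shift; lra].
    apply em_series_ext with (2 := H1). intros u _. cbv beta.
    replace (- (s + 1))%C with (- s - 1)%C by ring. reflexivity. }
  pose proof (sum_EM f (fun u => - s * cpow (u + x) (- s - 1))%C (- s * em_rem x 1 (s + 1))%C
  (cpow x (1 - s) / (s - 1))%C) as K.
  replace (zeta_em x s) with (cpow x (1 - s) / (s - 1) + RtoC (em_kernel 1 1) * f 0%R + - s *
  em_rem x 1 (s + 1))%C.
  2:{ unfold zeta_em, zeta_reg, f. rewrite Rplus_0_l. ring. }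
  apply K; auto.
  - intros u Hu. apply cder_cpow_shift; lra.
  - intros u Hu. apply ccont_mult; [apply ccont_const|apply ccont_cpow_shift; lra].
  - apply Clim_cpow_0; lra.
  - assert (E : forall k, ((cpow (INR k + x) (- (s - 1)) - cpow x (1 - s)) / (1 - s))%C = cint f
    0 (INR k)).
    { intro k. pose proof (pos_INR k). symmetry.
      rewrite (cint_FTC (fun u => / (1 - s) * cpow (u + x) (1 - s))%C); auto.
      - rewrite Rplus_0_l. replace (- (s - 1))%C with (1 - s)%C by ring. field.
        intro E0; apply Hs1. replace (s - 1)%C with (- (1 - s))%C by ring. rewrite E0. ring.
      - intros u Hu. eapply cder_eq; [apply cder_scal, cder_cpow_shift; lra|].
        replace (1 - s - 1)%C with (- s)%C by ring. unfold f.
        field. intro E0; apply Hs1. replace (s - 1)%C with (- (1 - s))%C by ring. rewrite E0.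
        ring.
      - intros u Hu. apply ccont_cpow_shift; lra. }
    eapply Clim_ext; [exact E|].
    pose proof (Clim_cpow_0 x (s - 1) Hx ltac:(change (Re (s - 1)) with (Re s - 1); lra)) as L.
    pose proof (Clim_scal (/ (1 - s))%C _ _ (Clim_minus _ _ _ _ L (Clim_const (cpow x (1 - s)))))
    as L2.
    replace (cpow x (1 - s) / (s - 1))%C with (/ (1 - s) * (0 - cpow x (1 - s)))%C.
    + apply Clim_ext with (2 := L2). intro k. cbv beta. unfold Cdiv. ring.
    + field. split; auto. intro E0; apply Hs1. replace (s - 1)%C with (- (1 - s))%C by ring.
      rewrite E0. ring.
Qed.

Lemma zeta_em_is_hurwitz x : 0 < x -> is_hurwitz_zeta x (zeta_em x).
Proof.
  intros Hx. split.
  - apply analytic_on_iff. intros z Hz. apply zeta_em_analytic; auto.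
  - intros s Hs. apply is_cseries_iff. apply zeta_em_dirichlet; auto.
Qed.

(** * Uniqueness of the continuation *)
(** The horizontal line through s avoids the pole at 1 and reaches the half plane
    of convergence, where both functions are the sum of the Dirichlet series. *)
Lemma hurwitz_unique_off_axis x f g s : is_hurwitz_zeta x f -> is_hurwitz_zeta x g ->
  Im s <> 0 -> f s = g s.
Proof.
  intros [Af Hf] [Ag Hg] Hs. rewrite analytic_on_iff in Af, Ag.
  set (h := fun z => (f z - g z)%C).
  (* Far enough to the right for Re > 1 to hold on an initial piece of the segment
     from z0 to s. *)
  set (z0 := ((3 + Rabs (Re s))%R, Im s) : C). set (w := (s - z0)%C).
  assert (Hw : w = RtoC (Re s - 3 - Rabs (Re s))) by (apply injective_projections; simpl;
  unfold Re, Im; ring).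
  assert (E : h (z0 + w)%C = 0).
  { apply (analytic_at_segment h z0 w (/ (3 + 2 * Rabs (Re s)))).
    - intros tau Ht. apply analytic_at_minus; [apply Af|apply Ag]; intro K; apply Hs;
        assert (Im (z0 + RtoC tau * w) = 0) as K' by (rewrite K; reflexivity); rewrite Hw in K';
        unfold z0, Im in *; simpl in K'; lra.
    - apply Rinv_0_lt_compat. pose proof (Rabs_pos (Re s)). lra.
    - intros tau Ht. unfold h.
      assert (1 < Re (z0 + RtoC tau * w)).
      { rewrite Hw. unfold z0, Re; simpl. unfold Re in *. pose proof (Rabs_pos (fst s)).
        pose proof (Rle_abs (- fst s)) as Q. rewrite Rabs_Ropp in Q.
        assert (tau * (3 + 2 * Rabs (fst s)) < 1).
        { replace 1 with (/ (3 + 2 * Rabs (fst s)) * (3 + 2 * Rabs (fst s))) by (field; lra).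
        apply Rmult_lt_compat_r; lra. }
        nra. }
      pose proof (proj2 (is_cseries_iff _ _) (Hf _ H)) as S1.
      pose proof (proj2 (is_cseries_iff _ _) (Hg _ H)) as S2.
      rewrite (Clim_unique _ _ _ S1 S2). ring. }
  unfold h in E. replace (z0 + w)%C with s in E by (unfold w; ring).
  apply Ceq_minus. exact E.
Qed.

(** For real s the line to the half plane meets the pole. But both functions are
    analytic at s and agree at the points s + i tau, hence at s. *)
Lemma hurwitz_unique x f g (s : C) : is_hurwitz_zeta x f -> is_hurwitz_zeta x g -> s <> 1 ->
  f s = g s.
Proof.
  intros Hf Hg Hs. destruct (Req_dec (Im s) 0) as [h|h]; [|eapply hurwitz_unique_off_axis; eauto].
  destruct (analytic_at_vanish (fun z => f z - g z)%C s Ci 1) as [r [Hr K]].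
  - pose proof (proj1 (analytic_on_iff _ _) (proj1 Hf) s Hs).
    pose proof (proj1 (analytic_on_iff _ _) (proj1 Hg) s Hs). apply analytic_at_minus; auto.
  - intro E. apply (f_equal snd) in E. simpl in E. lra.
  - lra.
  - intros tau Ht. rewrite (hurwitz_unique_off_axis x f g); auto; [ring|].
    unfold Im in *; simpl. lra.
  - specialize (K s). replace (s - s)%C with (RtoC 0) in K by ring. rewrite Cmod_0 in K.
    apply Ceq_minus, K, Hr.
Qed.

Lemma hurwitz_zeta_em x (s : C) : 0 < x -> s <> 1 -> hurwitz_zeta s x = zeta_em x s.
Proof.
  intros Hx Hs. unfold hurwitz_zeta. eapply hurwitz_unique; eauto using zeta_em_is_hurwitz.
  apply epsilon_spec. exists (zeta_em x). apply zeta_em_is_hurwitz; auto.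
Qed.

Lemma Rpower_le_base x a b : 1 <= x -> a <= b -> Rpower x a <= Rpower x b.
Proof.
  intros Hx Hab. unfold Rpower. apply exp_le. apply Rmult_le_compat_r; auto.
  rewrite <- ln_1. destruct (Req_dec 1 x); [subst; lra|left; apply ln_increasing; lra].
Qed.

Lemma Rpower_m2 x : 0 < x -> Rpower x (-2) = / x ^ 2.
Proof. intros. replace (-2) with (- INR 2) by (simpl; ring).
  rewrite Rpower_Ropp, Rpower_pow; auto. Qed.

Lemma csum_comb4 (a b c d : nat -> C) (p q r : C) n :
  (forall k, (k < n)%nat -> a k = (p * b k + q * c k + r * d k)%C) ->
  csum a n = (p * csum b n + q * csum c n + r * csum d n)%C.
Proof. induction n; intros H; simpl; [ring|]. rewrite IHn, H by auto. ring. Qed.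

(** * Sums of k^sigma H(tk) *)
(** H i stands for the i-th iterate of u d/du on H 0, which has Taylor coefficients
    g n; then the coefficients of H i are n^i g n. *)
Section Asymptotic.
Variables (H : nat -> R -> R) (g : nat -> R).
Hypothesis Hder : forall i u, 0 < u -> is_derive (H i) u (H (S i) u / u).
Hypothesis Htay : forall i N, exists B, 0 <= B /\ forall u, 0 < u ->
  Cmod (RtoC (H i u) - csum (fun n => RtoC (INR n ^ i * g n * u ^ n)) N)%C <= B * u ^ N.
Hypothesis Hdec : forall i p, exists B, 0 <= B /\ forall u, 0 < u -> Rabs (H i u) <= B / u ^ p.

(** The k-th term of the sum over k >= 1, with k = u + 1, so that the range of u
    starts at 0. *)
Definition dil_term (sg : C) (i : nat) (t u : R) : C := (cpow (u + 1) sg * RtoC (H i (t * (u +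
  1))))%C.

Lemma H_continuous i u : 0 < u -> continuous (H i) u.
Proof. intros. apply (ex_derive_continuous (V:=R_NormedModule)). eexists; apply Hder; auto. Qed.

Lemma dil_term_ccont sg i t u : 0 < t -> 0 <= u -> ccont (dil_term sg i t) u.
Proof.
  intros Ht Hu. apply ccont_mult; [apply ccont_cpow_shift; lra|]. apply ccont_RtoC.
  apply (continuous_comp (fun u => t * (u + 1)) (H i)).
  - continuity_by_derive. auto.
  - apply H_continuous. apply Rmult_lt_0_compat; lra.
Qed.

(** Differentiation lowers the exponent by 1 and raises the index of H by at most
    1: this is why the family H i, in place of H 0 alone, is considered. *)
Lemma dil_term_der sg i t u : 0 < t -> 0 <= u ->
  cder (dil_term sg i t) u (sg * dil_term (sg - 1) i t u + dil_term (sg - 1) (S i) t u)%C.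
Proof.
  intros Ht Hu. assert (0 < t * (u + 1)) by (apply Rmult_lt_0_compat; lra).
  eapply cder_eq; [apply cder_mult; [apply cder_cpow_shift; lra|apply cder_RtoC]|].
  - apply (is_derive_comp (H i) (fun u => t * (u + 1))); [apply Hder; auto|]. auto_derive; auto.
  - unfold dil_term. cbv beta.
    replace (cpow (u + 1) sg) with (cpow (u + 1) (sg - 1) * RtoC (u + 1))%C.
    2:{ rewrite <- (cpow_1 (u + 1)) by lra. rewrite <- cpow_plus. f_equal. ring. }
    change (scal (t * 1) (H (S i) (t * (u + 1)) / (t * (u + 1)))) with (t * 1 * (H (S i) (t * (u
    + 1)) / (t * (u + 1)))).
    replace (t * 1 * (H (S i) (t * (u + 1)) / (t * (u + 1)))) with (H (S i) (t * (u + 1)) / (u +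
    1)) by (field; lra).
    assert (RtoC (u + 1) <> 0) by (intro E; apply RtoC_inj in E; lra).
    rewrite RtoC_div by lra. field. auto.
Qed.

Lemma dil_term_bound sg i t : 0 < t -> exists B, 0 <= B /\ forall u, 0 <= u ->
  Cmod (dil_term sg i t u) <= B * / (u + 1) ^ 2.
Proof.
  intros Ht. destruct (INR_unbounded (Re sg + 2)) as [p Hp]. destruct (Hdec i p) as [B [HB K]].
  assert (0 < t ^ p) by (apply pow_lt; auto).
  exists (B / t ^ p). split. { apply Rmult_le_pos; auto. left; apply Rinv_0_lt_compat; auto. }
  intros u Hu. unfold dil_term. rewrite Cmod_mult, Cmod_cpow, Cmod_R.
  assert (0 < t * (u + 1)) by (apply Rmult_lt_0_compat; lra).
  eapply Rle_trans; [apply Rmult_le_compat_l; [left; apply exp_pos|apply K; auto]|].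
  rewrite Rpow_mult_distr. rewrite <- Rpower_m2 by lra. rewrite <- (Rpower_pow p (u + 1)) by lra.
  replace (Rpower (u + 1) (Re sg) * (B / (t ^ p * Rpower (u + 1) (INR p)))) with (B / t ^ p *
  (Rpower (u + 1) (Re sg) * Rpower (u + 1) (- INR p))).
  2:{ rewrite Rpower_Ropp. field. split; [apply Rgt_not_eq, exp_pos|lra]. }
  rewrite <- Rpower_plus. apply Rmult_le_compat_l. { apply Rmult_le_pos; auto.
  left; apply Rinv_0_lt_compat; auto. }
  apply Rpower_le_base; lra.
Qed.

Lemma dil_term_series_ex j sg i t : 0 < t -> exists l, em_series j (dil_term sg i t) l.
Proof.
  intros Ht. destruct (em_series_dominated2 1 j Rlt_0_1) as [B [_ K]].
  destruct (dil_term_bound sg i t Ht) as [B' [HB' K']].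
  destruct (K (dil_term sg i t) B') as [l [Hl _]]; auto. { intros; apply dil_term_ccont; auto.
  } exists l; auto.
Qed.

Lemma dil_term_lim0 sg i t : 0 < t -> Clim (fun k => dil_term sg i t (INR k)) 0.
Proof.
  intros Ht. destruct (dil_term_bound sg i t Ht) as [B [HB K]].
  apply Clim_bound0 with (fun k => B * / (INR k + 1) ^ 2). { intro k; apply K, pos_INR. }
  apply ex_series_lim_0. apply (ex_series_scal_l (V:=R_NormedModule) B). apply series_inv_sq; lra.
Qed.

Lemma dil_term_der_series j sg i t m1 m2 : 0 < t -> em_series j (dil_term (sg - 1) i t) m1 ->
  em_series j (dil_term (sg - 1) (S i) t) m2 ->
  em_series j (fun u => sg * dil_term (sg - 1) i t u + dil_term (sg - 1) (S i) t u)%C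
  (sg * m1 + m2)%C.
Proof.
  intros Ht H1 H2. replace (sg * m1 + m2)%C with (m2 + sg * m1)%C by ring.
  eapply em_series_ext; [|apply em_series_lin; [| |exact H2|exact H1]; intros;
  apply dil_term_ccont; auto].
  intros u _. cbv beta. ring.
Qed.

Lemma em_series_sub_csum j f l n (a : nat -> R -> C) (b : nat -> C) :
  (forall u, 0 <= u -> ccont f u) -> em_series j f l ->
  (forall k u, (k < n)%nat -> 0 <= u -> ccont (a k) u) ->
  (forall k, (k < n)%nat -> em_series j (a k) (b k)) ->
  em_series j (fun u => f u - csum (fun k => a k u) n)%C (l - csum b n)%C /\
  (forall u, 0 <= u -> ccont (fun u => csum (fun k => a k u) n) u).
Proof.
  intros Cf Hl. induction n; intros Ca Hb.
  - simpl. split; [|intros; apply ccont_const]. replace (l - 0)%C with l by ring.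
    apply em_series_ext with (2 := Hl). intros; ring.
  - destruct IHn as [K1 K2]; auto. simpl. split.
    + replace (l - (csum b n + b n))%C with (l - csum b n + - (1) * b n)%C by ring.
      apply em_series_ext with (2 := em_series_lin j (fun u => f u - csum (fun k => a k u) n)%C
      (a n) (-(1))%C _ _
        (fun u Hu => ccont_minus _ _ _ (Cf u Hu) (K2 u Hu)) (fun u Hu => Ca n u
        (Nat.lt_succ_diag_r n) Hu) K1 (Hb n (Nat.lt_succ_diag_r n))).
      intros u _. cbv beta. ring.
    + intros u Hu. apply ccont_plus; auto.
Qed.

(** If the exponent is very negative, the powers (u + 1)^(sg + n), n < N, and the
    remainder of H i can all be integrated against the kernel, the remainder giving
    O(t^N). Otherwise integrate by parts once: the exponent drops by 1, the
    boundary term H i t has the expected Taylor expansion, and [em_rem_rec] shows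
    that the expected coefficients obey the same recursion. K bounds the number of
    such steps. *)
Lemma tail_asym N K : forall j i sg, (1 <= j)%nat -> Re sg + INR N + 2 < INR K ->
  exists B, 0 <= B /\ forall t l, 0 < t -> em_series j (dil_term sg i t) l ->
  Cmod (l - csum (fun n => RtoC (INR n ^ i * g n * t ^ n) * em_rem 1 j (- sg - RtoC (INR n)))%C
  N) <= B * t ^ N.
Proof.
  induction K; intros j i sg Hj Hs.
  (* Re sg + N + 2 < 0: every power involved is at most (u + 1)^(-2). *)
  - simpl in Hs. destruct (em_series_dominated2 1 j Rlt_0_1) as [B [HB D]].
    destruct (Htay i N) as [B' [HB' T]].
    exists (B' * B). split; [apply Rmult_le_pos; lra|]. intros t l Ht Hl.
    destruct (em_series_sub_csum j (dil_term sg i t) l N (fun n u => RtoC (INR n ^ i * g n * t ^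
    n) * cpow (u + 1) (- (- sg - RtoC (INR n))))%C
       (fun n => RtoC (INR n ^ i * g n * t ^ n) * em_rem 1 j (- sg - RtoC (INR n)))%C) as [P1 P2].
    + intros; apply dil_term_ccont; auto.
    + exact Hl.
    + intros k u _ Hu. apply ccont_mult; [apply ccont_const|apply ccont_cpow_shift; lra].
    + intros k Hk. apply em_series_scal. { intros u Hu; apply ccont_cpow_shift; lra. }
      apply em_rem_series; auto; [lra|]. change (Re (- sg - RtoC (INR k))) with (- Re sg - INR
      k). apply lt_INR in Hk. lra.
    + destruct (D _ (B' * t ^ N) (Rmult_le_pos _ _ HB' (pow_le _ _ (Rlt_le _ _ Ht))) (fun u Hu =>
      ccont_minus _ _ _ (dil_term_ccont sg i t u Ht Hu) (P2 u Hu))) as [l' [Hl' Bl]].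
      * intros u Hu. assert (0 < t * (u + 1)) by (apply Rmult_lt_0_compat; lra).
        specialize (T (t * (u + 1)) H0). 
        replace (dil_term sg i t u - csum (fun k => RtoC (INR k ^ i * g k * t ^ k) * cpow (u + 1)
        (- (- sg - RtoC (INR k))))%C N)%C
          with (cpow (u + 1) sg * (RtoC (H i (t * (u + 1))) - csum (fun n => RtoC (INR n ^ i * g
          n * (t * (u + 1)) ^ n)) N))%C.
        -- rewrite Cmod_mult, Cmod_cpow. eapply Rle_trans; [apply Rmult_le_compat_l; [left;
           apply exp_pos|exact T]|].
           rewrite Rpow_mult_distr, <- (Rpower_pow N (u + 1)), <- Rpower_m2 by lra.
           replace (Rpower (u + 1) (Re sg) * (B' * (t ^ N * Rpower (u + 1) (INR N)))) with (B' *
           t ^ N * (Rpower (u + 1) (Re sg) * Rpower (u + 1) (INR N))) by ring.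
           rewrite <- Rpower_plus. apply Rmult_le_compat_l; [apply Rmult_le_pos; auto;
           apply pow_le; lra|]. apply Rpower_le_base; lra.
        -- unfold dil_term. unfold Cminus. rewrite Cmult_plus_distr_l. f_equal.
           replace (cpow (u + 1) sg * - csum (fun n => RtoC (INR n ^ i * g n * (t * (u + 1)) ^
           n)) N)%C with
             (- (cpow (u + 1) sg * csum (fun n => RtoC (INR n ^ i * g n * (t * (u + 1)) ^ n))
             N))%C by ring.
           f_equal. rewrite <- csum_scal. apply csum_ext. intros k _.
           replace (- (- sg + - RtoC (INR k)))%C with (sg + RtoC (INR k))%C by ring.
           rewrite cpow_plus, cpow_INR by lra.
           rewrite Rpow_mult_distr, !RtoC_mult. ring.
      * rewrite (em_series_unique _ _ _ _ P1 Hl').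
        replace (B' * B * t ^ N) with (B' * t ^ N * B) by ring. exact Bl.
  - destruct (IHK (S j) i (sg - 1)%C) as [B1 [HB1 K1]]; [lia| |].
    { change (Re (sg - 1)) with (Re sg - 1). rewrite S_INR in Hs. lra. }
    destruct (IHK (S j) (S i) (sg - 1)%C) as [B2 [HB2 K2]]; [lia| |].
    { change (Re (sg - 1)) with (Re sg - 1). rewrite S_INR in Hs. lra. }
    destruct (Htay i N) as [B0 [HB0 T]]. set (c := RtoC (em_kernel (S j) 0)).
    pose proof (Cmod_ge_0 c). pose proof (Cmod_ge_0 sg).
    exists (Cmod c * B0 + Cmod sg * B1 + B2). split. { pose proof (Rmult_le_pos _ _ H0 HB0).
    pose proof (Rmult_le_pos _ _ H1 HB1). lra. }
    intros t l Ht Hl.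
    destruct (dil_term_series_ex (S j) (sg - 1) i t Ht) as [m1 Hm1].
    destruct (dil_term_series_ex (S j) (sg - 1) (S i) t Ht) as [m2 Hm2].
    destruct j as [|j']; [lia|].
    pose proof (em_series_step j' (dil_term sg i t) _ (sg * m1 + m2)%C (fun u Hu => dil_term_der
    sg i t u Ht Hu)) as P. cbv beta in P. fold c in P.
    assert (El : l = (- c * dil_term sg i t 0 - (sg * m1 + m2))%C).
    { eapply em_series_unique; [exact Hl|]. apply P.
      - intros u Hu. apply ccont_plus; [apply ccont_mult; [apply ccont_const|]|];
        apply dil_term_ccont; auto.
      - apply dil_term_lim0; auto. - apply dil_term_der_series; auto. }
    assert (E0 : dil_term sg i t 0 = RtoC (H i t)).
    { unfold dil_term. rewrite !Rplus_0_l, Rmult_1_r, cpow_1_l. ring. }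
    rewrite El, E0.
    rewrite (csum_comb4 _ (fun n => RtoC (INR n ^ i * g n * t ^ n)) (fun n => RtoC (INR n ^ i * g
    n * t ^ n) * em_rem 1 (S (S j')) (- (sg - 1) - RtoC (INR n)))%C
       (fun n => RtoC (INR n ^ S i * g n * t ^ n) * em_rem 1 (S (S j')) (- (sg - 1) - RtoC (INR
       n)))%C (- c)%C (- sg)%C (- (1))%C).
    2:{ intros k _. rewrite em_rem_rec by (auto; lra). fold c. rewrite cpow_1_l.
        replace (- sg - RtoC (INR k) + 1)%C with (- (sg - 1) - RtoC (INR k))%C by ring.
        simpl pow. rewrite !RtoC_mult. ring. }
    specialize (K1 t m1 Ht Hm1). specialize (K2 t m2 Ht Hm2). specialize (T t Ht).
    set (s0 := csum _ N) in T |- *. set (s1 := csum _ N) in K1 |- *.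
    set (s2 := csum _ N) in K2 |- *.
    replace (- c * RtoC (H i t) - (sg * m1 + m2) - (- c * s0 + - sg * s1 + - (1) * s2))%C with
      (- (c * (RtoC (H i t) - s0)) + - (sg * (m1 - s1)) + - (m2 - s2))%C by ring.
    eapply Rle_trans; [apply Cmod_triangle|]. eapply Rle_trans;
    [apply Rplus_le_compat_r, Cmod_triangle|].
    rewrite !Cmod_opp, !Cmod_mult.
    assert (Cmod c * Cmod (RtoC (H i t) - s0) <= Cmod c * (B0 * t ^ N)) by (apply
    Rmult_le_compat_l; auto).
    assert (Cmod sg * Cmod (m1 - s1) <= Cmod sg * (B1 * t ^ N)) by (apply Rmult_le_compat_l;
    auto).
    lra.
Qed.

(** Euler-Maclaurin summation, with [tail_asym] for the two parts of the
    derivative. The boundary and kernel terms belonging to g n t^n are those of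
    [zeta_reg] at - sg - n. *)
Lemma sum_asym N sg : exists B, 0 <= B /\ forall t I, 0 < t ->
  Clim (fun k => cint (dil_term sg 0 t) 0 (INR k)) I ->
  exists l, is_cseries (fun k => dil_term sg 0 t (INR k)) l /\
  Cmod (l - I - csum (fun n => RtoC (g n * t ^ n) * zeta_reg 1 (- sg - RtoC (INR n)))%C N) <= B *
  t ^ N.
Proof.
  destruct (INR_unbounded (Re sg + INR N + 2)) as [K HK].
  destruct (tail_asym N K 1 0 (sg - 1)%C) as [B1 [HB1 K1]]; [lia| |].
  { change (Re (sg - 1)) with (Re sg - 1). lra. }
  destruct (tail_asym N K 1 1 (sg - 1)%C) as [B2 [HB2 K2]]; [lia| |].
  { change (Re (sg - 1)) with (Re sg - 1). lra. }
  destruct (Htay 0 N) as [B0 [HB0 T]]. set (c := RtoC (em_kernel 1 1)).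
  pose proof (Cmod_ge_0 c). pose proof (Cmod_ge_0 sg).
  exists (Cmod c * B0 + Cmod sg * B1 + B2). split. { pose proof (Rmult_le_pos _ _ H0 HB0).
  pose proof (Rmult_le_pos _ _ H1 HB1). lra. }
  intros t I Ht HI.
  destruct (dil_term_series_ex 1 (sg - 1) 0 t Ht) as [m1 Hm1].
  destruct (dil_term_series_ex 1 (sg - 1) 1 t Ht) as [m2 Hm2].
  exists (I + c * RtoC (H 0 t) + (sg * m1 + m2))%C. split.
  - assert (E0 : dil_term sg 0 t 0 = RtoC (H 0%nat t)).
    { unfold dil_term. rewrite !Rplus_0_l, Rmult_1_r, cpow_1_l. ring. }
    rewrite <- E0. apply (sum_EM (dil_term sg 0 t) (fun u => sg * dil_term (sg - 1) 0 t u +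
    dil_term (sg - 1) 1 t u)%C); auto.
    + intros; apply dil_term_der; auto.
    + intros u Hu. apply ccont_plus; [apply ccont_mult; [apply ccont_const|]|];
      apply dil_term_ccont; auto.
    + apply dil_term_lim0; auto.
    + apply dil_term_der_series; auto.
  - rewrite (csum_comb4 _ (fun n => RtoC (INR n ^ 0 * g n * t ^ n)) (fun n => RtoC (INR n ^ 0 * g
    n * t ^ n) * em_rem 1 1 (- (sg - 1) - RtoC (INR n)))%C
       (fun n => RtoC (INR n ^ 1 * g n * t ^ n) * em_rem 1 1 (- (sg - 1) - RtoC (INR n)))%C c sg
       1%C).
    2:{ intros k _. unfold zeta_reg. fold c. rewrite cpow_1_l.
        replace (- sg - RtoC (INR k) + 1)%C with (- (sg - 1) - RtoC (INR k))%C by ring.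
        simpl pow. rewrite Rmult_1_r, Rmult_1_l, !RtoC_mult. ring. }
    specialize (K1 t m1 Ht Hm1). specialize (K2 t m2 Ht Hm2). specialize (T t Ht).
    set (s0 := csum _ N) in T |- *. set (s1 := csum _ N) in K1 |- *.
    set (s2 := csum _ N) in K2 |- *.
    replace (I + c * RtoC (H 0%nat t) + (sg * m1 + m2) - I - (c * s0 + sg * s1 + 1 * s2))%C with
      (c * (RtoC (H 0%nat t) - s0) + sg * (m1 - s1) + (m2 - s2))%C by ring.
    eapply Rle_trans; [apply Cmod_triangle|]. eapply Rle_trans;
    [apply Rplus_le_compat_r, Cmod_triangle|].
    rewrite !Cmod_mult.
    assert (Cmod c * Cmod (RtoC (H 0%nat t) - s0) <= Cmod c * (B0 * t ^ N)) by (apply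
    Rmult_le_compat_l; auto).
    assert (Cmod sg * Cmod (m1 - s1) <= Cmod sg * (B1 * t ^ N)) by (apply Rmult_le_compat_l;
    auto).
    lra.
Qed.
End Asymptotic.

(** * Mellin transforms *)
Notation to_0 := (at_right 0).
Notation at_1 := (at_point 1).
Notation to_oo := (Rbar_locally p_infty).

Lemma interval_filters_01 : interval_filters to_0 at_1 (fun u => 0 < u <= 1).
Proof.
  split; [apply at_right_proper_filter|split; [apply at_point_filter|]].
  apply Filter_prod with (fun a => 0 < a < 1) (fun b => b = 1).
  - exists (mkposreal 1 Rlt_0_1). intros y Hy Hy0. change (Rabs (y - 0) < 1) in Hy.
    apply Rabs_def2 in Hy. lra.
  - reflexivity.
  - intros a b Ha ->; simpl. split; [lra|intros; lra].
Qed.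
Lemma interval_filters_1oo : interval_filters at_1 to_oo (fun u => 1 <= u).
Proof.
  split; [apply at_point_filter|split; [apply Rbar_locally_filter|]].
  apply Filter_prod with (fun a => a = 1) (fun b => 1 < b).
  - reflexivity. - exists 1; auto. - intros a b -> Hb; simpl. split; [lra|intros; lra].
Qed.
Lemma interval_filters_0oo : interval_filters to_0 to_oo (fun u => 0 < u).
Proof.
  split; [apply at_right_proper_filter|split; [apply Rbar_locally_filter|]].
  apply Filter_prod with (fun a => 0 < a < 1) (fun b => 1 < b).
  - exists (mkposreal 1 Rlt_0_1). intros y Hy Hy0. change (Rabs (y - 0) < 1) in Hy.
    apply Rabs_def2 in Hy. lra.
  - exists 1; auto. - intros a b Ha Hb; simpl. split; [lra|intros; lra].
Qed.

Lemma Rpower_m1 u a : 0 < u -> Rpower u (a - 1) = Rpower u a / u.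
Proof. intros. unfold Rminus. rewrite Rpower_plus, Rpower_Ropp, Rpower_1; auto. Qed.

Lemma is_derive_Rpower a u : 0 < u -> is_derive (fun u => Rpower u a) u (a * Rpower u (a - 1)).
Proof.
  intros. rewrite Rpower_m1 by auto. unfold Rpower. auto_derive; auto. field. lra.
Qed.

Lemma cont_Rpower a u : 0 < u -> continuous (fun u => Rpower u a) u.
Proof. intros. apply (ex_derive_continuous (V:=R_NormedModule)).
  eexists; apply is_derive_Rpower; auto. Qed.

Lemma Rpower_small a eps : 0 < a -> 0 < eps -> exists d, 0 < d /\ forall u, 0 < u < d ->
  Rpower u a < eps.
Proof.
  intros Ha He. exists (exp (ln eps / a)). split; [apply exp_pos|]. intros u Hu. unfold Rpower.
  rewrite <- (exp_ln eps) by auto. apply exp_increasing.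
  assert (ln u < ln eps / a) as K by (rewrite <- (ln_exp (ln eps / a)); apply ln_increasing; lra).
  apply Rmult_lt_compat_l with (r := a) in K; auto.
  replace (a * (ln eps / a)) with (ln eps) in K by (field; lra). auto.
Qed.

Lemma at_right0_intro (P : R -> Prop) d : 0 < d -> (forall u, 0 < u < d -> P u) -> to_0 P.
Proof.
  intros Hd H. exists (mkposreal d Hd). intros y Hy Hy0. change (Rabs (y - 0) < d) in Hy.
  apply Rabs_def2 in Hy. apply H. lra.
Qed.

Lemma is_rint_gen_Rpower a : 0 < a -> is_rint_gen to_0 at_1 (fun u => Rpower u (a - 1)) (/ a).
Proof.
  intros Ha. replace (/ a) with (/ a - 0) by ring.
  apply (is_rint_gen_FTC _ _ _ interval_filters_01 (fun u => / a * Rpower u a)).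
  - intros u Hu. eapply rder_eq; [apply (is_derive_scal (fun u => Rpower u a)), is_derive_Rpower;
    lra|]. simpl. field. lra.
  - intros u Hu. apply cont_Rpower; lra.
  - apply filterlim_locally. intros [eps He].
    destruct (Rpower_small a (eps * a)) as [d [Hd K]]; auto. { apply Rmult_lt_0_compat; auto. }
    apply at_right0_intro with d; auto. intros u Hu. specialize (K u Hu).
    change (Rabs (/ a * Rpower u a - 0) < eps).
    assert (0 < Rpower u a) by apply exp_pos. rewrite Rminus_0_r,
    Rabs_pos_eq by (apply Rmult_le_pos; [left; apply Rinv_0_lt_compat; auto|lra]).
    apply Rmult_lt_reg_l with a; auto. rewrite <- Rmult_assoc, Rinv_r by lra. lra.
  - apply filterlim_locally. intros eps. change (Rabs (/ a * Rpower 1 a - / a) < eps).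
    unfold Rpower. rewrite ln_1, Rmult_0_r, exp_0, Rmult_1_r, Rminus_diag, Rabs_R0. apply eps.
Qed.

Lemma is_rint_gen_invsq : is_rint_gen at_1 to_oo (fun u => / u ^ 2) 1.
Proof.
  assert (is_rint_gen at_1 to_oo (fun u => / u ^ 2) (0 - -1)) as K;
  [|replace (0 - -1) with 1 in K by ring; exact K].
  apply (is_rint_gen_FTC _ _ _ interval_filters_1oo (fun u => - / u)).
  - intros u Hu. auto_derive; [lra|]. field. lra.
  - intros u Hu. continuity_by_derive. nra.
  - apply filterlim_locally. intros eps. change (Rabs (- / 1 - -1) < eps).
    replace (- / 1 - -1) with 0 by field. rewrite Rabs_R0. apply eps.
  - apply filterlim_locally. intros [eps He]. exists (/ eps). intros u Hu.
    change (Rabs (- / u - 0) < eps).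
    assert (0 < / eps) by (apply Rinv_0_lt_compat; auto).
    assert (0 < / u) by (apply Rinv_0_lt_compat; lra).
    rewrite Rminus_0_r, Rabs_Ropp, Rabs_pos_eq by lra. rewrite <- (Rinv_inv eps).
    apply Rinv_lt_contravar; auto. apply Rmult_lt_0_compat; lra.
Qed.

Lemma is_rint_gen_scal Fa Fb dom c (g : R -> R) N : interval_filters Fa Fb dom ->
  (forall u, dom u -> continuous g u) -> is_rint_gen Fa Fb g N ->
  is_rint_gen Fa Fb (fun u => c * g u) (c * N).
Proof.
  intros G Cg Hg eps He. destruct G as [P1 [P2 G]].
  assert (0 < eps / (Rabs c + 1)) as He'. { pose proof (Rabs_pos c). apply Rdiv_lt_0_compat; lra.
  }
  pose proof (filter_prod_proper (F := Fa) (G := Fb)).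
  apply filter_imp with (2 := filter_and _ _ G (Hg _ He')). intros [a b] [[Hab Hd] K]; simpl in *.
  rewrite (RInt_scal (V:=R_CompleteNormedModule) g) by (apply rex_RInt; auto).
  change (Rabs (c * RInt g a b - c * N) < eps). rewrite <- Rmult_minus_distr_l, Rabs_mult.
  pose proof (Rabs_pos c). pose proof (Rabs_pos (RInt g a b - N)).
  assert (eps = (Rabs c + 1) * (eps / (Rabs c + 1))) as E by (field; lra). rewrite E. nra.
Qed.

Definition cint_gen Fa Fb (f : R -> C) : C := epsilon (inhabits (RtoC 0)) (is_cint_gen Fa Fb f).

Lemma cint_gen_spec Fa Fb f : (exists l, is_cint_gen Fa Fb f l) ->
  is_cint_gen Fa Fb f (cint_gen Fa Fb f).
Proof. apply epsilon_spec. Qed.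

Definition mellin_kernel (h : R -> R) (s : C) (u : R) : C := (RtoC (h u) * cpow u (s - 1))%C.

Lemma mellin_kernel_ccont h s u : 0 < u -> continuous h u -> ccont (mellin_kernel h s) u.
Proof. intros Hu Hh. apply ccont_mult; [apply ccont_RtoC; auto|apply ccont_cpow; auto]. Qed.

Section MellinAna.
Variables (Fa Fb : (R -> Prop) -> Prop) (dom : R -> Prop) (h g : R -> R) (s0 : C) (r N : R) (F :
  C -> C).
Hypothesis G : interval_filters Fa Fb dom.
Hypothesis dpos : forall u, dom u -> 0 < u.
Hypothesis Ch : forall u, dom u -> continuous h u.
Hypothesis Cg : forall u, dom u -> continuous g u.
Hypothesis Hr : 0 < r.
Hypothesis Hg : forall u, dom u ->
  Rabs (h u) * (Rpower u (Re s0 - 1) * exp (r * Rabs (ln u))) <= g u.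
Hypothesis HN : is_rint_gen Fa Fb g N.
Hypothesis HF : forall s, Cmod (s - s0) < r -> is_cint_gen Fa Fb (mellin_kernel h s) (F s).

(** [transform_power_series] with lam u = - ln u. The measure h(u) du/u is absorbed
    by the functional, which is the improper integral of f times mellin_kernel h 0.
    *)
Lemma mellin_power_series : exists a, has_power_series F s0 a (r/4) /\
  is_cint_gen Fa Fb (fun u => RtoC (ln u) * mellin_kernel h s0 u)%C (a 1%nat).
Proof.
  assert (Chu : forall u, dom u -> ccont (fun u => RtoC (h u / u)) u).
  { intros u Hu. apply ccont_RtoC. pose proof (dpos u Hu).
    apply (rcont_mult h (fun u => / u)); auto.
    continuity_by_derive. lra. }
  assert (Cln : forall u, dom u -> continuous (fun u => - ln u) u).
  { intros u Hu. pose proof (dpos u Hu). continuity_by_derive. lra. }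
  assert (EK : forall s u, dom u -> (RtoC (h u / u) * cexp (- s * RtoC (- ln u)))%C =
  mellin_kernel h s u).
  { intros s u Hu. pose proof (dpos u Hu). unfold mellin_kernel, Cminus.
    rewrite cpow_plus, cpow_opp, cpow_1, cpow_cexp, RtoC_div by lra.
    replace (- s * RtoC (- ln u))%C with (s * RtoC (ln u))%C by (rewrite RtoC_opp; ring).
    unfold Cdiv. ring. }
  destruct (transform_power_series (fun f l => (forall u,
  dom u -> ccont f u) /\ is_cint_gen Fa Fb (fun u => RtoC (h u / u) * f u)%C l) dom (fun u => -
  ln u) s0 r (2 * N)) with (F := F) as [a [Ha [_ Ha1]]].
  - auto.
  - intros f k c l m [Cf Hf] [Ck Hk]. split.
    + intros u Hu. apply ccont_plus; auto. apply ccont_mult; auto. apply ccont_const.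
    + apply is_cint_gen_ext with (dom := dom) (f := fun u => (RtoC (h u / u) * f u + c * (RtoC (h
      u / u) * k u))%C); auto.
      { intros u Hu. ring. }
      apply is_cint_gen_plus with dom; auto.
      * intros; apply ccont_mult; auto.
      * intros u Hu; apply ccont_mult; [apply ccont_const|apply ccont_mult; auto].
      * apply is_cint_gen_scal with dom; auto. intros; apply ccont_mult; auto.
  - intros f l m [_ H1] [_ H2]. eapply is_cint_gen_unique; eauto.
  - intros f k l E [Cf Hf]. split.
    + intros u Hu. apply (ccont_ext_loc f); auto. apply filter_forall; auto.
    + apply is_cint_gen_ext with (dom := dom) (3 := Hf); auto. intros u _. rewrite E; auto.
  - intros f B HB Cf Hf.
    destruct (is_cint_gen_dominated Fa Fb dom G (fun u => RtoC (h u / u) * f u)%C (fun u => B * g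
    u) (B * N)) as [l [Hl Bl]].
    + intros; apply ccont_mult; auto.
    + intros; apply rcont_mult; auto. apply continuous_const.
    + intros u Hu. pose proof (dpos u Hu). rewrite Cmod_mult, Cmod_R. specialize (Hf u Hu).
      specialize (Hg u Hu).
      eapply Rle_trans; [apply Rmult_le_compat_l; [apply Rabs_pos|exact Hf]|].
      replace (Rabs (h u / u) * (B * exp (- Re s0 * - ln u + r * Rabs (- ln u)))) with (B * (Rabs
      (h u) * (Rpower u (Re s0 - 1) * exp (r * Rabs (ln u))))).
      * apply Rmult_le_compat_l; auto.
      * rewrite Rpower_m1, exp_plus, Rabs_Ropp by auto. unfold Rdiv.
        rewrite Rabs_mult, (Rabs_pos_eq (/ u)) by (left; apply Rinv_0_lt_compat; auto).
        unfold Rpower. replace (- Re s0 * - ln u) with (Re s0 * ln u) by ring. ring.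
    + apply is_rint_gen_scal with dom; auto.
    + exists l. split; [split; auto|]. lra.
  - auto.
  - intros s Hs. split.
    + intros u Hu. apply (ccont_cexp (fun u => - s * RtoC (- ln u))%C).
      apply ccont_mult; [apply ccont_const|apply ccont_RtoC; auto].
    + apply is_cint_gen_ext with (dom := dom) (f := mellin_kernel h s); auto. intros u Hu.
      symmetry; auto.
  - exists a. split; auto. apply is_cint_gen_ext with (dom := dom) (3 := Ha1); auto.
    intros u Hu. rewrite <- EK by auto. rewrite RtoC_opp. ring.
Qed.
End MellinAna.

Lemma ln_le_0 u : 0 < u <= 1 -> ln u <= 0.
Proof. intros. rewrite <- ln_1. destruct (Req_dec u 1); [subst; lra|left; apply ln_increasing;
  lra]. Qed.
Lemma ln_ge_0 u : 1 <= u -> 0 <= ln u.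
Proof. intros. rewrite <- ln_1. destruct (Req_dec u 1); [subst; lra|left; apply ln_increasing;
  lra]. Qed.

Definition mellin_01 (h : R -> R) (s : C) : C := cint_gen to_0 at_1 (mellin_kernel h s).
Definition mellin_1oo (h : R -> R) (s : C) : C := cint_gen at_1 to_oo (mellin_kernel h s).

Section MellinZeroOne.
Variables (h : R -> R) (N : nat) (B : R).
Hypothesis Ch : forall u, 0 < u <= 1 -> continuous h u.
Hypothesis Bh : forall u, 0 < u <= 1 -> Rabs (h u) <= B * u ^ N.

Lemma mellin_01_spec s : 0 < Re s + INR N ->
  is_cint_gen to_0 at_1 (mellin_kernel h s) (mellin_01 h s).
Proof.
  intros Hs. apply cint_gen_spec.
  destruct (is_cint_gen_dominated to_0 at_1 _ interval_filters_01 (mellin_kernel h s) (fun u => B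
  * Rpower u (Re s + INR N - 1)) (B * / (Re s + INR N))) as [l [Hl _]].
  - intros u Hu. apply mellin_kernel_ccont; auto. lra.
  - intros u Hu. apply rcont_mult; [apply continuous_const|apply cont_Rpower; lra].
  - intros u Hu. unfold mellin_kernel. rewrite Cmod_mult, Cmod_R, Cmod_cpow.
    change (Re (s - 1)) with (Re s - 1).
    replace (Re s + INR N - 1) with (INR N + (Re s - 1)) by ring.
    rewrite Rpower_plus, Rpower_pow, <- Rmult_assoc by lra.
    apply Rmult_le_compat_r; auto. left; apply exp_pos.
  - apply is_rint_gen_scal with (fun u => 0 < u <= 1);
    [apply interval_filters_01| |apply is_rint_gen_Rpower; auto]. intros; apply cont_Rpower; lra.
  - exists l; auto.
Qed.

Lemma mellin_01_power_series s0 : 0 < Re s0 + INR N ->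
  exists a r, has_power_series (mellin_01 h) s0 a r /\
  is_cint_gen to_0 at_1 (fun u => RtoC (ln u) * mellin_kernel h s0 u)%C (a 1%nat).
Proof.
  intros Hs. set (r := (Re s0 + INR N) / 2).
  destruct (mellin_power_series to_0 at_1 (fun u => 0 < u <= 1) h (fun u => B * Rpower u (r - 1))
  s0 r (B * / r) (mellin_01 h)) as [a [H1 H2]]; auto.
  - apply interval_filters_01. - intros; lra.
  - intros u Hu. apply rcont_mult; [apply continuous_const|apply cont_Rpower; lra].
  - unfold r; lra.
  - intros u Hu. rewrite (Rabs_left1 (ln u)) by (apply ln_le_0; auto).
    replace (exp (r * - ln u)) with (Rpower u (- r)) by (unfold Rpower; f_equal; ring).
    rewrite <- Rpower_plus.
    replace (r - 1) with (INR N + (Re s0 - 1 + - r)) by (unfold r; field).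
    rewrite (Rpower_plus (INR N)), Rpower_pow, <- Rmult_assoc by lra.
    apply Rmult_le_compat_r; auto. left; apply exp_pos.
  - apply is_rint_gen_scal with (fun u => 0 < u <= 1);
    [apply interval_filters_01| |apply is_rint_gen_Rpower; unfold r; lra].
    intros; apply cont_Rpower; lra.
  - intros s Hs'. apply mellin_01_spec. apply Re_close in Hs'. apply Rabs_def2 in Hs'.
    unfold r in *; lra.
  - exists a, (r/4); auto.
Qed.
Lemma mellin_01_analytic s0 : 0 < Re s0 + INR N -> analytic_at (mellin_01 h) s0.
Proof. intros Hs. destruct (mellin_01_power_series s0 Hs) as [a [r [H _]]]. exists a, r; auto.
  Qed.
End MellinZeroOne.

Section MellinOneInfinity.
Variables (h : R -> R).
Hypothesis Ch : forall u, 1 <= u -> continuous h u.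
Hypothesis Bh : forall p, exists B, 0 <= B /\ forall u, 1 <= u -> Rabs (h u) <= B / u ^ p.

Lemma rapid_decay_power c : exists B, 0 <= B /\ forall u, 1 <= u ->
  Rabs (h u) * Rpower u c <= B * / u ^ 2.
Proof.
  destruct (INR_unbounded (c + 2)) as [p Hp]. destruct (Bh p) as [B [HB K]]. exists B.
  split; auto. intros u Hu.
  eapply Rle_trans; [apply Rmult_le_compat_r; [left; apply exp_pos|apply K; auto]|].
  rewrite <- Rpower_m2, <- (Rpower_pow p) by lra. unfold Rdiv.
  rewrite <- Rpower_Ropp, Rmult_assoc, <- Rpower_plus.
  apply Rmult_le_compat_l; auto. apply Rpower_le_base; lra.
Qed.

Lemma cont_invsq u : 1 <= u -> continuous (fun u => / u ^ 2) u.
Proof. intros. continuity_by_derive. nra. Qed.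

Lemma mellin_1oo_spec s : is_cint_gen at_1 to_oo (mellin_kernel h s) (mellin_1oo h s).
Proof.
  apply cint_gen_spec. destruct (rapid_decay_power (Re s - 1)) as [B [HB K]].
  destruct (is_cint_gen_dominated at_1 to_oo _ interval_filters_1oo (mellin_kernel h s) (fun u =>
  B * / u ^ 2) (B * 1)) as [l [Hl _]].
  - intros u Hu. apply mellin_kernel_ccont; auto. lra.
  - intros u Hu. apply rcont_mult; [apply continuous_const|apply cont_invsq; auto].
  - intros u Hu. unfold mellin_kernel. rewrite Cmod_mult, Cmod_R, Cmod_cpow.
    change (Re (s - 1)) with (Re s - 1). auto.
  - apply is_rint_gen_scal with (fun u => 1 <= u);
    [apply interval_filters_1oo|apply cont_invsq|apply is_rint_gen_invsq].
  - exists l; auto.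
Qed.

Lemma mellin_1oo_power_series s0 : exists a r, has_power_series (mellin_1oo h) s0 a r /\
  is_cint_gen at_1 to_oo (fun u => RtoC (ln u) * mellin_kernel h s0 u)%C (a 1%nat).
Proof.
  destruct (rapid_decay_power (Re s0 - 1 + 1)) as [B [HB K]].
  destruct (mellin_power_series at_1 to_oo (fun u => 1 <= u) h (fun u => B * / u ^ 2) s0 1 (B *
  1) (mellin_1oo h)) as [a [H1 H2]]; auto.
  - apply interval_filters_1oo. - intros; lra.
  - intros u Hu. apply rcont_mult; [apply continuous_const|apply cont_invsq; auto].
  - lra.
  - intros u Hu. rewrite (Rabs_pos_eq (ln u)) by (apply ln_ge_0; auto).
    change (exp (1 * ln u)) with (Rpower u 1). rewrite <- Rpower_plus. auto.
  - apply is_rint_gen_scal with (fun u => 1 <= u);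
    [apply interval_filters_1oo|apply cont_invsq|apply is_rint_gen_invsq].
  - intros s _. apply mellin_1oo_spec.
  - exists a, (1/4); auto.
Qed.
Lemma mellin_1oo_analytic s0 : analytic_at (mellin_1oo h) s0.
Proof. destruct (mellin_1oo_power_series s0) as [a [r [H _]]]. exists a, r; auto. Qed.
End MellinOneInfinity.

Lemma is_cint_gen_Chasles Fa Fb d1 d2 f l m : interval_filters Fa at_1 d1 ->
  interval_filters at_1 Fb d2 -> (forall u, d1 u \/ d2 u -> ccont f u) ->
  is_cint_gen Fa at_1 f l -> is_cint_gen at_1 Fb f m -> is_cint_gen Fa Fb f (l + m)%C.
Proof.
  intros G1 G2 Cf Hl Hm eps He.
  pose proof (filter_prod_proper (F := Fa) (G := at_1) (FF := proj1 G1) (FG := proj1 (proj2 G1))).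
  pose proof (filter_prod_proper (F := at_1) (G := Fb) (FF := proj1 G2) (FG := proj1 (proj2 G2))).
  destruct (filter_and _ _ (proj2 (proj2 G1)) (Hl _ (half_pos _ He))) as [P1 Q1 HP1 HQ1 K1].
  destruct (filter_and _ _ (proj2 (proj2 G2)) (Hm _ (half_pos _ He))) as [P2 Q2 HP2 HQ2 K2].
  apply Filter_prod with P1 Q2; auto. intros a b Ha Hb. simpl.
  destruct (K1 a 1 Ha HQ1) as [[h1 h2] h3]. destruct (K2 1 b HP2 Hb) as [[h4 h5] h6]. simpl in *.
  rewrite <- (cint_Chasles f a 1 b); [|lra|].
  - replace (cint f a 1 + cint f 1 b - (l + m))%C with ((cint f a 1 - l) + (cint f 1 b - m))%C by
    ring.
    eapply Rle_lt_trans; [apply Cmod_triangle|]. lra.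
  - intros u Hu. apply Cf. destruct (Rle_dec u 1); [left; apply h2; lra|right; apply h5; lra].
Qed.

(** * The Gamma function *)
Definition exp_neg (u : R) : R := exp (- u).
Definition Gamma_int (z : C) : C := (mellin_01 exp_neg z + mellin_1oo exp_neg z)%C.

Lemma exp_neg_cont u : continuous exp_neg u.
Proof. unfold exp_neg. continuity_by_derive. auto. Qed.

Lemma exp_neg_bound_01 u : 0 < u <= 1 -> Rabs (exp_neg u) <= 1 * u ^ 0.
Proof. intros. unfold exp_neg. rewrite Rabs_pos_eq by (left; apply exp_pos). simpl.
  rewrite Rmult_1_r, <- exp_0. apply exp_le; lra. Qed.

Lemma exp_opp_bound p u : 0 < u -> exp (- u) <= INR (fact p) / u ^ p.
Proof.
  intros. rewrite exp_Ropp. pose proof (pow_fact_exp p u ltac:(lra)). pose proof (exp_pos u).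
  assert (0 < u ^ p) by (apply pow_lt; auto).
  pose proof (INR_fact_lt_0 p). replace (INR (fact p) / u ^ p) with (/ (u ^ p / INR (fact p))) by
  (field; lra).
  apply Rinv_le_contravar; auto. apply Rdiv_lt_0_compat; auto.
Qed.

Lemma exp_neg_decay p : exists B, 0 <= B /\ forall u, 1 <= u -> Rabs (exp_neg u) <= B / u ^ p.
Proof.
  exists (INR (fact p)). split; [apply pos_INR|]. intros u Hu. unfold exp_neg.
  rewrite Rabs_pos_eq by (left; apply exp_pos). apply exp_opp_bound; lra.
Qed.

Lemma Gamma_int_spec z : 0 < Re z ->
  is_cint_gen to_0 to_oo (mellin_kernel exp_neg z) (Gamma_int z).
Proof.
  intros Hz. apply is_cint_gen_Chasles with (d1 := fun u => 0 < u <= 1) (d2 := fun u => 1 <= u);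
  auto using interval_filters_01, interval_filters_1oo.
  - intros u Hu. apply mellin_kernel_ccont; [lra|apply exp_neg_cont].
  - apply (mellin_01_spec exp_neg 0 1); [intros; apply exp_neg_cont|apply exp_neg_bound_01|simpl;
    lra].
  - apply mellin_1oo_spec; [intros; apply exp_neg_cont|apply exp_neg_decay].
Qed.

(** Differentiation under the integral sign: the derivative is the integral with an
    additional factor ln u. *)
Lemma Gamma_int_first_order z : 0 < Re z -> exists l, first_order Gamma_int z (Gamma_int z) l /\
  is_cint_gen to_0 to_oo (fun u => RtoC (ln u) * mellin_kernel exp_neg z u)%C l.
Proof.
  intros Hz.
  assert (Hz' : 0 < Re z + INR 0) by (simpl; lra).
  destruct (mellin_01_power_series exp_neg 0 1 (fun u _ => exp_neg_cont u) exp_neg_bound_01 z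
  Hz') as [a [r [H1 H2]]].
  destruct (mellin_1oo_power_series exp_neg (fun u _ => exp_neg_cont u) exp_neg_decay z) as [b
  [r' [H3 H4]]].
  exists (a 1%nat + b 1%nat)%C. split.
  - pose proof (power_series_first_order _ _ _ _ H1) as O1.
    pose proof (power_series_first_order _ _ _ _ H3) as O3.
    unfold Gamma_int. rewrite (first_order_value _ _ _ _ O1), (first_order_value _ _ _ _ O3).
    apply first_order_plus; auto.
  - apply is_cint_gen_Chasles with (d1 := fun u => 0 < u <= 1) (d2 := fun u => 1 <= u);
    auto using interval_filters_01, interval_filters_1oo.
    intros u Hu. apply ccont_mult; [|apply mellin_kernel_ccont; [lra|apply exp_neg_cont]].
    apply ccont_RtoC.
    continuity_by_derive. lra.
Qed.

Lemma Gamma_int_analytic z : 0 < Re z -> analytic_at Gamma_int z.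
Proof.
  intros Hz. apply analytic_at_plus.
  - apply (mellin_01_analytic exp_neg 0 1); [intros;
    apply exp_neg_cont|apply exp_neg_bound_01|simpl; lra].
  - apply mellin_1oo_analytic; [intros; apply exp_neg_cont|apply exp_neg_decay].
Qed.

Lemma is_cint_gen_RInt_gen Fa Fb dom f l : interval_filters Fa Fb dom ->
  (forall u, dom u -> ccont f u) -> is_cint_gen Fa Fb f l ->
  @RInt_gen C_R_CompleteNormedModule f Fa Fb = l.
Proof.
  intros G Cf Hl. destruct G as [P1 [P2 G]].
  apply (is_RInt_gen_unique (V:=C_R_CompleteNormedModule)).
  intros P [[eps He] HP]. pose proof (filter_prod_proper (F := Fa) (G := Fb)).
  apply filter_imp with (2 := filter_and _ _ G (Hl eps He)).
  intros [a b] [[Hab Hd] K]; simpl in *.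
  exists (cint f a b). split.
  - destruct (cex_RInt f a b Hab ltac:(auto)) as [[p Hp] [q Hq]]. unfold cint.
    rewrite (is_RInt_unique _ _ _ _ Hp), (is_RInt_unique _ _ _ _ Hq).
    apply (is_RInt_fct_extend_pair f); [exact Hp|exact Hq].
  - apply HP. apply (C_NormedModule_mixin_compat1). exact K.
Qed.

Lemma euler_integral_eq z : 0 < Re z -> euler_integral z = Gamma_int z.
Proof.
  intros Hz. unfold euler_integral. apply is_cint_gen_RInt_gen with (dom := fun u => 0 < u).
  - apply interval_filters_0oo.
  - intros u Hu. apply ccont_mult; [apply ccont_cpow; auto|apply ccont_RtoC, exp_neg_cont].
  - apply is_cint_gen_ext with (dom := fun u => 0 < u) (3 := Gamma_int_spec z Hz);
    [apply interval_filters_0oo|].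
    intros u Hu. unfold mellin_kernel, exp_neg. ring.
Qed.

Lemma Gamma_int_scaled a z : 0 < a -> 0 < Re z ->
  is_cint_gen to_0 to_oo (mellin_kernel (fun u => exp (- (a * u))) z)
  (cpow a (- z) * Gamma_int z)%C.
Proof.
  intros Ha Hz.
  assert (K : is_cint_gen to_0 to_oo (fun y => RtoC a * mellin_kernel exp_neg z (a * y + 0)%R)%C
  (Gamma_int z)).
  { intros eps He. destruct (filter_and _ _ (proj2 (proj2 interval_filters_0oo)) (Gamma_int_spec
    z Hz eps He)) as [P Q HP HQ H].
    apply Filter_prod with (fun u => P (a * u) /\ 0 < u) (fun u => Q (a * u)).
    - destruct HP as [[d Hd] HP]. apply at_right0_intro with (d / a); [apply Rdiv_lt_0_compat;
      auto|].
      intros u Hu. split; [|lra]. assert (0 < a * u) by (apply Rmult_lt_0_compat; lra).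
      apply HP; auto. change (Rabs (a * u - 0) < d).
      rewrite Rminus_0_r, Rabs_pos_eq by lra. destruct Hu as [_ Hu].
      apply Rmult_lt_compat_l with (r := a) in Hu; auto.
      replace (a * (d / a)) with d in Hu by (field; lra). auto.
    - destruct HQ as [M HQ]. exists (M / a). intros u Hu. apply HQ.
      apply Rmult_lt_compat_l with (r := a) in Hu; auto.
      replace (a * (M / a)) with M in Hu by (field; lra). auto.
    - intros x y [Hx Hx0] Hy. destruct (H _ _ Hx Hy) as [[h1 h2] h3]; simpl in *.
      rewrite cint_comp_lin; auto.
      + rewrite !Rplus_0_r. auto.
      + apply Rmult_le_reg_l with a; auto.
      + intros v Hv. rewrite Rplus_0_r. apply mellin_kernel_ccont; [apply Rmult_lt_0_compat;
        lra|apply exp_neg_cont]. }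
  apply (is_cint_gen_scal _ _ _ interval_filters_0oo (cpow a (- z))) in K.
  - apply is_cint_gen_ext with (dom := fun u => 0 < u) (3 := K); [apply interval_filters_0oo|].
    intros u Hu. cbv beta. unfold mellin_kernel, exp_neg.
    rewrite Rplus_0_r, cpow_mult_base by auto.
    replace (RtoC a) with (cpow a 1) by (apply cpow_1; auto).
    replace (cpow a (- z) * (cpow a 1 * (RtoC (exp (- (a * u))) * (cpow a (z - 1) * cpow u (z -
    1)))))%C
      with ((cpow a (- z) * cpow a 1 * cpow a (z - 1)) * (RtoC (exp (- (a * u))) * cpow u (z -
      1)))%C by ring.
    rewrite <- !cpow_plus. replace (- z + 1 + (z - 1))%C with (RtoC 0) by ring. rewrite cpow_0.
    ring.
  - intros u Hu. apply ccont_mult; [apply ccont_const|].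
    apply (ccont_comp (mellin_kernel exp_neg z) (fun y => a * y + 0)).
    + continuity_by_derive. auto.
    + rewrite Rplus_0_r. apply mellin_kernel_ccont; [apply Rmult_lt_0_compat;
      lra|apply exp_neg_cont].
Qed.

(** Integration by parts, in the form that e^(-u) u^z is a primitive of z e^(-u)
    u^(z-1) - e^(-u) u^z and vanishes at both ends. *)
Lemma Gamma_int_rec z : 0 < Re z -> Gamma_int (z + 1) = (z * Gamma_int z)%C.
Proof.
  intros Hz. set (Fn := fun u => (cpow u z * RtoC (exp (- u)))%C).
  assert (Cm : forall w u, 0 < u -> ccont (mellin_kernel exp_neg w) u) by (intros;
  apply mellin_kernel_ccont; auto; apply exp_neg_cont).
  assert (K1 : is_cint_gen to_0 to_oo (fun u => z * mellin_kernel exp_neg z u + - (1) *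
  mellin_kernel exp_neg (z + 1) u)%C (z * Gamma_int z + - (1) * Gamma_int (z + 1))%C).
  { apply is_cint_gen_plus with (fun u => 0 < u); [apply interval_filters_0oo| | | |].
    - intros; apply ccont_mult; [apply ccont_const|auto].
    - intros; apply ccont_mult; [apply ccont_const|auto].
    - apply is_cint_gen_scal with (fun u => 0 < u);
      auto using interval_filters_0oo, Gamma_int_spec.
    - apply is_cint_gen_scal with (fun u => 0 < u); auto using interval_filters_0oo.
      apply Gamma_int_spec. change (0 < Re z + 1). lra. }
  assert (M : forall u, 0 < u -> Cmod (Fn u - 0) = Rpower u (Re z) * exp (- u)).
  { intros u Hu. unfold Fn. replace (cpow u z * RtoC (exp (- u)) - 0)%C with (cpow u z * RtoC
    (exp (- u)))%C by ring.
    rewrite Cmod_mult, Cmod_cpow, Cmod_R, Rabs_pos_eq by (left; apply exp_pos). auto. }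
  assert (K2 : is_cint_gen to_0 to_oo (fun u => z * mellin_kernel exp_neg z u + - (1) *
  mellin_kernel exp_neg (z + 1) u)%C (0 - 0)%C).
  { apply (is_cint_gen_FTC _ _ _ interval_filters_0oo Fn).
    - intros u Hu. eapply cder_eq; [apply cder_mult; [apply cder_cpow;
      auto|apply (cder_RtoC (fun u => exp (- u)) u (- exp (- u)))]|].
      + auto_derive; auto. ring.
      + unfold mellin_kernel, exp_neg. replace (z + 1 - 1)%C with z by ring. rewrite RtoC_opp.
        ring.
    - intros u Hu. apply ccont_plus; apply ccont_mult; auto; apply ccont_const.
    - intros eps He. destruct (Rpower_small (Re z) eps Hz He) as [d [Hd K]].
      apply at_right0_intro with d; auto.
      intros u Hu. rewrite M by lra. specialize (K u Hu).
      assert (0 < Rpower u (Re z)) by apply exp_pos.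
      assert (exp (- u) <= 1) by (rewrite <- exp_0; apply exp_le; lra).
      pose proof (exp_pos (- u)). nra.
    - intros eps He. destruct (INR_unbounded (Re z + 1)) as [p Hp]. pose proof (INR_fact_lt_0 p).
      exists (Rmax 1 (INR (fact p) / eps)). intros u Hu.
      assert (1 < u) by (eapply Rle_lt_trans; [apply Rmax_l|exact Hu]).
      assert (INR (fact p) / eps < u) by (eapply Rle_lt_trans; [apply Rmax_r|exact Hu]).
      rewrite M by lra. eapply Rle_lt_trans; [apply Rmult_le_compat_l; [left;
      apply exp_pos|apply (exp_opp_bound p); lra]|].
      rewrite <- (Rpower_pow p u) by lra. unfold Rdiv. rewrite <- Rpower_Ropp.
      replace (Rpower u (Re z) * (INR (fact p) * Rpower u (- INR p))) with (INR (fact p) *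
      (Rpower u (Re z) * Rpower u (- INR p))) by ring.
      rewrite <- Rpower_plus. apply Rle_lt_trans with (INR (fact p) * / u).
      + apply Rmult_le_compat_l; [lra|]. rewrite <- (Rpower_1 u) at 2 by lra.
        rewrite <- Rpower_Ropp. apply Rpower_le_base; lra.
      + apply Rmult_lt_reg_r with u; [lra|]. rewrite Rmult_assoc, Rinv_l, Rmult_1_r by lra.
        apply Rmult_lt_compat_l with (r := eps) in H1; auto.
        replace (eps * (INR (fact p) / eps)) with (INR (fact p)) in H1 by (field; lra). auto. }
  pose proof (is_cint_gen_unique _ _ _ interval_filters_0oo _ _ _ K1 K2) as E.
  replace (Gamma_int (z + 1)) with (z * Gamma_int z - (z * Gamma_int z + - (1) * Gamma_int (z +
  1)))%C by ring. rewrite E. ring.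
Qed.

(** For Re z > 0 the shift in the definition of Gamma is 0. *)
Lemma Gamma_eq_int z : 0 < Re z -> Gamma z = Gamma_int z.
Proof.
  intros Hz. unfold Gamma. assert (Z.to_nat (up (- Re z)) = 0%nat) as ->.
  { destruct (archimed (- Re z)) as [_ H]. assert (IZR (up (- Re z)) < 1) by lra.
    apply lt_IZR in H0. lia. }
  simpl pochhammer. simpl INR. replace (z + 0)%C with z by ring.
  rewrite euler_integral_eq by auto. field.
Qed.

Lemma pochhammer_neq0 z n : (forall k, (k < n)%nat -> z <> RtoC (- INR k)) -> pochhammer z n <> 0.
Proof.
  induction n; intros H; simpl.
  - intro E. apply RtoC_inj in E. lra.
  - apply Cmult_neq_0; auto. intro E. apply (H n); auto. rewrite RtoC_opp.
    replace z with (z + RtoC (INR n) - RtoC (INR n))%C by ring. rewrite E. ring.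
Qed.

Lemma Gamma_int_pochhammer z m n : 0 < Re z + INR m -> (m <= n)%nat ->
  (Gamma_int (z + RtoC (INR m)) * pochhammer z n)%C =
  (Gamma_int (z + RtoC (INR n)) * pochhammer z m)%C.
Proof.
  intros Hz Hmn. induction Hmn; auto. apply le_INR in Hmn as Hle.
  rewrite S_INR, RtoC_plus. replace (z + (RtoC (INR m0) + 1))%C with (z + RtoC (INR m0) + 1)%C by
  ring.
  rewrite Gamma_int_rec. 2:{ change (0 < Re z + INR m0). lra. }
  simpl pochhammer. rewrite Cmult_assoc, IHHmn. ring.
Qed.

Lemma Gamma_pochhammer z n : (forall k : nat, z <> RtoC (- INR k)) -> 0 < Re z + INR n ->
  (Gamma z * pochhammer z n)%C = Gamma_int (z + RtoC (INR n)).
Proof.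
  intros Hz Hn. unfold Gamma. set (m := Z.to_nat (up (- Re z))).
  pose proof (lt_to_nat_up (- Re z)) as Hm. fold m in Hm.
  assert (pochhammer z m <> 0) by (apply pochhammer_neq0; auto).
  assert (pochhammer z n <> 0) by (apply pochhammer_neq0; auto).
  rewrite euler_integral_eq. 2:{ change (0 < Re z + INR m). lra. }
  destruct (Nat.le_ge_cases m n) as [h|h].
  - pose proof (Gamma_int_pochhammer z m n ltac:(lra) h) as E. unfold Cdiv.
    replace (Gamma_int (z + RtoC (INR m)) * / pochhammer z m * pochhammer z n)%C with (Gamma_int
    (z + RtoC (INR m)) * pochhammer z n * / pochhammer z m)%C by ring.
    rewrite E. field. auto.
  - pose proof (Gamma_int_pochhammer z n m ltac:(lra) h) as E. unfold Cdiv.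
    replace (Gamma_int (z + RtoC (INR m)) * / pochhammer z m * pochhammer z n)%C with (Gamma_int
    (z + RtoC (INR m)) * pochhammer z n * / pochhammer z m)%C by ring.
    rewrite <- E. field. auto.
Qed.

Lemma is_cint_gen_Re_le Fa Fb dom f k l m : interval_filters Fa Fb dom ->
  (forall u, dom u -> ccont f u) -> (forall u, dom u -> ccont k u) ->
  (forall u, dom u -> Re (f u) <= Re (k u)) -> is_cint_gen Fa Fb f l -> is_cint_gen Fa Fb k m ->
  Re l <= Re m.
Proof.
  intros G Cf Ck H Hl Hm. apply le_epsilon. intros eps He.
  destruct G as [P1 [P2 G]]. pose proof (filter_prod_proper (F := Fa) (G := Fb)).
  destruct (filter_ex _ (filter_and _ _ G (filter_and _ _ (Hl _ (half_pos _ He)) (Hm _ (half_pos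
  _ He))))) as [[a b] [[h1 h2] [h3 h4]]]; simpl in *.
  apply (Re_close _ _ _) in h3. apply (Re_close _ _ _) in h4. apply Rabs_def2 in h3.
  apply Rabs_def2 in h4.
  assert (Re (cint f a b) <= Re (cint k a b)).
  { unfold cint, Re; simpl. destruct (cex_RInt f a b h1 ltac:(auto)).
    destruct (cex_RInt k a b h1 ltac:(auto)).
    apply RInt_le; auto. intros u Hu. apply H, h2; lra. }
  lra.
Qed.

Lemma is_cint_gen_real Fa Fb dom f l : interval_filters Fa Fb dom ->
  (forall u, dom u -> Im (f u) = 0) -> is_cint_gen Fa Fb f l -> Im l = 0.
Proof.
  intros G H Hl. destruct G as [P1 [P2 G]]. pose proof (filter_prod_proper (F := Fa) (G := Fb)).
  assert (E : forall eps, 0 < eps -> Cmod (RtoC (Im l)) < eps).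
  { intros eps He. rewrite Cmod_R. destruct (filter_ex _ (filter_and _ _ G (Hl _ He))) as [[a b]
    [[h1 h2] h3]]; simpl in *.
    eapply Rle_lt_trans; [|exact h3]. eapply Rle_trans; [|apply im_le_Cmod].
    change (Im (cint f a b - l)) with (Im (cint f a b) - Im l).
    assert (Im (cint f a b) = 0) as ->.
    { unfold cint, Im at 1; simpl. rewrite (RInt_ext _ (fun _ => 0)).
      - rewrite RInt_const. unfold scal; simpl; unfold mult; simpl; ring.
      - rewrite Rmin_left, Rmax_right by auto. intros u Hu. apply H, h2. lra. }
    rewrite Rminus_0_l, Rabs_Ropp. lra. }
  apply Cmod_eq0_eps in E. apply RtoC_inj in E. auto.
Qed.

Lemma RtoC_Re l : Im l = 0 -> l = RtoC (Re l).
Proof. destruct l as [p q]. unfold Re, Im; simpl. intros ->. reflexivity. Qed.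

Lemma mellin_kernel_real h (x : R) u : 0 < u -> mellin_kernel h (RtoC x) u =
  RtoC (h u * Rpower u (x - 1)).
Proof. intros. unfold mellin_kernel. rewrite <- RtoC_minus, cpow_R, RtoC_mult. reflexivity. Qed.

Lemma Gamma_int_real_pos x : 0 < x -> exists r, 0 < r /\ Gamma_int (RtoC x) = RtoC r.
Proof.
  intros Hx. exists (Re (Gamma_int (RtoC x))).
  assert (E : Gamma_int (RtoC x) = RtoC (Re (Gamma_int (RtoC x)))).
  { apply RtoC_Re. apply (is_cint_gen_real to_0 to_oo (fun u => 0 < u) (mellin_kernel exp_neg
    (RtoC x))); [apply interval_filters_0oo| |apply Gamma_int_spec; auto].
    intros u Hu. rewrite mellin_kernel_real by auto. reflexivity. }
  split; auto.
  assert (H1 : 0 <= Re (mellin_01 exp_neg (RtoC x))).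
  { apply (is_cint_gen_Re_le to_0 at_1 (fun u => 0 < u <= 1) (fun _ => RtoC 0) (mellin_kernel
    exp_neg (RtoC x)) 0).
    - apply interval_filters_01. - intros; apply ccont_const.
      - intros u Hu; apply mellin_kernel_ccont; [lra|apply exp_neg_cont].
    - intros u Hu. rewrite mellin_kernel_real by lra. simpl.
      apply Rmult_le_pos; left; apply exp_pos.
    - apply is_cint_gen_zero with (fun u => 0 < u <= 1), interval_filters_01.
    - apply (mellin_01_spec exp_neg 0 1); [intros;
      apply exp_neg_cont|apply exp_neg_bound_01|simpl; lra]. }
  assert (H2 : exp (-2) / 2 <= Re (mellin_1oo exp_neg (RtoC x))).
  { replace (exp (-2) / 2) with (Re (RtoC 0 - RtoC (- exp (-2) / 2))%C) by (simpl; field).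
    apply (is_cint_gen_Re_le at_1 to_oo (fun u => 1 <= u) (fun u => RtoC (exp (- 2 * u)))
    (mellin_kernel exp_neg (RtoC x))).
    - apply interval_filters_1oo.
    - intros u Hu. apply ccont_RtoC. continuity_by_derive. auto.
    - intros u Hu; apply mellin_kernel_ccont; [lra|apply exp_neg_cont].
    - intros u Hu. rewrite mellin_kernel_real by lra. simpl. unfold exp_neg, Rpower.
      rewrite <- exp_plus. apply exp_le.
      assert (ln u <= u - 1). { pose proof (exp_ineq1_le (ln u)) as Q.
      rewrite exp_ln in Q by lra. lra. }
      pose proof (ln_ge_0 u Hu). nra.
    - apply (is_cint_gen_FTC _ _ _ interval_filters_1oo (fun u => RtoC (- exp (- 2 * u) / 2))).
      + intros u Hu. apply cder_RtoC. auto_derive; auto. field.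
      + intros u Hu. apply ccont_RtoC. continuity_by_derive. auto.
      + intros eps He. unfold at_point. replace (- 2 * 1) with (-2) by ring.
        replace (RtoC (- exp (-2) / 2) - RtoC (- exp (-2) / 2))%C with (RtoC 0) by ring.
        rewrite Cmod_0; auto.
      + intros eps He. exists (Rmax 1 (/ eps)). intros u Hu.
        assert (1 < u) by (eapply Rle_lt_trans; [apply Rmax_l|exact Hu]).
        assert (/ eps < u) by (eapply Rle_lt_trans; [apply Rmax_r|exact Hu]).
        replace (RtoC (- exp (-2 * u) / 2) - 0)%C with (RtoC (- exp (-2 * u) / 2)) by ring.
        rewrite Cmod_R.
        pose proof (exp_pos (-2 * u)). rewrite Rabs_left by lra.
        assert (exp (- (2 * u)) <= 1 / (2 * u) ^ 1) as Q by (apply (exp_opp_bound 1); lra).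
        replace (- (2 * u)) with (-2 * u) in Q by ring.
        assert (1 / (2 * u) ^ 1 = / u / 2) as Q2 by (field; lra).
        assert (/ u < eps). { rewrite <- (Rinv_inv eps). apply Rinv_lt_contravar; auto.
        apply Rmult_lt_0_compat; [apply Rinv_0_lt_compat; auto|lra]. }
        assert (0 < / u) by (apply Rinv_0_lt_compat; lra). lra.
    - apply mellin_1oo_spec; [intros; apply exp_neg_cont|apply exp_neg_decay]. }
  unfold Gamma_int. change (0 < Re (mellin_01 exp_neg (RtoC x)) + Re (mellin_1oo exp_neg (RtoC
  x))). pose proof (exp_pos (-2)). lra.
Qed.

(** * The digamma function *)
Definition Gamma_int' (z : C) : C := C_derive Gamma_int z.

Lemma Gamma_int'_spec z : 0 < Re z -> first_order Gamma_int z (Gamma_int z) (Gamma_int' z) /\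
  is_cint_gen to_0 to_oo (fun u => RtoC (ln u) * mellin_kernel exp_neg z u)%C (Gamma_int' z).
Proof. intros Hz. destruct (Gamma_int_first_order z Hz) as [l [H1 H2]]. unfold Gamma_int'.
  rewrite (first_order_deriv _ _ _ _ H1). auto. Qed.

Lemma Gamma_int'_real x : 0 < x -> exists r, Gamma_int' (RtoC x) = RtoC r.
Proof.
  intros Hx. exists (Re (Gamma_int' (RtoC x))). apply RtoC_Re.
  apply (is_cint_gen_real to_0 to_oo (fun u => 0 < u) (fun u => RtoC (ln u) * mellin_kernel
  exp_neg (RtoC x) u)%C); [apply interval_filters_0oo| |apply Gamma_int'_spec; auto].
  intros u Hu. rewrite mellin_kernel_real, <- RtoC_mult by auto. reflexivity.
Qed.

Lemma Gamma_int'_rec x : 0 < x -> Gamma_int' (RtoC (x + 1)) =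
  (Gamma_int (RtoC x) + RtoC x * Gamma_int' (RtoC x))%C.
Proof.
  intros Hx. destruct (Gamma_int'_spec (RtoC (x + 1))) as [H1 _]; [simpl; lra|].
  destruct (Gamma_int'_spec (RtoC x)) as [H0 _]; auto.
  rewrite RtoC_plus in H1 |- *. apply first_order_shift in H1.
  apply (first_order_loc _ (fun z => z * Gamma_int z)%C _ _ _ x) in H1; auto.
  - destruct (first_order_unique _ _ _ _ _ _ H1 (first_order_mult _ _ _ _ _ _ _ (first_order_id
    (RtoC x)) H0)) as [_ E]. rewrite E. ring.
  - intros z Hz. apply Gamma_int_rec. apply Re_close in Hz. simpl in Hz. apply Rabs_def2 in Hz.
    lra.
Qed.

Lemma mellin_kernel_exp_neg_ccont z u : 0 < u -> ccont (mellin_kernel exp_neg z) u.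
Proof. intros; apply mellin_kernel_ccont; auto; apply exp_neg_cont. Qed.

Lemma ln_ccont u : 0 < u -> ccont (fun u => RtoC (ln u)) u.
Proof. intros. apply ccont_RtoC. continuity_by_derive. lra. Qed.

Lemma ln_tangent y u : 0 < y -> 0 < u -> ln u <= ln y + (u - y) / y.
Proof.
  intros Hy Hu. pose proof (exp_ineq1_le (ln (u / y))) as Q.
  rewrite exp_ln in Q by (apply Rdiv_lt_0_compat; auto).
  rewrite ln_div in Q by auto. replace ((u - y) / y) with (u / y - 1) by (field; lra). lra.
Qed.

(** Against the density u^(x-1) e^(-u), whose mean is x, ln u is at most its
    tangent line at x. This is Jensen's inequality. *)
Lemma Gamma_int'_upper x : 0 < x -> Re (Gamma_int' (RtoC x)) <= ln x * Re (Gamma_int (RtoC x)).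
Proof.
  intros Hx. destruct (Gamma_int'_spec (RtoC x) Hx) as [_ H1].
  pose proof (Gamma_int_spec (RtoC x) Hx) as H2.
  assert (H3 : is_cint_gen to_0 to_oo (mellin_kernel exp_neg (RtoC x + 1)) (Gamma_int (RtoC x +
  1))) by (apply Gamma_int_spec; simpl; lra).
  apply (is_cint_gen_scal _ _ _ interval_filters_0oo (RtoC (ln x - 1))) in H2; [|intros;
  apply mellin_kernel_exp_neg_ccont; auto].
  apply (is_cint_gen_scal _ _ _ interval_filters_0oo (RtoC (/ x))) in H3; [|intros;
  apply mellin_kernel_exp_neg_ccont; auto].
  assert (H4 := is_cint_gen_plus _ _ _ interval_filters_0oo _ _ _ _ (fun u Hu => ccont_mult _ _ _
  (ccont_const _ u) (mellin_kernel_exp_neg_ccont _ u Hu)) (fun u Hu => ccont_mult _ _ _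
  (ccont_const _ u) (mellin_kernel_exp_neg_ccont _ u Hu)) H2 H3).
  replace (ln x * Re (Gamma_int (RtoC x))) with (Re (RtoC (ln x - 1) * Gamma_int (RtoC x) + RtoC
  (/ x) * Gamma_int (RtoC x + 1))%C).
  - apply (is_cint_gen_Re_le to_0 to_oo (fun u => 0 < u) _ _ _ _ interval_filters_0oo) with (4 :=
    H1) (5 := H4).
    + intros u Hu. apply ccont_mult; [apply ln_ccont|apply mellin_kernel_exp_neg_ccont]; auto.
    + intros u Hu. apply ccont_plus; apply ccont_mult; try apply ccont_const;
      apply mellin_kernel_exp_neg_ccont; auto.
    + intros u Hu. rewrite <- RtoC_plus, !mellin_kernel_real, <- !RtoC_mult,
      <- RtoC_plus by auto. simpl.
      replace (x + 1 - 1) with ((x - 1) + 1) by ring. rewrite Rpower_plus, Rpower_1 by auto.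
      pose proof (ln_tangent x u Hx Hu) as T. assert (0 < exp_neg u * Rpower u (x - 1)) by (apply
      Rmult_lt_0_compat; apply exp_pos).
      replace ((ln x - 1) * (exp_neg u * Rpower u (x - 1)) + / x * (exp_neg u * (Rpower u (x - 1)
      * u))) with ((ln x + (u - x) / x) * (exp_neg u * Rpower u (x - 1))) by (field; lra).
      apply Rmult_le_compat_r; lra.
  - rewrite Gamma_int_rec by auto. destruct (Gamma_int_real_pos x Hx) as [r [_ ->]].
    rewrite <- !RtoC_mult, <- RtoC_plus. simpl. field. lra.
Qed.

(** The same inequality for the density u^(y-1) e^(-u) and the convex function u ln
    u, which lies above its tangent line at the mean y. *)
Lemma Gamma_int'_lower y : 0 < y ->
  ln y * Re (Gamma_int (RtoC (y + 1))) <= Re (Gamma_int' (RtoC (y + 1))).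
Proof.
  intros Hy. assert (Hx : 0 < Re (RtoC (y + 1))) by (simpl; lra).
  destruct (Gamma_int'_spec (RtoC (y + 1)) Hx) as [_ H1].
  pose proof (Gamma_int_spec (RtoC (y + 1)) Hx) as H2.
  assert (H3 : is_cint_gen to_0 to_oo (mellin_kernel exp_neg (RtoC y)) (Gamma_int (RtoC y))) by
  (apply Gamma_int_spec; auto).
  apply (is_cint_gen_scal _ _ _ interval_filters_0oo (RtoC (ln y + 1))) in H2; [|intros;
  apply mellin_kernel_exp_neg_ccont; auto].
  apply (is_cint_gen_scal _ _ _ interval_filters_0oo (RtoC (- y))) in H3; [|intros;
  apply mellin_kernel_exp_neg_ccont; auto].
  assert (H4 := is_cint_gen_plus _ _ _ interval_filters_0oo _ _ _ _ (fun u Hu => ccont_mult _ _ _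
  (ccont_const _ u) (mellin_kernel_exp_neg_ccont _ u Hu)) (fun u Hu => ccont_mult _ _ _
  (ccont_const _ u) (mellin_kernel_exp_neg_ccont _ u Hu)) H2 H3).
  replace (ln y * Re (Gamma_int (RtoC (y + 1)))) with (Re (RtoC (ln y + 1) * Gamma_int (RtoC (y +
  1)) + RtoC (- y) * Gamma_int (RtoC y))%C).
  - apply (is_cint_gen_Re_le to_0 to_oo (fun u => 0 < u) _ _ _ _ interval_filters_0oo) with (4 :=
    H4) (5 := H1).
    + intros u Hu. apply ccont_plus; apply ccont_mult; try apply ccont_const;
      apply mellin_kernel_exp_neg_ccont; auto.
    + intros u Hu. apply ccont_mult; [apply ln_ccont|apply mellin_kernel_exp_neg_ccont]; auto.
    + intros u Hu. rewrite !mellin_kernel_real, <- !RtoC_mult, <- RtoC_plus by auto. simpl.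
      replace (y + 1 - 1) with ((y - 1) + 1) by ring. rewrite Rpower_plus, Rpower_1 by auto.
      pose proof (ln_tangent u y Hu Hy) as T. assert (0 < exp_neg u * Rpower u (y - 1)) by (apply
      Rmult_lt_0_compat; apply exp_pos).
      replace ((ln y + 1) * (exp_neg u * (Rpower u (y - 1) * u)) + - y * (exp_neg u * Rpower u (y
      - 1))) with ((ln y - (y - u) / u) * u * (exp_neg u * Rpower u (y - 1))) by (field; lra).
      replace (ln u * (exp_neg u * (Rpower u (y - 1) * u))) with (ln u * u * (exp_neg u * Rpower
      u (y - 1))) by ring.
      apply Rmult_le_compat_r; [lra|]. apply Rmult_le_compat_r; lra.
  - rewrite (RtoC_plus y 1), Gamma_int_rec by auto.
    destruct (Gamma_int_real_pos y Hy) as [r [_ ->]]. rewrite <- !RtoC_mult, <- RtoC_plus. simpl.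
    ring.
Qed.

Definition digamma_int (x : R) : C := (Gamma_int' (RtoC x) / Gamma_int (RtoC x))%C.

Lemma Gamma_int_neq0 x : 0 < x -> Gamma_int (RtoC x) <> 0.
Proof. intros Hx. destruct (Gamma_int_real_pos x Hx) as [r [Hr ->]]. intro E.
  apply RtoC_inj in E. lra. Qed.

Lemma RtoC_neq0 x : x <> 0 -> RtoC x <> 0.
Proof. intros H E. apply RtoC_inj in E. auto. Qed.

Lemma digamma_int_rec x : 0 < x -> digamma_int (x + 1) = (digamma_int x + RtoC (/ x))%C.
Proof.
  intros Hx. unfold digamma_int. rewrite Gamma_int'_rec by auto.
  rewrite (RtoC_plus x 1), Gamma_int_rec by auto. rewrite RtoC_inv by lra.
  field. split; [apply RtoC_neq0; lra|apply Gamma_int_neq0; auto].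
Qed.

Lemma digamma_int_ln y : 0 < y -> Cmod (digamma_int (y + 1) - RtoC (ln (y + 1))) <= / y.
Proof.
  intros Hy. destruct (Gamma_int_real_pos (y + 1)) as [r [Hr E]]; [lra|].
  destruct (Gamma_int'_real (y + 1)) as [d D]; [lra|].
  pose proof (Gamma_int'_upper (y + 1) ltac:(lra)) as U. pose proof (Gamma_int'_lower y Hy) as L.
  rewrite E, D in U, L. simpl in U, L.
  unfold digamma_int. rewrite E, D, <- RtoC_div, <- RtoC_minus, Cmod_R by lra.
  assert (ln (y + 1) <= ln y + / y). { pose proof (ln_tangent y (y + 1) Hy ltac:(lra)) as T.
  replace ((y + 1 - y) / y) with (/ y) in T by (field; lra). auto. }
  assert (d / r <= ln (y + 1)) by (apply Rmult_le_reg_r with r; auto; unfold Rdiv;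
  rewrite Rmult_assoc, Rinv_l; lra).
  assert (ln y <= d / r) by (apply Rmult_le_reg_r with r; auto; unfold Rdiv;
  rewrite Rmult_assoc, Rinv_l; lra).
  apply Rabs_le. lra.
Qed.

(** Minus the constant term of zeta(s,x) at s = 1. *)
Definition digamma_em (x : R) : C := (RtoC (ln x) - zeta_reg x 1)%C.

Lemma em_rem_2_series x : 0 < x -> em_series 1 (fun u => RtoC (/ (u + x) ^ 2)) (em_rem x 1 2).
Proof.
  intros Hx. apply em_series_ext with (2 := em_rem_series x 1 2 Hx (le_n 1) ltac:(simpl; lra)).
  intros u Hu. rewrite cpow_opp. replace (RtoC 2) with (RtoC (INR 2)) by (simpl; f_equal; ring).
  rewrite cpow_INR, RtoC_inv by (try apply Rgt_not_eq, pow_lt; lra). reflexivity.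
Qed.

(** The first kernel integral over [0,1] drops out of the series when x increases
    to x + 1, and an integration by parts evaluates it. *)
Lemma digamma_em_rec x : 0 < x -> digamma_em (x + 1) = (digamma_em x + RtoC (/ x))%C.
Proof.
  intros Hx. pose proof (em_rem_2_series x Hx) as H1.
  pose proof (em_rem_2_series (x + 1) ltac:(lra)) as H2.
  apply (is_cseries_shift _ _ 1) in H1. simpl csum in H1. set (p0 := em_int 1 _) in H1.
  assert (E : (em_rem x 1 2 - (0 + p0))%C = em_rem (x + 1) 1 2).
  { eapply Clim_unique; [exact H1|]. apply is_cseries_ext with (2 := H2). intro k.
    apply em_int_ext. intros v Hv.
    cbv beta. change (1 + k)%nat with (S k). rewrite S_INR. do 3 f_equal. ring. }
  assert (P : em_int 0 (fun v => RtoC (/ (v + x))) = (RtoC (em_kernel 1 1) * RtoC (/ (1 + x)) -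
  RtoC (em_kernel 1 0) * RtoC (/ (0 + x)) - em_int 1 (fun v => RtoC (- / (v + x) ^ 2)))%C).
  { apply (em_int_step 0 (fun v => RtoC (/ (v + x)))).
    - intros v Hv. apply cder_RtoC. auto_derive; [lra|]. field. lra.
    - intros v Hv. apply ccont_RtoC. continuity_by_derive. nra. }
  assert (P1 : em_int 1 (fun v => RtoC (- / (v + x) ^ 2)) = (- p0)%C).
  { transitivity (- (1) * p0)%C; [|ring]. unfold p0. symmetry.
    etransitivity; [symmetry; apply (em_int_scal 1 (- (1))%C (fun v => RtoC (/ (INR 0 + v + x) ^
    2)))|].
    - intros v Hv. apply ccont_RtoC. simpl INR. continuity_by_derive. nra.
    - apply em_int_ext. intros v Hv. cbv beta. replace (INR 0 + v) with v by (simpl; ring).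
      rewrite RtoC_opp. ring. }
  assert (P2 : em_int 0 (fun v => RtoC (/ (v + x))) = (RtoC (ln (1 + x)) - RtoC (ln (0 + x)))%C).
  { rewrite <- (cint_FTC (fun v => RtoC (ln (v + x))) (fun v => RtoC (/ (v + x)))); try lra.
    - apply cint_ext; [lra|]. intros; simpl em_kernel. ring.
    - intros v Hv. apply cder_RtoC. auto_derive; [lra|]. field. lra.
    - intros v Hv. apply ccont_RtoC. continuity_by_derive. lra. }
  rewrite P1, P2, Rplus_0_l, (Rplus_comm 1 x) in P.
  unfold digamma_em, zeta_reg. rewrite !cpow_opp, !cpow_1 by lra.
  replace (1 + 1)%C with (RtoC 2) by (rewrite <- RtoC_plus; f_equal; ring).
  rewrite <- E. rewrite !RtoC_inv in * by lra.
  replace (RtoC (ln (x + 1))) with (RtoC (ln (x + 1)) - RtoC (ln x) + RtoC (ln x))%C by ring.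
  rewrite P, em_kernel_jump, RtoC_plus. ring.
Qed.

Lemma digamma_em_ln : exists B, 0 <= B /\ forall x, 1 <= x ->
  Cmod (digamma_em x - RtoC (ln x)) <= B / x.
Proof.
  destruct (em_series_dominated 1) as [B [HB D]]. pose proof (Rabs_pos (em_kernel 1 1)).
  exists (Rabs (em_kernel 1 1) + 2 * B). split; [lra|]. intros x Hx. assert (0 < x) as Hx0 by lra.
  destruct (series_inv_sq x Hx0) as [S1 S2].
  destruct (D (fun u => RtoC (/ (u + x) ^ 2)) (fun k => / (INR k + x) ^ 2)) as [l [Hl Bl]]; auto.
  - intros u Hu. apply ccont_RtoC. continuity_by_derive. nra.
  - intros k v Hv. pose proof (pos_INR k). rewrite Cmod_R, Rabs_pos_eq by (left;
    apply Rinv_0_lt_compat, pow_lt; lra). apply inv_sq_le; auto.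
  - rewrite (em_series_unique _ _ _ _ Hl (em_rem_2_series x Hx0)) in Bl.
    unfold digamma_em, zeta_reg. rewrite cpow_opp, cpow_1 by lra.
    replace (1 + 1)%C with (RtoC 2) by (rewrite <- RtoC_plus; f_equal; ring).
    replace (RtoC (ln x) - (RtoC (em_kernel 1 1) * / RtoC x - 1 * em_rem x 1 2) - RtoC (ln x))%C
    with (em_rem x 1 2 + - (RtoC (em_kernel 1 1) * / RtoC x))%C by ring.
    eapply Rle_trans; [apply Cmod_triangle|]. rewrite Cmod_opp, Cmod_mult, Cmod_inv,
    !Cmod_R by (apply RtoC_neq0; lra).
    rewrite (Rabs_pos_eq x) by lra.
    assert (/ x ^ 2 <= / x) by (apply Rinv_le_contravar; simpl; nra).
    assert (B * Series (fun k => / (INR k + x) ^ 2) <= B * (2 * / x)) by (apply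
    Rmult_le_compat_l; lra).
    unfold Rdiv. lra.
Qed.

Lemma Rinv_INR_small B eps : 0 < eps -> 0 <= B -> exists n : nat, forall y, INR n < y ->
  B / y < eps.
Proof.
  intros He HB. destruct (INR_unbounded (B / eps)) as [n Hn]. exists n. intros y Hy.
  assert (0 <= B / eps) by (apply Rmult_le_pos; auto; left; apply Rinv_0_lt_compat; auto).
  apply Rmult_lt_reg_r with y; [lra|]. unfold Rdiv. rewrite Rmult_assoc, Rinv_l, Rmult_1_r by lra.
  assert (B / eps < y) as K by lra. apply Rmult_lt_compat_l with (r := eps) in K; auto.
  replace (eps * (B / eps)) with B in K by (field; lra). auto.
Qed.

(** The difference of the two functions has period 1 in x and tends to 0 at
    infinity. *)
Lemma digamma_int_em x : 0 < x -> digamma_int x = digamma_em x.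
Proof.
  intros Hx.
  assert (P : forall n, (digamma_int (x + INR n) - digamma_em (x + INR n))%C = (digamma_int x -
  digamma_em x)%C).
  { induction n. - simpl. rewrite Rplus_0_r. auto.
    - rewrite S_INR. pose proof (pos_INR n). replace (x + (INR n + 1)) with (x + INR n + 1) by
      ring. rewrite digamma_int_rec, digamma_em_rec by lra. rewrite <- IHn. ring. }
  assert (E : (digamma_int x - digamma_em x = 0)%C).
  { apply Cmod_eq0_eps. intros eps He. destruct digamma_em_ln as [B [HB K]].
    destruct (Rinv_INR_small (B + 1) eps He) as [n Hn]; [lra|].
    rewrite <- (P (S (S n))). set (y := x + INR (S n)).
    assert (Hy : INR n < y /\ 0 < y). { unfold y. rewrite S_INR. pose proof (pos_INR n). lra. }
    replace (x + INR (S (S n))) with (y + 1) by (unfold y; rewrite !S_INR; ring).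
    replace (digamma_int (y + 1) - digamma_em (y + 1))%C with ((digamma_int (y + 1) - RtoC (ln (y
    + 1))) + - (digamma_em (y + 1) - RtoC (ln (y + 1))))%C by ring.
    eapply Rle_lt_trans; [apply Cmod_triangle|]. rewrite Cmod_opp.
    pose proof (digamma_int_ln y ltac:(lra)). specialize (K (y + 1) ltac:(lra)).
    specialize (Hn y ltac:(lra)).
    assert (B / (y + 1) <= B / y). { apply Rmult_le_compat_l; auto. apply Rinv_le_contravar; lra.
    }
    unfold Rdiv in *. lra. }
  apply Ceq_minus. exact E.
Qed.

Lemma Gamma_first_order x : 0 < x ->
  first_order Gamma (RtoC x) (Gamma_int (RtoC x)) (Gamma_int' (RtoC x)).
Proof.
  intros Hx. apply (first_order_loc Gamma_int _ _ _ _ x); auto.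
  - intros z Hz. symmetry. apply Gamma_eq_int. apply Re_close in Hz. simpl in Hz.
    apply Rabs_def2 in Hz. lra.
  - apply Gamma_int'_spec; auto.
Qed.

Lemma digamma_zeta_reg x : 0 < x -> digamma (RtoC x) = (RtoC (ln x) - zeta_reg x 1)%C.
Proof.
  intros Hx. unfold digamma. rewrite (first_order_deriv _ _ _ _ (Gamma_first_order x Hx)),
  Gamma_eq_int by auto. apply (digamma_int_em x Hx).
Qed.

(** * The integral term *)
Lemma csum_real (a : nat -> R) n : Im (csum (fun k => RtoC (a k)) n) = 0.
Proof. induction n; simpl; auto. change (Im (csum (fun k => RtoC (a k)) n) + 0 = 0). lra. Qed.

Section Mellin.
Variables (G : R -> R) (g : nat -> R).
Hypothesis CG : forall u, 0 < u -> continuous G u.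
Hypothesis TG : forall N, exists B, 0 <= B /\ forall u, 0 < u ->
  Cmod (RtoC (G u) - csum (fun n => RtoC (g n * u ^ n)) N)%C <= B * u ^ N.
Hypothesis DG : forall p, exists B, 0 <= B /\ forall u, 0 < u -> Rabs (G u) <= B / u ^ p.

(** Real-valued, hence the real part; [taylor_rem_RtoC] is the equation that is
    meant. *)
Definition taylor_rem (N : nat) (u : R) : R := Re (RtoC (G u) - csum (fun n => RtoC (g n * u ^
  n)) N)%C.

Lemma taylor_rem_RtoC N u : RtoC (taylor_rem N u) =
  (RtoC (G u) - csum (fun n => RtoC (g n * u ^ n)) N)%C.
Proof.
  symmetry. apply RtoC_Re. pose proof (csum_real (fun n => g n * u ^ n) N) as E.
  change (0 - Im (csum (fun n => RtoC (g n * u ^ n)) N) = 0). lra.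
Qed.

Lemma taylor_poly_ccont N u : ccont (fun u => csum (fun n => RtoC (g n * u ^ n)) N) u.
Proof.
  apply (ccont_csum (fun n u => RtoC (g n * u ^ n))). intro k. apply ccont_RtoC.
  continuity_by_derive. auto.
Qed.

Lemma taylor_rem_cont N u : 0 < u -> continuous (taylor_rem N) u.
Proof.
  intros Hu. assert (ccont (fun u => RtoC (G u) - csum (fun n => RtoC (g n * u ^ n)) N)%C u) as
  [K _]; [|exact K].
  apply ccont_minus; [apply ccont_RtoC; auto|apply taylor_poly_ccont].
Qed.

Lemma taylor_rem_bound N : exists B, 0 <= B /\ forall u, 0 < u ->
  Rabs (taylor_rem N u) <= B * u ^ N.
Proof.
  destruct (TG N) as [B [HB K]]. exists B. split; auto. intros u Hu.
  rewrite <- Cmod_R, taylor_rem_RtoC. auto.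
Qed.

(** The Mellin transform of G without its first N polar terms g n / (s + n), see
    [mellin_full]; it is analytic for Re s > - N. *)
Definition mellin_reg (N : nat) (s : C) : C := (mellin_1oo G s + mellin_01 (taylor_rem N) s)%C.

Lemma G_cont_1oo u : 1 <= u -> continuous G u. Proof. intros; apply CG; lra. Qed.
Lemma G_decay_1oo p : exists B, 0 <= B /\ forall u, 1 <= u -> Rabs (G u) <= B / u ^ p.
Proof. destruct (DG p) as [B [HB K]]. exists B. split; auto. intros; apply K; lra. Qed.

Lemma mellin_reg_analytic N s : 0 < Re s + INR N -> analytic_at (mellin_reg N) s.
Proof.
  intros Hs. destruct (taylor_rem_bound N) as [B [_ K]]. apply analytic_at_plus.
  - apply mellin_1oo_analytic; auto using G_cont_1oo, G_decay_1oo.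
  - apply (mellin_01_analytic (taylor_rem N) N B); auto. intros; apply taylor_rem_cont; lra.
    intros; apply K; lra.
Qed.

Lemma mellin_01_taylor_rem N s : 0 < Re s + INR N ->
  is_cint_gen to_0 at_1 (mellin_kernel (taylor_rem N) s) (mellin_01 (taylor_rem N) s).
Proof.
  intros Hs. destruct (taylor_rem_bound N) as [B [_ K]].
  apply (mellin_01_spec (taylor_rem N) N B); auto. intros; apply taylor_rem_cont; lra.
  intros; apply K; lra.
Qed.

Lemma RInt_Rpower B al a t : 0 < al -> 0 < a <= t -> RInt (fun u => B * Rpower u (al - 1)) a t =
  B / al * Rpower t al - B / al * Rpower a al.
Proof.
  intros Hal Ha. apply is_RInt_unique. apply (is_RInt_derive (V:=R_CompleteNormedModule) (fun u
  => B / al * Rpower u al));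
    rewrite Rmin_left, Rmax_right by lra; intros u Hu.
  - eapply rder_eq; [apply (is_derive_scal (fun u => Rpower u al)), is_derive_Rpower; lra|].
    simpl. field. lra.
  - apply rcont_mult; [apply continuous_const|apply cont_Rpower; lra].
Qed.

Lemma mellin_kernel_taylor_rem_small N s : 0 < Re s + INR N -> exists B, 0 <= B /\
  forall t, 0 < t <= 1 -> Cmod
  (cint (mellin_kernel (taylor_rem N) s) t 1 - mellin_01 (taylor_rem N) s) <= B * Rpower t
  (Re s + INR N).
Proof.
  intros Hs. destruct (taylor_rem_bound N) as [B [HB K]]. set (al := Re s + INR N) in *.
  assert (HBa : 0 <= B / al) by (apply Rmult_le_pos; auto; left; apply Rinv_0_lt_compat; auto).
  exists (2 * (B / al)). split; [lra|]. intros t Ht. apply le_epsilon. intros eps He.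
  destruct (mellin_01_taylor_rem N s Hs eps He) as [P Q [[d Hd] HP] HQ H].
  set (a := Rmin t (d / 2)). assert (0 < a) by (apply Rmin_glb_lt; lra).
  assert (a <= t) by apply Rmin_l. assert (a <= d / 2) by apply Rmin_r.
  specialize (H a 1). simpl in H. assert (Cmod (cint (mellin_kernel (taylor_rem N) s) a 1 -
  mellin_01 (taylor_rem N) s) < eps) as K1.
  { apply H; auto. apply HP; auto. change (Rabs (a - 0) < d). rewrite Rabs_pos_eq; lra. }
  assert (CR : forall u, 0 < u -> ccont (mellin_kernel (taylor_rem N) s) u) by (intros;
  apply mellin_kernel_ccont; auto; apply taylor_rem_cont; auto).
  rewrite <- (cint_Chasles _ a t 1) in K1 by (try lra; intros; apply CR; lra).
  assert (Cmod (cint (mellin_kernel (taylor_rem N) s) a t) <= 2 * (B / al) * Rpower t al) as K2.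
  { eapply Rle_trans; [apply (cint_norm _ (fun u => B * Rpower u (al - 1))); auto|].
    - intros; apply CR; lra.
    - intros u Hu. apply rcont_mult; [apply continuous_const|apply cont_Rpower; lra].
    - intros u Hu. unfold mellin_kernel. rewrite Cmod_mult, Cmod_R, Cmod_cpow.
      change (Re (s - 1)) with (Re s - 1).
      replace (al - 1) with (INR N + (Re s - 1)) by (unfold al; ring).
      rewrite Rpower_plus, Rpower_pow, <- Rmult_assoc by lra.
      apply Rmult_le_compat_r; [left; apply exp_pos|]. apply K; lra.
    - rewrite RInt_Rpower by (auto; lra). assert (0 <= B / al * Rpower a al) by (apply
      Rmult_le_pos; auto; left; apply exp_pos). lra. }
  replace (cint (mellin_kernel (taylor_rem N) s) t 1 - mellin_01 (taylor_rem N) s)%C with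
    ((cint (mellin_kernel (taylor_rem N) s) a t + cint (mellin_kernel (taylor_rem N) s) t 1 -
    mellin_01 (taylor_rem N) s) + - cint (mellin_kernel (taylor_rem N) s) a t)%C by ring.
  eapply Rle_trans; [apply Cmod_triangle|]. rewrite Cmod_opp. lra.
Qed.

Definition power_int (s : C) (n : nat) (t : R) : C := cint (fun v => cpow v (s - 1 + RtoC (INR
  n))) t 1.

Lemma mellin_kernel_split N s t : 0 < t <= 1 -> cint (mellin_kernel G s) t 1 =
  (cint (mellin_kernel (taylor_rem N) s) t 1 + csum (fun n => RtoC (g n) * power_int s n t)%C
  N)%C.
Proof.
  intros Ht.
  assert (CP : forall n u, t <= u <= 1 -> ccont (fun v => cpow v (s - 1 + RtoC (INR n))) u) by
  (intros; apply ccont_cpow; lra).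
  assert (E : forall M, csum (fun n => RtoC (g n) * power_int s n t)%C M = cint (fun v => csum
  (fun n => RtoC (g n) * cpow v (s - 1 + RtoC (INR n)))%C M) t 1
     /\ forall u, t <= u <= 1 -> ccont (fun v => csum (fun n => RtoC (g n) * cpow v (s - 1 + RtoC
     (INR n)))%C M) u).
  { induction M as [|M [IH1 IH2]]; simpl.
    - split; [|intros; apply ccont_const]. rewrite (cint_FTC (fun _ => RtoC 0)); [ring|lra| |];
      intros; [apply cder_const|apply ccont_const].
    - assert (C1 : forall u, t <= u <= 1 -> ccont (fun v => RtoC (g M) * cpow v (s - 1 + RtoC
      (INR M)))%C u) by (intros; apply ccont_mult; [apply ccont_const|auto]).
      split; [|intros; apply ccont_plus; auto]. rewrite cint_plus by (auto; lra). rewrite IH1.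
      f_equal. unfold power_int. rewrite cint_scal by (auto; lra). auto. }
  destruct (E N) as [E1 E2]. rewrite E1, <- cint_plus; auto; [|lra|].
  - apply cint_ext; [lra|]. intros u Hu. unfold mellin_kernel. rewrite taylor_rem_RtoC.
    assert (csum (fun n => RtoC (g n) * cpow u (s - 1 + RtoC (INR n)))%C N = cpow u (s - 1) *
    csum (fun n => RtoC (g n * u ^ n)) N)%C as ->.
    { rewrite <- csum_scal. apply csum_ext. intros k _.
      rewrite cpow_plus, cpow_INR, RtoC_mult by lra. ring. }
    ring.
  - intros u Hu. apply mellin_kernel_ccont; [lra|apply taylor_rem_cont; lra].
Qed.

Lemma is_cint_gen_seq f l (b : nat -> R) : is_cint_gen at_1 to_oo f l ->
  (forall M, exists n0, forall n, (n0 <= n)%nat -> M < b n) -> Clim (fun n => cint f 1 (b n)) l.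
Proof.
  intros H Hb eps He. destruct (H eps He) as [P Q HP [M HQ] K]. destruct (Hb M) as [n0 Hn0].
  exists n0. intros n Hn.
  apply (K 1 (b n)); auto.
Qed.

(** Substituting v = t (u + 1) gives t^(-s) times the integral of G against v^(s-1)
    over (t,oo). On (t,1) the Taylor terms are integrated exactly, and extending
    the remainder from (t,1) to (0,1) costs O(t^(s+N)). *)
Lemma int_asym N s : 0 < Re s + INR N -> exists B, 0 <= B /\ forall t, 0 < t <= 1 ->
  exists I, Clim (fun k => cint (fun u => cpow (u + 1) (s - 1) * RtoC (G (t * (u + 1))))%C 0
  (INR k)) I /\ Cmod (I - cpow t (- s) *
  (mellin_reg N s + csum (fun n => RtoC (g n) * power_int s n t)%C N)) <= B * t ^ N.
Proof.
  intros Hs. destruct (mellin_kernel_taylor_rem_small N s Hs) as [B [HB K]]. exists B.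
  split; auto. intros t Ht.
  assert (CGk : forall u, 0 < u -> ccont (mellin_kernel G s) u) by (intros;
  apply mellin_kernel_ccont; auto).
  exists (cpow t (- s) * (cint (mellin_kernel G s) t 1 + mellin_1oo G s))%C. split.
  - assert (E : forall k, (cpow t (- s) * (cint (mellin_kernel G s) t 1 + cint (mellin_kernel G
    s) 1 (t * INR (k + Z.to_nat (up (/ t))) + t)))%C
        = cint (fun u => cpow (u + 1) (s - 1) * RtoC (G (t * (u + 1))))%C 0 (INR (k + Z.to_nat
        (up (/ t))))).
    { intro k. set (K0 := INR (k + Z.to_nat (up (/ t)))).
      assert (1 <= t * K0 + t).
      { pose proof (lt_to_nat_up (/ t)). assert (/ t < K0). { unfold K0. rewrite plus_INR.
        pose proof (pos_INR k). lra. }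
        apply Rmult_lt_compat_l with (r := t) in H0; [|lra]. rewrite Rinv_r in H0; lra. }
      assert (0 <= K0) by apply pos_INR.
      rewrite cint_Chasles by (try lra; intros; apply CGk; lra).
      pose proof (cint_comp_lin (mellin_kernel G s) t t 0 K0 ltac:(lra) H0 ltac:(intros;
      apply CGk; nra)) as E0.
      rewrite Rmult_0_r, Rplus_0_l in E0. rewrite <- E0, <- cint_scal; auto.
      - apply cint_ext; auto. intros u Hu. unfold mellin_kernel.
        replace (t * u + t) with (t * (u + 1)) by ring.
        rewrite cpow_mult_base by lra. rewrite <- (cpow_1 t) by lra.
        replace (cpow t (- s) * (cpow t 1 * (RtoC (G (t * (u + 1))) * (cpow t (s - 1) * cpow (u +
        1) (s - 1)))))%C with
          ((cpow t (- s) * cpow t 1 * cpow t (s - 1)) * (RtoC (G (t * (u + 1))) * cpow (u + 1) (s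
          - 1)))%C by ring.
        rewrite <- !cpow_plus. replace (- s + 1 + (s - 1))%C with (RtoC 0) by ring.
        rewrite cpow_0. ring.
      - intros u Hu. apply ccont_mult; [apply ccont_const|].
        apply (ccont_comp (mellin_kernel G s) (fun u => t * u + t)).
        + continuity_by_derive. auto.
        + apply CGk. nra. }
    assert (L : Clim (fun k => cint (fun u => cpow (u + 1) (s - 1) * RtoC (G (t * (u + 1))))%C 0
    (INR (k + Z.to_nat (up (/ t))))) (cpow t (- s) * (cint (mellin_kernel G s) t 1 + mellin_1oo G
    s))%C).
    { eapply Clim_ext; [exact E|]. apply Clim_scal, Clim_plus; [apply Clim_const|].
      apply (is_cint_gen_seq (mellin_kernel G s) (mellin_1oo G s) (fun k => t * INR (k + Z.to_nat
      (up (/ t))) + t)).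
      - apply mellin_1oo_spec; auto using G_cont_1oo, G_decay_1oo.
      - intro M. destruct (INR_unbounded (M / t)) as [n0 Hn0]. exists n0. intros n Hn.
        assert (INR n0 <= INR (n + Z.to_nat (up (/ t)))) by (apply le_INR; lia).
        assert (M / t < INR (n + Z.to_nat (up (/ t)))) as Q by lra.
        apply Rmult_lt_compat_l with (r := t) in Q; [|lra].
        replace (t * (M / t)) with M in Q by (field; lra). lra. }
    intros eps He. destruct (L eps He) as [n0 Hn0]. exists (n0 + Z.to_nat (up (/ t)))%nat.
    intros n Hn.
    specialize (Hn0 (n - Z.to_nat (up (/ t)))%nat ltac:(lia)).
    replace (n - Z.to_nat (up (/ t)) + Z.to_nat (up (/ t)))%nat with n in Hn0 by lia. exact Hn0.
  - rewrite (mellin_kernel_split N s t Ht). unfold mellin_reg. set (cs := csum _ N).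
    replace (cpow t (- s) * (cint (mellin_kernel (taylor_rem N) s) t 1 + cs + mellin_1oo G s) -
    cpow t (- s) * (mellin_1oo G s + mellin_01 (taylor_rem N) s + cs))%C
      with (cpow t (- s) * (cint (mellin_kernel (taylor_rem N) s) t 1 - mellin_01 (taylor_rem N)
      s))%C by ring.
    rewrite Cmod_mult, Cmod_cpow. change (Re (- s)) with (- Re s).
    eapply Rle_trans; [apply Rmult_le_compat_l; [left; apply exp_pos|apply (K t Ht)]|].
    rewrite <- (Rpower_pow N t) by lra. assert (Rpower t (INR N) = Rpower t (- Re s) * Rpower t
    (Re s + INR N)) as -> by (rewrite <- Rpower_plus; f_equal; ring). right. ring.
Qed.

Lemma power_int_generic s n t : 0 < t <= 1 -> (s + RtoC (INR n))%C <> 0 ->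
  power_int s n t = ((1 - cpow t (s + RtoC (INR n))) / (s + RtoC (INR n)))%C.
Proof.
  intros Ht Hs. unfold power_int. rewrite (cint_FTC (fun v => / (s + RtoC (INR n)) * cpow v (s +
  RtoC (INR n)))%C); try lra.
  - rewrite cpow_1_l. field. auto.
  - intros u Hu. eapply cder_eq; [apply cder_scal, cder_cpow; lra|].
    replace (s + RtoC (INR n) - 1)%C with (s - 1 + RtoC (INR n))%C by ring. field. auto.
  - intros u Hu. apply ccont_cpow; lra.
Qed.

Lemma power_int_log n t : 0 < t <= 1 -> power_int (- RtoC (INR n)) n t = RtoC (- ln t).
Proof.
  intros Ht. unfold power_int. rewrite (cint_FTC (fun v => RtoC (ln v))); try lra.
  - rewrite ln_1, <- RtoC_minus. f_equal. ring.
  - intros u Hu. replace (- RtoC (INR n) - 1 + RtoC (INR n))%C with (- (1))%C by ring.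
    rewrite cpow_opp, cpow_1, <- RtoC_inv by lra.
    apply cder_RtoC. auto_derive; [lra|]. field. lra.
  - intros u Hu. apply ccont_cpow; lra.
Qed.

Lemma is_cint_gen_power s : 0 < Re s -> is_cint_gen to_0 at_1 (fun u => cpow u (s - 1)) (/ s)%C.
Proof.
  intros Hs. assert (s <> 0) by (intro E; rewrite E in Hs; simpl in Hs; lra).
  replace (/ s)%C with (/ s - 0)%C by ring. apply (is_cint_gen_FTC _ _ _ interval_filters_01 (fun
  u => / s * cpow u s)%C).
  - intros u Hu. eapply cder_eq; [apply cder_scal, cder_cpow; lra|]. field. auto.
  - intros u Hu. apply ccont_cpow; lra.
  - intros eps He. assert (0 < Cmod s) by (apply Cmod_gt_0; auto).
    destruct (Rpower_small (Re s) (eps * Cmod s) Hs) as [d [Hd K]]; [apply Rmult_lt_0_compat;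
    auto|]. apply at_right0_intro with d; auto.
    intros u Hu. specialize (K u Hu). replace (/ s * cpow u s - 0)%C with (/ s * cpow u s)%C by
    ring. rewrite Cmod_mult, Cmod_inv, Cmod_cpow by auto.
    apply Rmult_lt_reg_l with (Cmod s); auto. rewrite <- Rmult_assoc, Rinv_r by lra. lra.
  - intros eps He. unfold at_point. rewrite cpow_1_l.
    replace (/ s * 1 - / s)%C with (RtoC 0) by ring. rewrite Cmod_0; auto.
Qed.

Lemma mellin_full N s : 0 < Re s ->
  is_cint_gen to_0 to_oo (mellin_kernel G s)
  (mellin_reg N s + csum (fun n => RtoC (g n) / (s + RtoC (INR n)))%C N)%C.
Proof.
  intros Hs. pose proof (pos_INR N).
  replace (mellin_reg N s + csum (fun n => RtoC (g n) / (s + RtoC (INR n)))%C N)%C with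
  ((mellin_01 (taylor_rem N) s + csum (fun n => RtoC (g n) / (s + RtoC (INR n)))%C N) +
  mellin_1oo G s)%C by (unfold mellin_reg; ring).
  apply is_cint_gen_Chasles with (d1 := fun u => 0 < u <= 1) (d2 := fun u => 1 <= u);
  auto using interval_filters_01, interval_filters_1oo.
  - intros u Hu. apply mellin_kernel_ccont; [lra|apply CG; lra].
  - assert (E : forall M, is_cint_gen to_0 at_1 (fun v => csum (fun n => RtoC (g n) * cpow v (s +
    RtoC (INR n) - 1))%C M) (csum (fun n => RtoC (g n) / (s + RtoC (INR n)))%C M)
     /\ forall u, 0 < u <= 1 -> ccont (fun v => csum (fun n => RtoC (g n) * cpow v (s + RtoC (INR
     n) - 1))%C M) u).
    { induction M as [|M [IH1 IH2]].
      - simpl. split; [|intros; apply ccont_const].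
        apply is_cint_gen_zero with (fun u => 0 < u <= 1), interval_filters_01.
      - assert (C1 : forall u, 0 < u <= 1 -> ccont (fun v => cpow v (s + RtoC (INR M) - 1)) u) by
        (intros; apply ccont_cpow; lra).
        assert (C2 : forall u, 0 < u <= 1 -> ccont (fun v => RtoC (g M) * cpow v (s + RtoC (INR
        M) - 1))%C u) by (intros; apply ccont_mult; [apply ccont_const|auto]).
        cbn [csum]. split; [|intros; apply ccont_plus; auto].
        apply is_cint_gen_plus with (fun u => 0 < u <= 1); auto using interval_filters_01.
        unfold Cdiv. apply is_cint_gen_scal with (fun u => 0 < u <= 1);
        auto using interval_filters_01.
        apply is_cint_gen_power. change (0 < Re s + INR M). pose proof (pos_INR M). lra. }
    destruct (E N) as [E1 E2].
    apply is_cint_gen_ext with (dom := fun u => 0 < u <= 1) (f := (fun u => mellin_kernel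
    (taylor_rem N) s u + csum (fun n => RtoC (g n) * cpow u (s + RtoC (INR n) - 1)) N)%C);
    [apply interval_filters_01| |].
    + intros u Hu. unfold mellin_kernel. rewrite taylor_rem_RtoC.
      assert (csum (fun n => RtoC (g n) * cpow u (s + RtoC (INR n) - 1))%C N = cpow u (s - 1) *
      csum (fun n => RtoC (g n * u ^ n)) N)%C as ->.
      { rewrite <- csum_scal. apply csum_ext. intros k _.
        replace (s + RtoC (INR k) - 1)%C with (s - 1 + RtoC (INR k))%C by ring.
        rewrite cpow_plus, cpow_INR, RtoC_mult by lra. ring. }
      ring.
    + apply is_cint_gen_plus with (fun u => 0 < u <= 1); auto using interval_filters_01.
      * intros u Hu. apply mellin_kernel_ccont; [lra|apply taylor_rem_cont; lra].
      * apply mellin_01_taylor_rem. lra.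
  - apply mellin_1oo_spec; auto using G_cont_1oo, G_decay_1oo.
Qed.
End Mellin.

(** * Bernoulli polynomials *)
Lemma CV_radius_gt (a : nat -> R) r :
  (forall t, 0 < t < r -> ex_series (fun n => a n * t ^ n)) -> forall t, Rabs t < r ->
  Rbar_lt (Rabs t) (CV_radius a).
Proof.
  intros H t Ht. set (v := (Rabs t + r) / 2). pose proof (Rabs_pos t).
  destruct (Rbar_lt_le_dec (CV_radius a) v) as [h|h].
  - exfalso. apply (CV_disk_outside a v).
    + rewrite Rabs_pos_eq by (unfold v; lra). auto.
    + apply ex_series_lim_0, H. unfold v; lra.
  - eapply Rbar_lt_le_trans; [|exact h]. simpl. unfold v; lra.
Qed.

(** The coefficients of t/(e^t - 1), as the reciprocal of sum t^n/(n+1)!. A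
    coefficient depends on all earlier ones, so the recursion builds the list of
    them, the latest first. *)
Fixpoint recip_list (n : nat) : list R :=
  match n with
  | O => (1 :: nil)%list
  | S m => ((- sum_f_R0 (fun i => List.nth i (recip_list m) 0 / INR (fact (i + 2))) m) ::
  recip_list m)%list
  end.
Definition recip_coef (n : nat) : R := List.nth 0 (recip_list n) 0.

Lemma recip_list_nth m : forall i, (i <= m)%nat -> List.nth i (recip_list m) 0 =
  recip_coef (m - i).
Proof.
  induction m; intros i Hi.
  - replace i with 0%nat by lia. reflexivity.
  - destruct i; [reflexivity|]. simpl. apply IHm. lia.
Qed.

Lemma recip_coef_S m : recip_coef (S m) =
  - sum_f_R0 (fun i => recip_coef (m - i) / INR (fact (i + 2))) m.
Proof.
  unfold recip_coef at 1. simpl. f_equal. apply sum_eq. intros i Hi. rewrite recip_list_nth; auto.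
Qed.

Lemma fact_pow2 i : 2 ^ (i + 1) <= INR (fact (i + 2)).
Proof.
  induction i. - simpl. lra.
  - replace (S i + 2)%nat with (S (i + 2)) by lia. rewrite fact_simpl, mult_INR. simpl pow.
    assert (2 <= INR (S (i + 2))) by (replace 2 with (INR 2) by (simpl; ring); apply le_INR; lia).
    assert (0 < 2 ^ (i + 1)) by (apply pow_lt; lra). apply Rmult_le_compat; lra.
Qed.

(** The recursion expresses a coefficient through earlier ones with weights
    1/(i+2)! <= 2^(-i-1), whose sum is at most 1. So the series converges for |t| <
    1. *)
Lemma recip_coef_bound n : Rabs (recip_coef n) <= 1.
Proof.
  induction n as [n IH] using lt_wf_ind. destruct n.
  - unfold recip_coef; simpl. rewrite Rabs_R1. lra.
  - rewrite recip_coef_S, Rabs_Ropp. eapply Rle_trans; [apply Rsum_abs|].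
    apply Rle_trans with (sum_f_R0 (fun i => (1/2) * (1/2) ^ i) n).
    + apply sum_Rle. intros i Hi. unfold Rdiv at 1. rewrite Rabs_mult.
      assert (Rabs (/ INR (fact (i + 2))) <= 1/2 * (1/2) ^ i).
      { rewrite Rabs_pos_eq by (left; apply Rinv_0_lt_compat, INR_fact_lt_0).
        replace (1/2 * (1/2)^i) with (/ 2 ^ (i + 1)).
        - apply Rinv_le_contravar; [apply pow_lt; lra|apply fact_pow2].
        - rewrite Nat.add_1_r. change (1/2 * (1/2)^i) with ((1/2) ^ (S i)). unfold Rdiv.
          rewrite Rmult_1_l, pow_inv. auto. }
      specialize (IH (n - i)%nat ltac:(lia)). pose proof (Rabs_pos (recip_coef (n - i))).
      pose proof (Rabs_pos (/ INR (fact (i + 2)))).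
      replace (1/2 * (1/2) ^ i) with (1 * (1/2 * (1/2) ^ i)) by ring. apply Rmult_le_compat; auto.
    + assert (forall n, sum_f_R0 (fun i => (1/2) * (1/2) ^ i) n = 1 - (1/2) ^ (S n)) as ->.
      { clear. induction n; simpl; [field|]. rewrite IHn. simpl. field. }
      assert (0 < (1/2) ^ S n) by (apply pow_lt; lra). lra.
Qed.

Definition expm1_coef (n : nat) : R := / INR (fact (S n)).

Lemma delta_series : is_series (fun n => match n with O => 1 | _ => 0 end) 1.
Proof.
  change (is_lim_seq (sum_n (fun n => match n with O => 1 | _ => 0 end)) 1).
  apply (is_lim_seq_ext (fun _ => 1)); [|apply is_lim_seq_const].
  intro n. induction n. - rewrite sum_O. auto. - rewrite sum_Sn, <- IHn. unfold plus; simpl. ring.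
Qed.

Lemma expm1_series t : is_series (fun n => expm1_coef n * t ^ n)
  (if Req_EM_T t 0 then 1 else (exp t - 1) / t).
Proof.
  destruct (Req_EM_T t 0) as [->|Ht].
  - apply (is_series_ext (fun n => match n with O => 1 | _ => 0 end)).
    + intros [|n]; unfold expm1_coef; simpl; field. 
      pose proof (INR_fact_neq_0 (S (S n))) as Q. simpl in Q. exact Q.
    + apply delta_series.
  - pose proof (proj1 (is_pseries_R _ _ _) (is_exp_Reals t)) as H.
    assert (H1 : is_series (fun n => / INR (fact (S n)) * t ^ (S n)) (exp t - 1)).
    { apply (is_series_incr_1 (fun n => / INR (fact n) * t ^ n)). unfold plus; simpl.
      replace (exp t - 1 + / 1 * 1) with (exp t) by field. exact H. }
    apply (is_series_scal_l (/ t)) in H1. replace ((exp t - 1) / t) with (/ t * (exp t - 1)) by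
    (field; auto).
    eapply is_series_ext; [|exact H1]. intro n. unfold expm1_coef.
    change (/ t * (/ INR (fact (S n)) * (t * t ^ n)) = / INR (fact (S n)) * t ^ n). field.
    split; [apply INR_fact_neq_0|auto].
Qed.

Lemma recip_coef_series t : Rabs t < 1 -> ex_series (fun n => recip_coef n * t ^ n).
Proof.
  intros Ht. apply (ex_series_le (V:=R_CompleteNormedModule)) with (fun n => Rabs t ^ n).
  - intro n. unfold norm; simpl; unfold abs; simpl. rewrite Rabs_mult, RPow_abs.
    pose proof (recip_coef_bound n). pose proof (Rabs_pos (t ^ n)). nra.
  - exists (/ (1 - Rabs t)). apply is_series_geom. rewrite Rabs_Rabsolu. auto.
Qed.

Lemma CV_recip_coef t : Rabs t < 1 -> Rbar_lt (Rabs t) (CV_radius recip_coef).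
Proof. apply CV_radius_gt. intros u Hu. apply recip_coef_series. rewrite Rabs_pos_eq; lra. Qed.
Lemma CV_expm1_coef t : Rbar_lt (Rabs t) (CV_radius expm1_coef).
Proof. apply (CV_radius_gt _ (Rabs t + 1)); [|lra]. intros u Hu. eexists; apply expm1_series. Qed.
Lemma CV_exp_coef x t : Rbar_lt (Rabs t) (CV_radius (fun n => x ^ n / INR (fact n))).
Proof.
  apply (CV_radius_gt _ (Rabs t + 1)); [|lra]. intros u Hu. exists (exp (x * u)).
  apply (is_series_ext (fun n => / INR (fact n) * (x * u) ^ n)).
  - intro n. rewrite Rpow_mult_distr. change (/ INR (fact n) * (x ^ n * u ^ n) = x ^ n / INR
    (fact n) * u ^ n). unfold Rdiv. ring.
  - apply is_pseries_R, is_exp_Reals.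
Qed.

Lemma expm1_recip_coef n : PS_mult expm1_coef recip_coef n = match n with O => 1 | _ => 0 end.
Proof.
  destruct n.
  - unfold PS_mult, expm1_coef, recip_coef; simpl. field.
  - unfold PS_mult. rewrite decomp_sum by lia. simpl pred. rewrite Nat.sub_0_r, recip_coef_S.
    unfold expm1_coef at 1. simpl (fact 1). replace (/ INR 1) with 1 by (simpl; field).
    rewrite (sum_eq (fun i => expm1_coef (S i) * recip_coef (S n - S i)) (fun i => recip_coef (n
    - i) / INR (fact (i + 2)))).
    + ring.
    + intros i Hi. unfold expm1_coef. replace (S (S i)) with (i + 2)%nat by lia.
      replace (S n - S i)%nat with (n - i)%nat by lia. unfold Rdiv. ring.
Qed.

Lemma PSeries_recip_coef t : t <> 0 -> Rabs t < 1 -> PSeries recip_coef t = t / (exp t - 1).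
Proof.
  intros Ht0 Ht.
  assert (Et : exp t - 1 <> 0). { intro E. apply Ht0.
  assert (exp t = exp 0) as K by (rewrite exp_0; lra). apply exp_inv in K. auto. }
  pose proof (expm1_series t) as H1. destruct (Req_EM_T t 0); [contradiction|].
  pose proof (is_pseries_mult expm1_coef recip_coef t _ _ (proj2 (is_pseries_R _ _ _) H1)
  (PSeries_correct _ _ (CV_radius_inside _ _ (CV_recip_coef t Ht))) (CV_expm1_coef t)
  (CV_recip_coef t Ht)) as H.
  assert (H2 : PSeries (PS_mult expm1_coef recip_coef) t = 1).
  { rewrite (PSeries_ext _ (fun n => match n with O => 1 | _ => 0 end)) by apply expm1_recip_coef.
    apply is_series_unique. apply (is_series_ext (fun n => match n with O => 1 | _ => 0 end));
    [|apply delta_series].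
    intros [|k]; [simpl; ring|]. rewrite Rmult_0_l. auto. }
  rewrite (is_pseries_unique _ _ _ H) in H2.
  apply Rmult_eq_reg_l with ((exp t - 1) / t); [|apply Rmult_integral_contrapositive_currified;
  [auto|apply Rinv_neq_0_compat; auto]].
  rewrite H2. field. auto.
Qed.

Lemma is_bernoulli_exists x : exists b, is_bernoulli x b.
Proof.
  exists (fun n => PS_mult recip_coef (fun n => x ^ n / INR (fact n)) n * INR (fact n)).
  exists 1. split; [lra|]. intros t Ht0 Ht.
  replace (t * exp (x * t) / (exp t - 1)) with (t / (exp t - 1) * exp (x * t)).
  2:{ field. intro E. apply Ht0. assert (exp t = exp 0) as K by (rewrite exp_0; lra).
  apply exp_inv in K. auto. }
  rewrite <- PSeries_recip_coef by auto.
  eapply is_pseries_ext; [|apply (is_pseries_mult recip_coef (fun n => x ^ n / INR (fact n)) t _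
  (exp (x * t)))].
  - intro n. simpl. field. apply INR_fact_neq_0.
  - apply PSeries_correct, CV_radius_inside, CV_recip_coef; auto.
  - apply is_pseries_R. apply (is_series_ext (fun n => / INR (fact n) * (x * t) ^ n)).
    + intro n. rewrite Rpow_mult_distr. change (/ INR (fact n) * (x ^ n * t ^ n) = x ^ n / INR
      (fact n) * t ^ n). unfold Rdiv. ring.
    + apply is_pseries_R, is_exp_Reals.
  - apply CV_recip_coef; auto.
  - apply CV_exp_coef.
Qed.

Lemma bernoulli_spec x : is_bernoulli x (fun n => bernoulli n x).
Proof. apply (epsilon_spec (inhabits (fun _ : nat => 0)) (is_bernoulli x)), is_bernoulli_exists.
  Qed.

(** * The generating function and its Euler derivatives *)
Ltac eq_in_R := match goal with |- @eq _ ?p ?q => change (@eq R p q) end.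

Definition geom (u : R) : R := / (1 - exp (- u)).
Definition gen_fun (x u : R) : R := u * geom u * exp (- (x * u)).

Lemma one_minus_exp u : 0 < u -> 0 < 1 - exp (- u).
Proof. intros. rewrite <- exp_0 at 1. assert (exp (- u) < exp 0) by (apply exp_increasing; lra).
  lra. Qed.

(** The span of u^a (1 - e^(-u))^(-b) e^(-xu). It contains the generating function,
    it is closed under u d/du since the derivative of geom is geom - geom^2, and
    its members decay rapidly: this gives the decay of all Euler derivatives at
    once. All of this is meant for u > 0. *)
Inductive exp_poly (x : R) : (R -> R) -> Prop :=
| exp_poly_mono a b : exp_poly x (fun u => u ^ a * geom u ^ b * exp (- (x * u)))
| exp_poly_add f h : exp_poly x f -> exp_poly x h -> exp_poly x (fun u => f u + h u)
| exp_poly_scal c f : exp_poly x f -> exp_poly x (fun u => c * f u)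
| exp_poly_ext f h : (forall u, 0 < u -> f u = h u) -> exp_poly x f -> exp_poly x h.

Lemma is_derive_pow_quot a u : 0 < u -> is_derive (fun u => u ^ a) u (INR a * u ^ a / u).
Proof.
  intros. eapply rder_eq; [apply (is_derive_pow (fun u => u) a u 1);
  apply (is_derive_id (K:=R_AbsRing))|].
  destruct a; [simpl; field; lra|]. change (INR (S a) * 1 * u ^ a = INR (S a) * (u * u ^ a) / u).
  field. lra.
Qed.

Lemma is_derive_geom u : 0 < u -> is_derive geom u (geom u - geom u ^ 2).
Proof.
  intros Hu. pose proof (one_minus_exp u Hu). unfold geom. auto_derive; [lra|]. field. lra.
Qed.

Lemma is_derive_geom_pow b u : 0 < u ->
  is_derive (fun u => geom u ^ b) u (INR b * (geom u ^ b - geom u ^ (S b))).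
Proof.
  intros Hu. eapply rder_eq; [apply (is_derive_pow geom b u); apply is_derive_geom; auto|].
  destruct b; [simpl; ring|]. change (INR (S b) * (geom u - geom u ^ 2) * geom u ^ b = INR (S b)
  * (geom u * geom u ^ b - geom u * (geom u * geom u ^ b))). ring.
Qed.

Lemma exp_poly_der x f : exp_poly x f -> exists f', exp_poly x f' /\ forall u, 0 < u ->
  is_derive f u (f' u / u).
Proof.
  induction 1 as [a b|f h Hf [f' [Af Df]] Hh [h' [Ah Dh]]|c f Hf [f' [Af Df]]|f h E Hf [f' [Af
  Df]]].
  - exists (fun u => INR a * (u ^ a * geom u ^ b * exp (- (x * u))) + (INR b * (u ^ (S a) * geom
    u ^ b * exp (- (x * u)) )
       + (- INR b * (u ^ (S a) * geom u ^ (S b) * exp (- (x * u))) + - x * (u ^ (S a) * geom u ^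
         b * exp (- (x * u)))))). split.
    + repeat apply exp_poly_add; apply exp_poly_scal; apply exp_poly_mono.
    + intros u Hu. eapply rder_eq.
      * apply rder_mult; [apply rder_mult; [apply is_derive_pow_quot;
        auto|apply is_derive_geom_pow; auto]|].
        instantiate (1 := - x * exp (- (x * u))). auto_derive; auto. ring.
      * eq_in_R. change (u ^ S a) with (u * u ^ a). cbv beta. field. lra.
  - exists (fun u => f' u + h' u). split; [apply exp_poly_add; auto|]. intros u Hu.
    eapply rder_eq; [apply rder_plus; auto|]. change (f' u / u + h' u / u = (f' u + h' u) / u).
    field. lra.
  - exists (fun u => c * f' u). split; [apply exp_poly_scal; auto|]. intros u Hu.
    eapply rder_eq; [apply (is_derive_scal f); auto|]. change (c * (f' u / u) = c * f' u / u).
    field. lra.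
  - exists f'. split; auto. intros u Hu. apply (is_derive_ext_loc f); auto.
    exists (mkposreal u Hu). intros y Hy. apply E. change (Rabs (y - u) < u) in Hy.
    apply Rabs_def2 in Hy. lra.
Qed.

Lemma exp_poly_decay x f : 0 < x -> exp_poly x f -> forall rho p, 0 < rho -> exists B, 0 <= B /\
  forall u, rho <= u -> Rabs (f u) <= B / u ^ p.
Proof.
  intros Hx. induction 1 as [a b|f h Hf IHf Hh IHh|c f Hf IHf|f h E Hf IHf]; intros rho p Hrho.
  - pose proof (one_minus_exp rho Hrho) as K.
    assert (W : forall u, rho <= u -> 0 < geom u <= geom rho).
    { intros u Hu. unfold geom. split; [apply Rinv_0_lt_compat, one_minus_exp; lra|].
      apply Rinv_le_contravar; auto.
      assert (exp (- u) <= exp (- rho)) by (apply exp_le; lra). lra. }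
    set (M := INR (fact (a + p)) / x ^ (a + p)).
    assert (0 <= M). { apply Rmult_le_pos; [apply pos_INR|left; apply Rinv_0_lt_compat, pow_lt;
    auto]. }
    assert (0 <= geom rho ^ b). { apply pow_le. left; apply W; lra. }
    exists (geom rho ^ b * M). split; [apply Rmult_le_pos; auto|]. intros u Hu.
    destruct (W u Hu) as [W1 W2].
    assert (0 < u ^ a) by (apply pow_lt; lra). assert (0 < u ^ p) by (apply pow_lt; lra).
    assert (0 < geom u ^ b) by (apply pow_lt; auto). pose proof (exp_pos (- (x * u))).
    rewrite Rabs_pos_eq by (apply Rmult_le_pos; [apply Rmult_le_pos|]; lra).
    assert (geom u ^ b <= geom rho ^ b) by (apply pow_incr; lra).
    assert (exp (- (x * u)) <= INR (fact (a + p)) / (x * u) ^ (a + p)) as Q by (apply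
    exp_opp_bound, Rmult_lt_0_compat; lra).
    replace (INR (fact (a + p)) / (x * u) ^ (a + p)) with (M / (u ^ a * u ^ p)) in Q.
    2:{ unfold M. rewrite Rpow_mult_distr, (pow_add u). field. repeat split; try lra.
    apply Rgt_not_eq, pow_lt; auto. }
    apply Rle_trans with (u ^ a * geom rho ^ b * (M / (u ^ a * u ^ p))).
    + apply Rmult_le_compat; try lra. apply Rmult_le_pos; lra. apply Rmult_le_compat_l; lra.
    + right. field. lra.
  - destruct (IHf rho p Hrho) as [B [HB K]]. destruct (IHh rho p Hrho) as [B' [HB' K']].
    exists (B + B'). split; [lra|].
    intros u Hu. eapply Rle_trans; [apply Rabs_triang|]. specialize (K u Hu).
    specialize (K' u Hu). unfold Rdiv in *. lra.
  - destruct (IHf rho p Hrho) as [B [HB K]]. exists (Rabs c * B).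
    split; [apply Rmult_le_pos; auto; apply Rabs_pos|].
    intros u Hu. rewrite Rabs_mult. unfold Rdiv. rewrite Rmult_assoc.
    apply Rmult_le_compat_l; [apply Rabs_pos|apply K; auto].
  - destruct (IHf rho p Hrho) as [B [HB K]]. exists B. split; auto. intros u Hu.
    rewrite <- E by lra. auto.
Qed.

(** (u d/du)^i applied to the generating function; u d/du multiplies the n-th
    Taylor coefficient by n. *)
Fixpoint euler_iter (x : R) (i : nat) (u : R) : R :=
  match i with O => gen_fun x u | S k => u * Derive (euler_iter x k) u end.

Lemma euler_iter_exp_poly x i : exp_poly x (euler_iter x i).
Proof.
  induction i.
  - apply exp_poly_ext with (fun u => u ^ 1 * geom u ^ 1 * exp (- (x * u)));
    [|apply exp_poly_mono]. intros u Hu. simpl. unfold gen_fun. ring.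
  - destruct (exp_poly_der _ _ IHi) as [f' [A D]]. apply exp_poly_ext with f'; auto. intros u Hu.
    simpl. rewrite (is_derive_unique _ _ _ (D u Hu)). field. lra.
Qed.

Lemma euler_iter_der x i u : 0 < u -> is_derive (euler_iter x i) u (euler_iter x (S i) u / u).
Proof.
  intros Hu. destruct (exp_poly_der _ _ (euler_iter_exp_poly x i)) as [f' [A D]].
  eapply rder_eq; [apply D; auto|]. simpl. rewrite (is_derive_unique _ _ _ (D u Hu)). field. lra.
Qed.

(** The Taylor coefficients of gen_fun; the sign comes from t = - u in the
    generating function of the Bernoulli polynomials. *)
Definition gen_coef (x : R) (n : nat) : R := (-1) ^ n * bernoulli n x / INR (fact n).

Lemma gen_fun_series x : exists r, 0 < r /\ forall u, 0 < u < r ->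
  is_pseries (gen_coef x) u (gen_fun x u).
Proof.
  destruct (bernoulli_spec x) as [r [Hr H]]. exists r. split; auto. intros u Hu.
  specialize (H (- u) ltac:(lra)). rewrite Rabs_Ropp, Rabs_pos_eq in H by lra.
  specialize (H ltac:(lra)).
  apply is_pseries_R. apply is_pseries_R in H. pose proof (one_minus_exp u ltac:(lra)).
  replace (gen_fun x u) with (- u * exp (x * - u) / (exp (- u) - 1)).
  - apply is_series_ext with (2 := H). intro n. unfold gen_coef.
    replace (- u) with (-1 * u) by ring. rewrite Rpow_mult_distr. eq_in_R. unfold Rdiv. ring.
  - unfold gen_fun, geom. replace (x * - u) with (- (x * u)) by ring. field. lra.
Qed.

Lemma euler_iter_PSeries x : exists r, 0 < r /\
  (forall u, Rabs u < r -> forall i,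
  Rbar_lt (Rabs u) (CV_radius (fun n => INR n ^ i * gen_coef x n))) /\ forall i u, 0 < u < r ->
  euler_iter x i u = PSeries (fun n => INR n ^ i * gen_coef x n) u.
Proof.
  destruct (gen_fun_series x) as [r [Hr H]]. exists r. split; auto.
  assert (E1 : forall i n, PS_incr_1 (PS_derive (fun n => INR n ^ i * gen_coef x n)) n = INR n ^
  S i * gen_coef x n).
  { intros i [|n]; unfold PS_incr_1, PS_derive; [simpl INR; rewrite pow_i by lia; unfold zero;
    simpl; eq_in_R; ring|]. eq_in_R. change (INR (S n) ^ S i) with (INR (S n) * INR (S n) ^ i).
    ring. }
  assert (CVi : forall u, Rabs u < r -> forall i,
  Rbar_lt (Rabs u) (CV_radius (fun n => INR n ^ i * gen_coef x n))).
  { intros u Hu i. induction i.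
    - apply (CV_radius_gt _ r); auto. intros t Ht. exists (gen_fun x t).
      apply (is_series_ext (fun n => gen_coef x n * t ^ n)); [intro n; simpl; ring|].
      apply is_pseries_R. apply H; auto.
    - rewrite <- (CV_radius_ext _ _ (E1 i)), CV_radius_incr_1, CV_radius_derive. auto. }
  split; auto. intro i. induction i; intros u Hu.
  - simpl euler_iter. symmetry. rewrite (PSeries_ext _ (gen_coef x)) by (intro n; simpl; ring).
    apply is_pseries_unique. auto.
  - simpl euler_iter. rewrite <- (PSeries_ext _ _ _ (E1 i)), PSeries_incr_1. f_equal.
    apply is_derive_unique.
    apply (is_derive_ext_loc (PSeries (fun n => INR n ^ i * gen_coef x n))).
    + assert (0 < Rmin u (r - u)) as Hd by (apply Rmin_glb_lt; lra). exists (mkposreal _ Hd).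
      intros y Hy. change (Rabs (y - u) < Rmin u (r - u)) in Hy.
      pose proof (Rmin_l u (r - u)). pose proof (Rmin_r u (r - u)). apply Rabs_def2 in Hy.
      symmetry. apply IHi. lra.
    + apply is_derive_PSeries. apply CVi. rewrite Rabs_pos_eq; lra.
Qed.

Lemma PSeries_taylor N : forall (a : nat -> R) rho, 0 < rho -> Rbar_lt rho (CV_radius a) ->
  exists B, 0 <= B /\ forall u, 0 < u <= rho ->
  Cmod (RtoC (PSeries a u) - csum (fun n => RtoC (a n * u ^ n)) N)%C <= B * u ^ N.
Proof.
  induction N; intros a rho Hr HCV.
  - pose proof (CV_disk_inside a rho) as K. rewrite Rabs_pos_eq in K by lra. specialize (K HCV).
    exists (Rabs (Series (fun n => Rabs (a n * rho ^ n)))). split; [apply Rabs_pos|]. intros u Hu.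
    cbn [csum]. replace (RtoC (PSeries a u) - 0)%C with (RtoC (PSeries a u)) by ring.
    rewrite Cmod_R. simpl. rewrite Rmult_1_r.
    assert (L : forall n, 0 <= Rabs (a n * u ^ n) <= Rabs (a n * rho ^ n)).
    { intro n. split; [apply Rabs_pos|]. rewrite !Rabs_mult.
      apply Rmult_le_compat_l; [apply Rabs_pos|].
      rewrite !Rabs_pos_eq by (apply pow_le; lra). apply pow_incr; lra. }
    unfold PSeries. eapply Rle_trans; [apply Series_Rabs|].
    + apply (ex_series_le (V:=R_CompleteNormedModule)) with (2 := K). intro n.
      unfold norm; simpl; unfold abs; simpl. rewrite Rabs_Rabsolu. apply L.
    + eapply Rle_trans; [apply Series_le; [exact L|exact K]|apply Rle_abs].
  - destruct (IHN (PS_decr_1 a) rho Hr) as [B [HB K]]. { rewrite CV_radius_decr_1; auto. }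
    exists B. split; auto. intros u Hu. rewrite csum_shift, PSeries_decr_1.
    2:{ apply CV_radius_inside. eapply Rbar_le_lt_trans; [|exact HCV]. simpl.
    rewrite Rabs_pos_eq; lra. }
    rewrite (csum_ext _ (fun k => RtoC u * RtoC (PS_decr_1 a k * u ^ k))%C).
    2:{ intros k _. rewrite <- RtoC_mult. f_equal. unfold PS_decr_1. simpl. ring. }
    rewrite csum_scal. specialize (K u Hu). set (cs := csum _ N) in *.
    replace (RtoC (a 0%nat + u * PSeries (PS_decr_1 a) u) - (RtoC (a 0%nat * u ^ 0) + RtoC u *
    cs))%C with (RtoC u * (RtoC (PSeries (PS_decr_1 a) u) - cs))%C.
    + rewrite Cmod_mult, Cmod_R, Rabs_pos_eq by lra. change (u ^ S N) with (u * u ^ N).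
      replace (B * (u * u ^ N)) with (u * (B * u ^ N)) by ring.
      apply Rmult_le_compat_l; [lra|auto].
    + simpl pow. rewrite Rmult_1_r, RtoC_plus, RtoC_mult. ring.
Qed.

Lemma csum_poly_bound (c : nat -> R) rho N : 0 < rho -> exists B, 0 <= B /\ forall u, rho <= u ->
  Cmod (csum (fun n => RtoC (c n * u ^ n)) N) <= B * u ^ N.
Proof.
  intros Hr. induction N as [|N [B [HB K]]].
  - exists 0. split; [lra|]. intros u Hu. cbn [csum]. rewrite Cmod_0. lra.
  - exists ((B + Rabs (c N)) / rho). assert (0 <= B + Rabs (c N)) by (pose proof (Rabs_pos (c
    N)); lra).
    split; [apply Rmult_le_pos; auto; left; apply Rinv_0_lt_compat; auto|].
    intros u Hu. cbn [csum]. eapply Rle_trans; [apply Cmod_triangle|]. specialize (K u Hu).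
    rewrite Cmod_R, Rabs_mult, (Rabs_pos_eq (u ^ N)) by (apply pow_le; lra).
    assert (0 < u ^ N) by (apply pow_lt; lra).
    apply Rle_trans with ((B + Rabs (c N)) * u ^ N); [lra|].
    change (u ^ S N) with (u * u ^ N). apply Rle_trans with ((B + Rabs (c N)) / rho * (rho * u ^
    N)); [right; field; lra|].
    apply Rmult_le_compat_l; [apply Rmult_le_pos; auto; left; apply Rinv_0_lt_compat; auto|].
    apply Rmult_le_compat_r; lra.
Qed.

(** Near 0 this is the remainder of a convergent power series. Away from 0, where
    the power series need not converge, the decaying function and the polynomial of
    degree less than N are each O(u^N). *)
Lemma euler_iter_taylor x i N : 0 < x -> exists B, 0 <= B /\ forall u, 0 < u ->
  Cmod (RtoC (euler_iter x i u) - csum (fun n => RtoC (INR n ^ i * gen_coef x n * u ^ n)) N)%C <=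
  B * u ^ N.
Proof.
  intros Hx. destruct (euler_iter_PSeries x) as [r [Hr [CV E]]]. set (rho := r / 2).
  assert (0 < rho < r) by (unfold rho; lra).
  destruct (PSeries_taylor N (fun n => INR n ^ i * gen_coef x n) rho) as [B1 [HB1 K1]]; [lra| |].
  { specialize (CV rho ltac:(rewrite Rabs_pos_eq; lra) i). rewrite Rabs_pos_eq in CV by lra.
    auto. }
  destruct (csum_poly_bound (fun n => INR n ^ i * gen_coef x n) rho N) as [B2 [HB2 K2]]; [lra|].
  destruct (exp_poly_decay x _ Hx (euler_iter_exp_poly x i) rho 0) as [B3 [HB3 K3]]; [lra|].
  assert (0 < rho ^ N) by (apply pow_lt; lra).
  assert (0 <= B3 / rho ^ N) by (apply Rmult_le_pos; auto; left; apply Rinv_0_lt_compat; auto).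
  exists (B1 + B2 + B3 / rho ^ N). split; [lra|]. intros u Hu.
  assert (0 < u ^ N) by (apply pow_lt; lra).
  assert (P1 : 0 <= B1 * u ^ N) by (apply Rmult_le_pos; lra).
  assert (P2 : 0 <= B2 * u ^ N) by (apply Rmult_le_pos; lra).
  assert (P3 : 0 <= B3 / rho ^ N * u ^ N) by (apply Rmult_le_pos; lra).
  destruct (Rle_dec u rho) as [h|h].
  - rewrite E by lra. specialize (K1 u ltac:(lra)). lra.
  - specialize (K2 u ltac:(lra)). specialize (K3 u ltac:(lra)). simpl in K3.
    unfold Cminus. eapply Rle_trans; [apply Cmod_triangle|]. rewrite Cmod_opp, Cmod_R.
    assert (B3 / 1 <= B3 / rho ^ N * u ^ N).
    { replace (B3 / 1) with (B3 / rho ^ N * rho ^ N) by (field; lra).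
      apply Rmult_le_compat_l; auto. apply pow_incr; lra. }
    lra.
Qed.

Lemma euler_iter_decay x i p : 0 < x -> exists B, 0 <= B /\ forall u, 0 < u ->
  Rabs (euler_iter x i u) <= B / u ^ p.
Proof.
  intros Hx. destruct (euler_iter_taylor x i 0 Hx) as [B1 [HB1 K1]].
  destruct (exp_poly_decay x _ Hx (euler_iter_exp_poly x i) 1 p) as [B2 [HB2 K2]]; [lra|].
  exists (B1 + B2). split; [lra|]. intros u Hu. assert (0 < u ^ p) by (apply pow_lt; auto).
  destruct (Rle_dec 1 u) as [h|h].
  - eapply Rle_trans; [apply K2; auto|]. apply Rmult_le_compat_r; [left; apply Rinv_0_lt_compat;
    auto|lra].
  - specialize (K1 u Hu). simpl in K1. replace (RtoC (euler_iter x i u) - 0)%C with (RtoC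
    (euler_iter x i u)) in K1 by ring. rewrite Cmod_R in K1.
    assert (u ^ p <= 1) by (rewrite <- (pow1 p); apply pow_incr; lra).
    apply Rle_trans with (B1 + B2); [lra|]. rewrite <- (Rmult_1_r (B1 + B2)) at 1.
    apply Rmult_le_compat_l; [lra|].
    rewrite <- Rinv_1 at 1. apply Rinv_le_contravar; auto.
Qed.

(** * Gamma times zeta *)
Lemma gen_fun_cont x u : 0 < u -> continuous (gen_fun x) u.
Proof. intros. apply (ex_derive_continuous (V:=R_NormedModule)). eexists.
  apply (euler_iter_der x 0 u); auto. Qed.

Lemma gen_fun_taylor x N : 0 < x -> exists B, 0 <= B /\ forall u, 0 < u ->
  Cmod (RtoC (gen_fun x u) - csum (fun n => RtoC (gen_coef x n * u ^ n)) N)%C <= B * u ^ N.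
Proof.
  intros Hx. destruct (euler_iter_taylor x 0 N Hx) as [B [HB K]]. exists B. split; auto.
  intros u Hu. specialize (K u Hu).
  rewrite (csum_ext _ (fun n => RtoC (gen_coef x n * u ^ n))) in K; [exact K|]. intros k _.
  f_equal. simpl. ring.
Qed.

Lemma gen_fun_decay x p : 0 < x -> exists B, 0 <= B /\ forall u, 0 < u ->
  Rabs (gen_fun x u) <= B / u ^ p.
Proof. intros Hx. apply (euler_iter_decay x 0 p Hx). Qed.

Notation mellin_gen x N s := (mellin_reg (gen_fun x) (gen_coef x) N s).

Lemma is_rint_gen_of_is_cint_gen Fa Fb dom (g : R -> R) l : interval_filters Fa Fb dom ->
  is_cint_gen Fa Fb (fun u => RtoC (g u)) (RtoC l) -> is_rint_gen Fa Fb g l.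
Proof.
  intros G H eps He. destruct G as [P1 [P2 G]].
  pose proof (filter_prod_proper (F := Fa) (G := Fb)).
  apply filter_imp with (2 := H eps He). intros ab K. apply (Re_close _ _ _) in K. exact K.
Qed.

Lemma geometric_exp_sum x u K : 0 < u -> csum (fun n => RtoC (exp (- ((INR n + x) * u)))) K =
  RtoC (exp (- (x * u)) * geom u * (1 - exp (- (INR K * u)))).
Proof.
  intros Hu. pose proof (one_minus_exp u Hu). induction K.
  - simpl. replace (- (0 * u)) with 0 by ring. rewrite exp_0, Rminus_diag, Rmult_0_r. auto.
  - cbn [csum]. rewrite IHK, <- RtoC_plus. f_equal. rewrite S_INR.
    replace (- ((INR K + 1) * u)) with (- (INR K * u) + - u) by ring.
    replace (- ((INR K + x) * u)) with (- (x * u) + - (INR K * u)) by ring.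
    rewrite !exp_plus. unfold geom. field. lra.
Qed.

(** Both sides are the integral of u^(s-1) G(u) over (0,oo): expand 1/(1 - e^(-u))
    as a geometric series in G(u) = u e^(-xu)/(1 - e^(-u)) and apply the scaling of
    the Gamma integral to each term. *)
Lemma mellin_gen_right x N s : 0 < x -> 0 < Re s -> (Gamma_int (1 + s) * zeta_em x (1 + s))%C =
  (mellin_gen x N s + csum (fun n => RtoC (gen_coef x n) / (s + RtoC (INR n)))%C N)%C.
Proof.
  intros Hx Hs. assert (H1s : 0 < Re (1 + s)) by (simpl; unfold Re in *; lra).
  pose proof (mellin_full (gen_fun x) (gen_coef x) (fun u Hu => gen_fun_cont x u Hu) (fun M =>
  gen_fun_taylor x M Hx) (fun p => gen_fun_decay x p Hx) N s Hs) as HT.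
  set (T := (mellin_gen x N s + csum (fun n => RtoC (gen_coef x n) / (s + RtoC (INR n)))%C N)%C)
  in *.
  assert (Ck : forall a z u, 0 < u -> ccont (mellin_kernel (fun u => exp (- (a * u))) z) u).
  { intros a z u Hu. apply mellin_kernel_ccont; auto. continuity_by_derive. auto. }
  assert (HS : forall K, is_cint_gen to_0 to_oo (fun u => csum (fun n => mellin_kernel (fun u =>
  exp (- ((INR n + x) * u))) (1 + s) u) K) (csum (fun n => cpow (INR n + x) (- (1 + s)) *
  Gamma_int (1 + s))%C K)
     /\ forall u, 0 < u -> ccont (fun u => csum (fun n => mellin_kernel (fun u => exp (- ((INR n
     + x) * u))) (1 + s) u) K) u).
  { induction K as [|K [IH1 IH2]]; cbn [csum].
    - split; [|intros; apply ccont_const]. apply is_cint_gen_zero with (fun u => 0 < u),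
      interval_filters_0oo.
    - split; [|intros; apply ccont_plus; auto].
      apply is_cint_gen_plus with (fun u => 0 < u); auto using interval_filters_0oo.
      apply Gamma_int_scaled; auto. pose proof (pos_INR K); lra. }
  destruct (gen_fun_decay x 0 Hx) as [B [HB KB]].
  destruct (Gamma_int_real_pos (Re s) Hs) as [gr [Hgr Egr]].
  (* The tail of the geometric series is e^(-Ku) times the integrand; as the
     generating function is bounded, its integral is O(K^(- Re s)). *)
  assert (HD : forall K : nat, (0 < K)%nat -> Cmod (csum (fun n => cpow (INR n + x) (- (1 + s)) *
  Gamma_int (1 + s))%C K - T) <= 2 * (B * (Rpower (INR K) (- Re s) * gr))).
  { intros K HK. apply lt_INR in HK. simpl in HK.
    assert (R1 : is_rint_gen to_0 to_oo (fun u => B * (exp (- (INR K * u)) * Rpower u (Re s -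
    1))) (B * (Rpower (INR K) (- Re s) * gr))).
    { apply is_rint_gen_scal with (fun u => 0 < u); [apply interval_filters_0oo| |].
      - intros u Hu. apply rcont_mult; [|apply cont_Rpower; auto]. continuity_by_derive. auto.
      - apply is_rint_gen_of_is_cint_gen with (fun u => 0 < u); [apply interval_filters_0oo|].
        pose proof (Gamma_int_scaled (INR K) (RtoC (Re s)) HK Hs) as Q.
        rewrite Egr, <- RtoC_opp, cpow_R, <- RtoC_mult in Q.
        apply is_cint_gen_ext with (dom := fun u => 0 < u) (3 := Q);
        [apply interval_filters_0oo|]. intros u Hu. rewrite mellin_kernel_real; auto. }
    destruct (HS K) as [S1 S2].
    destruct (is_cint_gen_dominated to_0 to_oo (fun u => 0 < u) interval_filters_0oo (fun u =>
    mellin_kernel (gen_fun x) s u + - (1) * csum (fun n => mellin_kernel (fun u => exp (- ((INR n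
    + x) * u))) (1 + s) u) K)%C
      (fun u => B * (exp (- (INR K * u)) * Rpower u (Re s - 1))) (B * (Rpower (INR K) (- Re s) *
      gr))) as [l [Hl Bl]]; [| | |exact R1|].
    - intros u Hu. apply ccont_plus; [apply mellin_kernel_ccont; auto; apply gen_fun_cont;
      auto|]. apply ccont_mult; [apply ccont_const|auto].
    - intros u Hu. apply rcont_mult; [apply continuous_const|].
      apply rcont_mult; [|apply cont_Rpower; auto]. continuity_by_derive. auto.
    - intros u Hu.
      replace (mellin_kernel (gen_fun x) s u + - (1) * csum (fun n => mellin_kernel (fun u => exp
      (- ((INR n + x) * u))) (1 + s) u) K)%C with (RtoC (exp (- (INR K * u))) * mellin_kernel
      (gen_fun x) s u)%C.
      + unfold mellin_kernel. rewrite !Cmod_mult, !Cmod_R, Cmod_cpow.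
        change (Re (s - 1)) with (Re s - 1).
        specialize (KB u Hu). simpl in KB. unfold Rdiv in KB. rewrite Rinv_1, Rmult_1_r in KB.
        rewrite (Rabs_pos_eq (exp _)) by (left; apply exp_pos).
        rewrite <- Rmult_assoc, (Rmult_comm (exp _)), Rmult_assoc.
        apply Rmult_le_compat_r; auto. apply Rmult_le_pos; left; apply exp_pos.
      + unfold mellin_kernel. replace (1 + s - 1)%C with (s - 1 + 1)%C by ring.
        assert (csum (fun n => RtoC (exp (- ((INR n + x) * u))) * cpow u (s - 1 + 1))%C K = cpow
        u (s - 1) * RtoC u * csum (fun n => RtoC (exp (- ((INR n + x) * u)))) K)%C as ->.
        { rewrite <- csum_scal. apply csum_ext. intros k _. rewrite cpow_plus, cpow_1 by auto.
          ring. }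
        rewrite geometric_exp_sum by auto. unfold gen_fun. rewrite !RtoC_mult, RtoC_minus. ring.
    - replace (csum (fun n => cpow (INR n + x) (- (1 + s)) * Gamma_int (1 + s))%C K - T)%C with
      (- l)%C; [rewrite Cmod_opp; auto|].
      assert (Q : is_cint_gen to_0 to_oo (fun u => mellin_kernel (gen_fun x) s u + - (1) * csum
      (fun n => mellin_kernel (fun u => exp (- ((INR n + x) * u))) (1 + s) u) K)%C (T + - (1) *
      csum (fun n => cpow (INR n + x) (- (1 + s)) * Gamma_int (1 + s))%C K)%C).
      { apply is_cint_gen_plus with (fun u => 0 < u); auto using interval_filters_0oo.
        - intros u Hu. apply mellin_kernel_ccont; auto; apply gen_fun_cont; auto.
        - intros u Hu. apply ccont_mult; [apply ccont_const|auto].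
        - apply is_cint_gen_scal with (fun u => 0 < u); auto using interval_filters_0oo. }
      rewrite (is_cint_gen_unique _ _ _ interval_filters_0oo _ _ _ Hl Q). ring. }
  assert (C1 : Clim (csum (fun n => cpow (INR n + x) (- (1 + s)) * Gamma_int (1 + s))%C) T).
  { apply Clim_incr. eapply Clim_bound; [intro n; apply HD; lia|].
    replace (Finite 0) with (Rbar_mult (2 * B * gr) 0) by (simpl; f_equal; ring).
    apply (is_lim_seq_ext (fun n => (2 * B * gr) * Rpower (INR (S n)) (- Re s))). { intro n.
    ring. }
    apply is_lim_seq_scal_l. pose proof (Clim_cpow_0 1 (RtoC (Re s)) Rlt_0_1 Hs) as L.
    apply Clim_parts in L. destruct L as [L _].
    eapply is_lim_seq_ext; [|exact L]. intro n. cbv beta. rewrite <- RtoC_opp, cpow_R, S_INR.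
    reflexivity. }
  assert (C2 : is_cseries (fun n => cpow (INR n + x) (- (1 + s)) * Gamma_int (1 + s))%C
  (Gamma_int (1 + s) * zeta_em x (1 + s))%C).
  { eapply is_cseries_ext; [|apply is_cseries_scal, (zeta_em_dirichlet x (1 + s)); auto; simpl;
    unfold Re in *; lra]. intro n. cbv beta. ring. }
  eapply Clim_unique; [exact C2|exact C1].
Qed.

(** s zeta(1+s,x), with its removable singularity at s = 0 removed: an entire
    function. *)
Definition s_zeta (x : R) (s : C) : C := (cpow x (- s) + s * zeta_reg x (s + 1))%C.

Lemma s_zeta_eq x (s : C) : s <> 0 -> s_zeta x s = (s * zeta_em x (1 + s))%C.
Proof.
  intros Hs. unfold s_zeta, zeta_em. replace (1 - (1 + s))%C with (- s)%C by ring.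
  replace (1 + s - 1)%C with s by ring.
  rewrite (Cplus_comm 1 s). field. auto.
Qed.

Lemma s_zeta_analytic x s : 0 < x -> analytic_at (s_zeta x) s.
Proof.
  intros Hx. apply analytic_at_plus.
  - apply (analytic_at_opp_arg (fun s => cpow x s)), analytic_at_cpow.
  - apply analytic_at_mult; [apply analytic_at_id|]. apply (analytic_at_shift (zeta_reg x)).
    apply zeta_reg_analytic; auto.
Qed.

Lemma pochhammer_analytic n s : analytic_at (fun s => pochhammer s n) s.
Proof.
  induction n; simpl; [apply analytic_at_const|]. apply analytic_at_mult; auto.
  apply analytic_at_plus; [apply analytic_at_id|apply analytic_at_const].
Qed.

Lemma pochhammer_shift z n : pochhammer z (S n) = (z * pochhammer (z + 1) n)%C.
Proof.
  induction n; [simpl; ring|]. change (pochhammer z (S (S n))) with (pochhammer z (S n) * (z +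
  RtoC (INR (S n))))%C.
  rewrite IHn. simpl pochhammer at 2. rewrite S_INR, RtoC_plus. ring.
Qed.

(** The sum of g k / (s + k), k < n, multiplied by s (s + 1) ... (s + n - 1), in a
    form without division so that it is visibly entire. *)
Fixpoint polar_numer (x : R) (n : nat) (s : C) : C :=
  match n with O => RtoC 0 | S k => (polar_numer x k s * (s + RtoC (INR k)) + RtoC (gen_coef x k)
  * pochhammer s k)%C end.

Lemma polar_numer_analytic x n s : analytic_at (polar_numer x n) s.
Proof.
  induction n; simpl; [apply analytic_at_const|]. apply analytic_at_plus.
  - apply analytic_at_mult; auto. apply analytic_at_plus;
    [apply analytic_at_id|apply analytic_at_const].
  - apply analytic_at_mult; [apply analytic_at_const|apply pochhammer_analytic].
Qed.

Lemma polar_numer_eq x n s : (forall k, (k < n)%nat -> (s + RtoC (INR k))%C <> 0) ->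
  polar_numer x n s = (pochhammer s n * csum
  (fun k => RtoC (gen_coef x k) / (s + RtoC (INR k)))%C n)%C.
Proof.
  induction n; intros H; simpl; [ring|]. rewrite IHn by auto. field. auto.
Qed.

Lemma mellin_gen_analytic x N s : 0 < x -> 0 < Re s + INR N ->
  analytic_at (fun s => mellin_gen x N s) s.
Proof.
  intros Hx Hs. apply mellin_reg_analytic; auto.
  - intros; apply gen_fun_cont; auto. - intros; apply gen_fun_taylor; auto.
    - intros; apply gen_fun_decay; auto.
Qed.

Lemma mellin_identity_right x N s : 0 < x -> 0 < Re s -> (1 <= N)%nat ->
  (Gamma_int (s + RtoC (INR N)) * s_zeta x s)%C =
  (pochhammer s N * mellin_gen x N s + polar_numer x N s)%C.
Proof.
  intros Hx Hs HN.
  assert (Hk : forall k, (s + RtoC (INR k))%C <> 0).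
  { intros k E. assert (Re (s + RtoC (INR k)) = 0) as K by (rewrite E; reflexivity).
    change (Re s + INR k = 0) in K. pose proof (pos_INR k). lra. }
  assert (Hs0 : s <> 0) by (specialize (Hk 0%nat); simpl in Hk;
  replace (s + 0)%C with s in Hk by ring; auto).
  rewrite polar_numer_eq by auto. rewrite <- Cmult_plus_distr_l, <- mellin_gen_right by auto.
  rewrite s_zeta_eq by auto.
  destruct N as [|n]; [lia|]. rewrite pochhammer_shift.
  assert (E : (Gamma_int (1 + s) * pochhammer (s + 1) n)%C = Gamma_int (s + RtoC (INR (S n)))).
  { rewrite (Cplus_comm 1 s). pose proof (Gamma_int_pochhammer (s + 1) 0 n) as P. simpl INR in P.
    replace (s + 1 + 0)%C with (s + 1)%C in P by ring.
    rewrite P; [|change (0 < Re s + 1 + 0); lra|lia]. simpl pochhammer. rewrite S_INR, RtoC_plus.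
    replace (s + 1 + RtoC (INR n))%C with (s + (RtoC (INR n) + 1))%C by ring. ring. }
  rewrite <- E. ring.
Qed.

(** Both sides are analytic for Re s > - N and agree for Re s > 0; the horizontal
    line through s joins the two regions. *)
Lemma mellin_identity x N s : 0 < x -> 0 < Re s + INR N -> (1 <= N)%nat ->
  (Gamma_int (s + RtoC (INR N)) * s_zeta x s)%C =
  (pochhammer s N * mellin_gen x N s + polar_numer x N s)%C.
Proof.
  intros Hx Hs HN. pose proof (pos_INR N).
  set (f := fun z => (Gamma_int (z + RtoC (INR N)) * s_zeta x z - (pochhammer z N * mellin_gen x
  N z + polar_numer x N z))%C).
  set (z0 := (1, Im s) : C). set (w := (s - z0)%C).
  assert (Hw : w = RtoC (Re s - 1)) by (apply injective_projections; simpl; unfold Re, Im; ring).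
  assert (Rz : forall tau, Re (z0 + RtoC tau * w) = 1 + tau * (Re s - 1)) by (intro tau;
  rewrite Hw; simpl; unfold Re; simpl; ring).
  assert (E : f (z0 + w)%C = 0).
  { apply (analytic_at_segment f z0 w (/ (1 + Rabs (Re s - 1)))).
    - intros tau Ht. set (z := (z0 + RtoC tau * w)%C).
      assert (0 < Re z + INR N). { unfold z. rewrite Rz.
      destruct (Rle_dec 0 (Re s - 1)); [assert (0 <= tau * (Re s - 1)) by (apply Rmult_le_pos;
      lra)|assert (1 * (Re s - 1) <= tau * (Re s - 1)) by nra]; lra. }
      apply analytic_at_minus; [apply analytic_at_mult|apply analytic_at_plus;
      [apply analytic_at_mult|]].
      + apply (analytic_at_shift Gamma_int). apply Gamma_int_analytic. exact H0.
      + apply s_zeta_analytic; auto. + apply pochhammer_analytic.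
        + apply mellin_gen_analytic; auto. + apply polar_numer_analytic.
    - apply Rinv_0_lt_compat. pose proof (Rabs_pos (Re s - 1)). lra.
    - intros tau Ht. unfold f. rewrite mellin_identity_right; auto; [ring|]. rewrite Rz.
      pose proof (Rabs_pos (Re s - 1)). pose proof (Rle_abs (- (Re s - 1))) as Q.
      rewrite Rabs_Ropp in Q.
      set (D := 1 + Rabs (Re s - 1)) in *. assert (tau * D < / D * D) as K by (apply
      Rmult_lt_compat_r; [unfold D; lra|apply Ht]).
      rewrite Rinv_l in K by (unfold D; lra). unfold D in K.
      nra. }
  replace (z0 + w)%C with s in E by (unfold w; ring). unfold f in E.
  apply Ceq_minus. exact E.
Qed.

Lemma Gamma_zeta_mellin x N s : 0 < x -> 0 < Re s + INR N -> (1 <= N)%nat ->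
  (forall n : nat, s <> RtoC (- INR n)) -> (Gamma (1 + s) * zeta_em x (1 + s))%C =
  (mellin_gen x N s + csum (fun n => RtoC (gen_coef x n) / (s + RtoC (INR n)))%C N)%C.
Proof.
  intros Hx Hs HN Hne.
  assert (Hk : forall k, (s + RtoC (INR k))%C <> 0).
  { intros k E. apply (Hne k). rewrite RtoC_opp.
    replace s with (s + RtoC (INR k) - RtoC (INR k))%C by ring. rewrite E. ring. }
  assert (Hs0 : s <> 0) by (specialize (Hk 0%nat); simpl in Hk;
  replace (s + 0)%C with s in Hk by ring; auto).
  assert (HP : pochhammer s N <> 0) by (apply pochhammer_neq0; intros; apply Hne).
  pose proof (mellin_identity x N s Hx Hs HN) as E.
  rewrite polar_numer_eq, <- Cmult_plus_distr_l, s_zeta_eq in E by auto.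
  set (T := (mellin_gen x N s + _)%C) in *.
  destruct N as [|n]; [lia|].
  assert (P : (Gamma (1 + s) * pochhammer (1 + s) n)%C = Gamma_int (s + RtoC (INR (S n)))).
  { rewrite Gamma_pochhammer.
    - f_equal. rewrite S_INR, RtoC_plus. ring.
    - intros k E0. apply (Hne (S k)). rewrite S_INR, RtoC_opp, RtoC_plus.
      replace s with (1 + s - 1)%C by ring. rewrite E0, RtoC_opp. ring.
    - change (0 < 1 + Re s + INR n). rewrite S_INR in Hs. lra. }
  rewrite <- P in E. rewrite pochhammer_shift, (Cplus_comm s 1) in E.
  rewrite pochhammer_shift, (Cplus_comm s 1) in HP.
  assert (E2 : (s * pochhammer (1 + s) n * (Gamma (1 + s) * zeta_em x (1 + s)))%C = (s *
  pochhammer (1 + s) n * T)%C) by (rewrite <- E; ring).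
  replace (Gamma (1 + s) * zeta_em x (1 + s))%C with (/ (s * pochhammer (1 + s) n) * (s *
  pochhammer (1 + s) n * (Gamma (1 + s) * zeta_em x (1 + s))))%C.
  - rewrite E2, Cmult_assoc, Cinv_l by auto. ring.
  - rewrite Cmult_assoc, Cinv_l by auto. ring.
Qed.

(** * Finite parts at the poles *)
Lemma Gamma_int_1 : Gamma_int 1 = 1.
Proof.
  apply (is_cint_gen_unique to_0 to_oo (fun u => 0 < u) interval_filters_0oo (mellin_kernel
  exp_neg 1)); [apply Gamma_int_spec; simpl; lra|].
  replace (RtoC 1) with (0 - (- (1)))%C by ring. 
  apply (is_cint_gen_FTC _ _ _ interval_filters_0oo (fun u => RtoC (- exp (- u)))).
  - intros u Hu. replace (0 - - (1))%C with (RtoC 1) by ring. rewrite mellin_kernel_real by auto.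
    replace (1 - 1) with 0 by ring. rewrite Rpower_O by auto.
    apply cder_RtoC. unfold exp_neg. auto_derive; auto. ring.
  - intros u Hu. apply mellin_kernel_exp_neg_ccont; auto.
  - intros eps He. apply at_right0_intro with eps; auto. intros u Hu.
    replace (RtoC (- exp (- u)) - - (1))%C with (RtoC (1 - exp (- u))) by (rewrite RtoC_minus,
    RtoC_opp; ring).
    rewrite Cmod_R. pose proof (exp_ineq1_le (- u)). pose proof (one_minus_exp u ltac:(lra)).
    rewrite Rabs_pos_eq; lra.
  - intros eps He. exists (Rmax 1 (/ eps)). intros u Hu.
    assert (1 < u) by (eapply Rle_lt_trans; [apply Rmax_l|exact Hu]).
    assert (/ eps < u) by (eapply Rle_lt_trans; [apply Rmax_r|exact Hu]).
    replace (RtoC (- exp (- u)) - 0)%C with (RtoC (- exp (- u))) by ring.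
    rewrite Cmod_R, Rabs_Ropp, Rabs_pos_eq by (left; apply exp_pos).
    pose proof (exp_opp_bound 1 u ltac:(lra)) as Q.
    replace (INR (fact 1) / u ^ 1) with (/ u) in Q by (simpl; field; lra).
    assert (/ u < eps). { rewrite <- (Rinv_inv eps). apply Rinv_lt_contravar; auto.
    apply Rmult_lt_0_compat; [apply Rinv_0_lt_compat; auto|lra]. }
    lra.
Qed.

Lemma Gamma_int'_1 : Gamma_int' 1 = (- zeta_reg 1 1)%C.
Proof.
  pose proof (digamma_int_em 1 Rlt_0_1) as E. unfold digamma_int, digamma_em in E.
  rewrite Gamma_int_1, ln_1 in E.
  replace (Gamma_int' 1) with (Gamma_int' 1 / 1)%C by field. rewrite E. ring.
Qed.

Lemma pochhammer_first_order z n : (forall k, (k < n)%nat -> (z + RtoC (INR k))%C <> 0) ->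
  first_order (fun s => pochhammer s n) z (pochhammer z n)
  (pochhammer z n * csum (fun k => / (z + RtoC (INR k)))%C n)%C.
Proof.
  induction n; intros H; simpl.
  - replace (1 * 0)%C with (RtoC 0) by ring. apply first_order_const.
  - pose proof (first_order_mult _ _ _ _ _ _ _ (IHn (fun k Hk => H k (Nat.lt_lt_succ_r _ _ Hk)))
    (first_order_plus _ _ _ _ _ _ _ (first_order_id z) (first_order_const (RtoC (INR n)) z))) as
    K.
    replace (pochhammer z n * (z + RtoC (INR n)) * (csum (fun k => / (z + RtoC (INR k)))%C n + /
    (z + RtoC (INR n))))%C with
      (pochhammer z n * csum (fun k => / (z + RtoC (INR k)))%C n * (z + RtoC (INR n)) +
      pochhammer z n * (1 + 0))%C; [exact K|].
    field. apply H. lia.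
Qed.

Lemma pochhammer_neg m : pochhammer (RtoC (- INR m)) m = RtoC ((-1) ^ m * INR (fact m)).
Proof.
  induction m; [simpl; f_equal; ring|]. rewrite pochhammer_shift.
  replace (RtoC (- INR (S m)) + 1)%C with (RtoC (- INR m)) by (rewrite <- RtoC_plus, S_INR;
  f_equal; ring).
  rewrite IHm, <- RtoC_mult. f_equal. rewrite fact_simpl, mult_INR. simpl pow. ring.
Qed.

Lemma harmonic_S m : harmonic (S m) = harmonic m + / INR (S m).
Proof. unfold harmonic. rewrite sum_n_Sm by lia. reflexivity. Qed.

Lemma sum_inv_harmonic m : csum (fun k => / (RtoC (- INR m) + RtoC (INR k)))%C m =
  RtoC (- harmonic m).
Proof.
  induction m.
  - simpl. unfold harmonic. rewrite sum_n_m_zero by lia. f_equal. unfold zero; simpl. ring.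
  - rewrite csum_shift, harmonic_S. rewrite (csum_ext _ (fun k => / (RtoC (- INR m) + RtoC (INR
    k)))%C).
    + rewrite IHm. rewrite <- RtoC_plus, <- RtoC_inv by (simpl INR at 2; rewrite S_INR;
      pose proof (pos_INR m); lra). rewrite <- RtoC_plus. f_equal.
      simpl (INR 0). rewrite S_INR. pose proof (pos_INR m). field. lra.
    + intros k _. f_equal. rewrite !S_INR, <- !RtoC_plus. f_equal. ring.
Qed.

(** The Mellin transform of the generating function near s = - m, without its polar
    term g m / (s + m). *)
Definition reg_part (x : R) (m N : nat) (s : C) : C :=
  (mellin_gen x N s + csum (fun n => if (n =? m)%nat then RtoC 0 else RtoC (gen_coef x n) / (s +
  RtoC (INR n))) N)%C.

Lemma csum_skip (a : nat -> C) m N : (m < N)%nat ->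
  csum a N = (csum (fun n => if (n =? m)%nat then RtoC 0 else a n) N + a m)%C.
Proof.
  induction N; intros H; [lia|]. simpl. destruct (Nat.eqb_spec N m) as [->|h].
  - rewrite (csum_ext a (fun n => if (n =? m)%nat then RtoC 0 else a n)); [ring|]. intros k Hk.
    destruct (Nat.eqb_spec k m); [lia|auto].
  - rewrite IHN by lia. ring.
Qed.

Lemma csum_analytic (a : nat -> C -> C) n s : (forall k, (k < n)%nat -> analytic_at (a k) s) ->
  analytic_at (fun s => csum (fun k => a k s) n) s.
Proof. induction n; intros H; simpl; [apply analytic_at_const|]. apply analytic_at_plus; auto.
  Qed.

Lemma reg_part_analytic x m N : 0 < x -> (m < N)%nat ->
  analytic_at (reg_part x m N) (RtoC (- INR m)).
Proof.
  intros Hx HN. apply analytic_at_plus.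
  - apply mellin_gen_analytic; auto. simpl. apply lt_INR in HN. lra.
  - apply (csum_analytic (fun n s => if (n =? m)%nat then RtoC 0 else RtoC (gen_coef x n) / (s +
    RtoC (INR n)))%C). intros k _.
    destruct (Nat.eqb_spec k m) as [->|h]; [apply analytic_at_const|].
    apply analytic_at_mult; [apply analytic_at_const|].
    apply (analytic_at_shift (fun s => / s)%C). apply analytic_at_inv. rewrite <- RtoC_plus.
    apply RtoC_neq0. intro E. apply h. apply INR_eq. lra.
Qed.

(** [mellin_identity] divided by the factors of s (s + 1) ... (s + N - 1) that do
    not vanish at - m. The division is possible just to the right of - m, and
    analyticity extends the result to a neighbourhood. *)
Lemma pole_identity x m N : 0 < x -> (m < N)%nat -> exists r, 0 < r /\
  forall s, Cmod (s - RtoC (- INR m)) < r -> (Gamma_int (s + RtoC (INR (S m))) * s_zeta x s)%C =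
  (pochhammer s (S m) * reg_part x m N s + RtoC (gen_coef x m) * pochhammer s m)%C.
Proof.
  intros Hx HN. set (z0 := RtoC (- INR m)).
  destruct (analytic_at_vanish (fun s => Gamma_int (s + RtoC (INR (S m))) * s_zeta x s -
  (pochhammer s (S m) * reg_part x m N s + RtoC (gen_coef x m) * pochhammer s m))%C z0 1 1) as [r
  [Hr K]].
  - apply analytic_at_minus; [apply analytic_at_mult|apply analytic_at_plus;
    apply analytic_at_mult].
    + apply (analytic_at_shift Gamma_int), Gamma_int_analytic. unfold z0. rewrite <- RtoC_plus.
      change (0 < - INR m + INR (S m)). rewrite S_INR. lra.
    + apply s_zeta_analytic; auto. + apply pochhammer_analytic. + apply reg_part_analytic; auto.
      + apply analytic_at_const. + apply pochhammer_analytic.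
  - intro E. apply RtoC_inj in E. lra.
  - lra.
  - intros tau Ht. set (s := (z0 + RtoC tau * 1)%C).
    assert (Es : s = RtoC (tau - INR m)) by (unfold s, z0; rewrite RtoC_minus, RtoC_opp; ring).
    assert (Hk : forall k, (s + RtoC (INR k))%C <> 0).
    { intros k E. rewrite Es, <- RtoC_plus in E. apply RtoC_inj in E.
      destruct (Nat.le_gt_cases m k) as [h|h]; [apply le_INR in h; lra|].
      assert (S k <= m)%nat as h' by lia. apply le_INR in h'. rewrite S_INR in h'. lra. }
    assert (HP : pochhammer s N <> 0).
    { apply pochhammer_neq0. intros k _ E. apply (Hk k). rewrite E, <- RtoC_plus. f_equal. ring. }
    assert (HRe : - INR m < Re s) by (rewrite Es; simpl; lra).
    pose proof (mellin_identity x N s Hx) as M. apply lt_INR in HN as HN'.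
    specialize (M ltac:(lra) ltac:(lia)).
    rewrite polar_numer_eq, (csum_skip _ m N HN) in M by auto.
    pose proof (Gamma_int_pochhammer s (S m) N) as P. rewrite S_INR in P at 1.
    specialize (P ltac:(lra) HN).
    assert (E : (pochhammer s N * (Gamma_int (s + RtoC (INR (S m))) * s_zeta x s))%C =
    (pochhammer s N * (pochhammer s (S m) * reg_part x m N s + RtoC (gen_coef x m) * pochhammer s
    m))%C).
    { transitivity (Gamma_int (s + RtoC (INR (S m))) * pochhammer s N * s_zeta x s)%C; [ring|].
      rewrite P.
      transitivity (Gamma_int (s + RtoC (INR N)) * s_zeta x s * pochhammer s (S m))%C; [ring|].
      rewrite M. unfold reg_part. simpl pochhammer. field. apply Hk. }
    assert (E2 : (/ pochhammer s N * (pochhammer s N * (Gamma_int (s + RtoC (INR (S m))) * s_zeta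
    x s)))%C = (/ pochhammer s N * (pochhammer s N * (pochhammer s (S m) * reg_part x m N s +
    RtoC (gen_coef x m) * pochhammer s m)))%C) by (rewrite E; auto).
    rewrite !Cmult_assoc, Cinv_l in E2 by auto. rewrite !Cmult_1_l in E2. rewrite E2. ring.
  - exists r. split; auto. intros s Hs. apply Ceq_minus, (K s Hs).
Qed.

(** The constant and linear coefficients of [pole_identity] at s = - m. As s (s +
    1) ... (s + m) has a simple zero there, the value of reg_part appears in the
    linear coefficient; minus the harmonic number is the logarithmic derivative of
    s (s + 1) ... (s + m - 1), and Gamma'(1) comes from Gamma(s+m+1). *)
Lemma finite_part x m N W1 : 0 < x -> (m < N)%nat ->
  first_order (s_zeta x) (RtoC (- INR m)) (s_zeta x (RtoC (- INR m))) W1 ->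
  let p0 := RtoC ((-1) ^ m * INR (fact m)) in s_zeta x (RtoC (- INR m)) =
  (RtoC (gen_coef x m) * p0)%C /\ (p0 * reg_part x m N (RtoC (- INR m)))%C =
  (Gamma_int' 1 * (RtoC (gen_coef x m) * p0) + W1 + RtoC (gen_coef x m) * p0 * RtoC
  (harmonic m))%C.
Proof.
  intros Hx HN HW p0. set (z0 := RtoC (- INR m)) in *. set (g := RtoC (gen_coef x m)).
  destruct (pole_identity x m N Hx HN) as [r [Hr E]]. fold z0 in E.
  destruct (analytic_at_first_order _ _ (reg_part_analytic x m N Hx HN)) as [K1 HK].
  fold z0 in HK.
  assert (HG : first_order (fun s => Gamma_int (s + RtoC (INR (S m)))) z0 1 (Gamma_int' 1)).
  { apply first_order_shift. replace (z0 + RtoC (INR (S m)))%C with (RtoC 1) by (unfold z0;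
    rewrite <- RtoC_plus, S_INR; f_equal; ring).
    rewrite <- Gamma_int_1 at 2. apply Gamma_int'_spec. simpl; lra. }
  assert (HP : first_order (fun s => pochhammer s m) z0 p0 (p0 * RtoC (- harmonic m))%C).
  { unfold p0. rewrite <- pochhammer_neg, <- sum_inv_harmonic. apply pochhammer_first_order.
    intros k Hk. rewrite <- RtoC_plus. apply RtoC_neq0. apply lt_INR in Hk. lra. }
  assert (HS : first_order (fun s => pochhammer s (S m)) z0 (p0 * (z0 + RtoC (INR m)))%C (p0 *
  RtoC (- harmonic m) * (z0 + RtoC (INR m)) + p0 * (1 + 0))%C).
  { apply (first_order_mult (fun s => pochhammer s m) (fun s => s + RtoC (INR m))%C); auto.
    apply first_order_plus; [apply first_order_id|apply first_order_const]. }
  assert (Hz : (z0 + RtoC (INR m))%C = 0) by (unfold z0; rewrite RtoC_opp; ring).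
  rewrite Hz in HS.
  pose proof (first_order_mult _ _ _ _ _ _ _ HG HW) as HL. cbv beta in HL.
  apply (first_order_loc _ _ _ _ _ r Hr E) in HL.
  pose proof (first_order_plus _ _ _ _ _ _ _ (first_order_mult _ _ _ _ _ _ _ HS HK)
  (first_order_mult _ _ _ _ _ _ _ (first_order_const g z0) HP)) as HR.
  destruct (first_order_unique _ _ _ _ _ _ HL HR) as [e0 e1]. clear HL HR.
  assert (V0 : s_zeta x z0 = (g * p0)%C) by (replace (s_zeta x z0) with (1 * s_zeta x z0)%C by
  ring; rewrite e0; ring).
  split; auto. rewrite V0 in e1.
  transitivity ((p0 * RtoC (- harmonic m) * 0 + p0 * (1 + 0)) * reg_part x m N z0 + p0 * 0 * K1 +
  (0 * p0 + g * (p0 * RtoC (- harmonic m))) + g * p0 * RtoC (harmonic m))%C.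
  - rewrite RtoC_opp. ring.
  - rewrite <- e1. ring.
Qed.

Lemma first_order_cexp c : first_order (fun s => cexp (s * c)) 0 1 c.
Proof.
  exists (2 * Cmod c ^ 2 * exp (Cmod c) + 1), 1. pose proof (Cmod_ge_0 c).
  pose proof (exp_pos (Cmod c)).
  assert (0 <= 2 * Cmod c ^ 2 * exp (Cmod c)) by (apply Rmult_le_pos; [apply Rmult_le_pos;
  [lra|apply pow_le; auto]|lra]).
  repeat split; [lra|lra|]. intros z Hz. replace (z - 0)%C with z in * by ring.
  pose proof (cexp_taylor 2 (z * c)) as T. unfold cexp_poly in T. simpl csum in T.
  replace (0 + 1 / 1 + z * c * 1 / 1)%C with (1 + c * z)%C in T by field.
  eapply Rle_trans; [exact T|]. rewrite Cmod_mult. pose proof (Cmod_ge_0 z).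
  replace (INR (fact 2)) with 2 by (simpl; ring).
  assert (exp (Cmod z * Cmod c) <= exp (Cmod c)) by (apply exp_le; nra).
  assert (0 <= Cmod z ^ 2) by (apply pow_le; auto).
  replace ((2 * (Cmod z * Cmod c)) ^ 2 / 2 * exp (Cmod z * Cmod c)) with (2 * Cmod c ^ 2 * Cmod z
  ^ 2 * exp (Cmod z * Cmod c)) by (simpl; field).
  apply Rle_trans with (2 * Cmod c ^ 2 * Cmod z ^ 2 * exp (Cmod c)).
  - apply Rmult_le_compat_l; auto. apply Rmult_le_pos; auto.
    apply Rmult_le_pos; [lra|apply pow_le; auto].
  - nra.
Qed.

Lemma s_zeta_first_order_0 x : 0 < x ->
  first_order (s_zeta x) 0 1 (- RtoC (ln x) + zeta_reg x 1)%C.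
Proof.
  intros Hx. destruct (analytic_at_first_order (zeta_reg x) 1 (zeta_reg_analytic x 1 Hx)) as [d
  Hd].
  assert (H1 : first_order (fun s => zeta_reg x (s + 1)) 0 (zeta_reg x 1) d) by (apply
  first_order_shift; replace (0 + 1)%C with (RtoC 1) by ring; auto).
  pose proof (first_order_plus _ _ _ _ _ _ _ (first_order_cexp (- RtoC (ln x))%C)
  (first_order_mult _ _ _ _ _ _ _ (first_order_id 0) H1)) as K. cbv beta in K.
  replace (1 + 0 * zeta_reg x 1)%C with (RtoC 1) in K by ring.
  replace (- RtoC (ln x) + (1 * zeta_reg x 1 + 0 * d))%C with (- RtoC (ln x) + zeta_reg x 1)%C in
  K by ring.
  apply (first_order_loc _ (s_zeta x) _ _ _ 1) in K; auto; [lra|]. intros z _. unfold s_zeta.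
  rewrite cpow_cexp. do 2 f_equal. ring.
Qed.

Lemma hurwitz_zeta'_spec x (s : C) : 0 < x -> s <> 1 ->
  first_order (zeta_em x) s (zeta_em x s) (hurwitz_zeta' s x).
Proof.
  intros Hx Hs. destruct (analytic_at_first_order (zeta_em x) s (zeta_em_analytic x s Hx Hs)) as
  [d Hd].
  assert (0 < Cmod (s - 1)). { apply Cmod_gt_0. intro E. apply Hs.
  replace s with (s - 1 + 1)%C by ring. rewrite E. ring. }
  assert (hurwitz_zeta' s x = d) as ->; auto. unfold hurwitz_zeta'.
  apply first_order_deriv with (zeta_em x s).
  apply (first_order_loc (zeta_em x) _ _ _ _ (Cmod (s - 1))); auto. intros z Hz. symmetry.
  apply hurwitz_zeta_em; auto.
  intros ->. replace (1 - s)%C with (- (s - 1))%C in Hz by ring. rewrite Cmod_opp in Hz. lra.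
Qed.

Lemma s_zeta_first_order_neg x m : 0 < x -> (1 <= m)%nat ->
  let s := RtoC (- INR m) in first_order (s_zeta x) s (s * zeta_em x (s + 1))%C
  (zeta_em x (s + 1) + s * hurwitz_zeta' (s + 1) x)%C.
Proof.
  intros Hx Hm s. assert (Hm' : 1 <= INR m) by (apply (le_INR 1); auto).
  assert (Hs1 : (s + 1)%C <> 1). { unfold s. rewrite <- RtoC_plus. intro E. apply RtoC_inj in E.
  lra. }
  pose proof (first_order_shift _ _ _ _ _ (hurwitz_zeta'_spec x (s + 1) Hx Hs1)) as H1.
  pose proof (first_order_mult _ _ _ _ _ _ _ (first_order_id s) H1) as K. rewrite Cmult_1_l in K.
  apply (first_order_loc _ (s_zeta x) _ _ _ (INR m)) in K; auto; [lra|]. intros z Hz.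
  rewrite s_zeta_eq; [rewrite (Cplus_comm 1 z); auto|].
  intros ->. unfold s in Hz. replace (0 - RtoC (- INR m))%C with (RtoC (INR m)) in Hz by (rewrite
  RtoC_opp; ring). rewrite Cmod_R, Rabs_pos_eq in Hz; lra.
Qed.

Lemma pow_m1_sq n : (-1) ^ n * (-1) ^ n = 1.
Proof. rewrite <- Rpow_mult_distr. replace (-1 * -1) with 1 by ring. apply pow1. Qed.

Lemma finite_part_0 x N : 0 < x -> (0 < N)%nat -> gen_coef x 0 = 1 /\
  (reg_part x 0 N (RtoC (- INR 0)) + RtoC (gen_coef x 0) * zeta_reg 1 1)%C =
  (- digamma (RtoC x))%C.
Proof.
  intros Hx HN. pose proof (s_zeta_first_order_0 x Hx) as W. simpl INR. rewrite Ropp_0.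
  pose proof (first_order_value _ _ _ _ W) as V.
  destruct (finite_part x 0 N (- RtoC (ln x) + zeta_reg x 1)%C Hx HN) as [H1 H2].
  { simpl INR. rewrite Ropp_0, V. exact W. }
  simpl INR in H1, H2. rewrite Ropp_0 in H1, H2. simpl in H1, H2. rewrite Rmult_1_r in H1, H2.
  rewrite V in H1.
  assert (E : gen_coef x 0 = 1). { apply RtoC_inj. rewrite H1. ring. }
  split; auto. rewrite digamma_zeta_reg by auto. unfold harmonic in H2.
  rewrite sum_n_m_zero in H2 by lia. unfold zero in H2; simpl in H2.
  rewrite E, Gamma_int'_1 in H2. rewrite E. replace (reg_part x 0 N 0) with (1 * reg_part x 0 N
  0)%C by ring. rewrite H2. ring.
Qed.

(** For m >= 1, [finite_part] gives zeta(1-m,x) = - B_m(x)/m from the constant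
    coefficient. Inserted into the linear one, it contributes - B_m(x)/m, which is
    why H_m becomes H_(m-1). *)
Lemma finite_part_neg x m N : 0 < x -> (1 <= m)%nat -> (m < N)%nat ->
  (reg_part x m N (RtoC (- INR m)) + RtoC (gen_coef x m) * zeta_reg 1 1)%C =
  (RtoC ((-1) ^ m / INR (fact m)) *
  (RtoC (harmonic (m - 1) * bernoulli m x) - RtoC (INR m) * hurwitz_zeta' (1 - RtoC (INR m))
  x))%C.
Proof.
  intros Hx Hm HN. assert (Hm' : 1 <= INR m) by (apply (le_INR 1); auto).
  pose proof (INR_fact_lt_0 m).
  pose proof (s_zeta_first_order_neg x m Hx Hm) as W. cbv zeta in W.
  set (s := RtoC (- INR m)) in *.
  pose proof (first_order_value _ _ _ _ W) as V.
  destruct (finite_part x m N _ Hx HN ltac:(fold s; rewrite V; exact W)) as [H1 H2].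
  fold s in H1, H2. rewrite V in H1.
  replace (s + 1)%C with (1 - RtoC (INR m))%C in * by (unfold s; rewrite RtoC_opp; ring).
  set (Z := zeta_em x (1 - RtoC (INR m))) in *.
  set (Z' := hurwitz_zeta' (1 - RtoC (INR m)) x) in *.
  set (sg := RtoC ((-1) ^ m)). set (F := RtoC (INR (fact m))). set (b := RtoC (bernoulli m x)).
  set (mm := RtoC (INR m)) in *.
  assert (Hsg : (sg * sg = 1)%C) by (unfold sg; rewrite <- RtoC_mult, pow_m1_sq; auto).
  assert (HF : F <> 0) by apply RtoC_fact_neq. assert (Hmm : mm <> 0) by (apply RtoC_neq0; lra).
  assert (Ep : RtoC ((-1) ^ m * INR (fact m)) = (sg * F)%C) by apply RtoC_mult.
  assert (Eg : RtoC (gen_coef x m) = (sg * b / F)%C) by (unfold gen_coef;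
  rewrite RtoC_div, RtoC_mult by lra; auto).
  assert (Es : s = (- mm)%C) by (unfold s; rewrite RtoC_opp; auto).
  rewrite Ep, Eg in H1, H2. rewrite Es in H1.
  assert (EZ : Z = (- b / mm)%C).
  { replace Z with (- / mm * (- mm * Z))%C by (field; auto). rewrite H1.
    replace (- / mm * (sg * b / F * (sg * F)))%C with (- / mm * ((sg * sg) * b))%C by (field;
    auto). rewrite Hsg. field. auto. }
  rewrite Gamma_int'_1, EZ, Es in H2.
  assert (EH : RtoC (harmonic m) = (RtoC (harmonic (m - 1)) + / mm)%C).
  { destruct m as [|m']; [lia|]. rewrite harmonic_S. simpl (S m' - 1)%nat.
    rewrite Nat.sub_0_r, RtoC_plus, RtoC_inv by lra. auto. }
  rewrite EH in H2. rewrite Eg. rewrite RtoC_div, RtoC_mult by lra. fold sg F b. rewrite Es.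
  replace (reg_part x m N (- mm)) with ((sg * sg) * / (sg * F) * (sg * F * reg_part x m N (-
  mm)))%C.
  2:{ rewrite Hsg. field. split; auto. intro E. rewrite E in Hsg.
  replace (0 * 0)%C with (RtoC 0) in Hsg by ring. apply RtoC_inj in Hsg. lra. }
  assert (Hsg0 : sg <> 0). { intro E. rewrite E in Hsg.
  replace (0 * 0)%C with (RtoC 0) in Hsg by ring. apply RtoC_inj in Hsg. lra. }
  rewrite H2.
  transitivity (sg / F * (RtoC (harmonic (m - 1)) * b - mm * Z'))%C; [|reflexivity].
  set (h := RtoC (harmonic (m - 1))).
  replace (sg * sg * / (sg * F) * (- zeta_reg 1 1 * (sg * b / F * (sg * F)) + (- b / mm + - mm *
  Z') + sg * b / F * (sg * F) * (h + / mm)) + sg * b / F * zeta_reg 1 1)%C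
    with (sg / F * (- zeta_reg 1 1 * ((sg * sg) * b) + (- b / mm + - mm * Z') + (sg * sg) * b *
    (h + / mm)) + sg * b / F * zeta_reg 1 1)%C by (field; auto).
  rewrite Hsg. field. auto.
Qed.

(** * The expansions of the Lambert series *)
Lemma lambert_term x s t k : 0 < x -> 0 < t ->
  (RtoC t * (cpow (INR (S k)) s * RtoC
  (qpow (exp (- t)) (INR (S k) * x) / (1 - exp (- t) ^ (S k)))))%C =
  dil_term (euler_iter x) (s - 1) 0 t (INR k).
Proof.
  intros Hx Ht. unfold dil_term. rewrite <- S_INR. pose proof (lt_0_INR (S k) ltac:(lia)) as HK.
  set (K := INR (S k)) in *.
  assert (E1 : exp (- t) ^ S k = exp (- (t * K))).
  { rewrite <- Rpower_pow by apply exp_pos. unfold Rpower. rewrite ln_exp. f_equal. fold K. ring.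
    }
  assert (E2 : qpow (exp (- t)) (K * x) = exp (- (x * (t * K)))).
  { unfold qpow. destruct (Rlt_dec 0 (exp (- t))) as [h|h]; [|exfalso; apply h, exp_pos].
    unfold Rpower. rewrite ln_exp. f_equal. ring. }
  rewrite E1, E2. simpl euler_iter. unfold gen_fun, geom.
  pose proof (one_minus_exp (t * K) ltac:(apply Rmult_lt_0_compat; auto)) as P.
  replace (cpow K s) with (cpow K (s - 1) * RtoC K)%C.
  2:{ rewrite <- (cpow_1 K) by auto. rewrite <- cpow_plus. f_equal. ring. }
  transitivity (cpow K (s - 1) * RtoC (t * (K * (exp (- (x * (t * K))) / (1 - exp (- (t *
  K)))))))%C; [rewrite !RtoC_mult; ring|].
  f_equal. f_equal. field. lra.
Qed.

(** The two halves combined: Euler-Maclaurin for the sum and Mellin asymptotics for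
    the integral. The parts t^n zeta_reg and power_int are made into zeta values in
    the three cases separately. *)
Lemma lambert_asym x s N : 0 < x -> 0 < Re s + INR N -> exists B, 0 <= B /\
  forall t, 0 < t <= 1 -> Cmod
  (RtoC t * lambert_series (exp (- t)) s x - cpow t (- s) *
  (mellin_gen x N s + csum (fun n => RtoC (gen_coef x n) * power_int s n t)%C N) - csum
  (fun n => RtoC (gen_coef x n * t ^ n) * zeta_reg 1 (1 - s - RtoC (INR n)))%C N) <= B * t ^ N.
Proof.
  intros Hx Hs.
  destruct (sum_asym (euler_iter x) (gen_coef x) (fun i u Hu => euler_iter_der x i u Hu) (fun i M
  => euler_iter_taylor x i M Hx) (fun i p => euler_iter_decay x i p Hx) N (s - 1)%C) as [B1 [HB1
  K1]].
  destruct (int_asym (gen_fun x) (gen_coef x) (fun u Hu => gen_fun_cont x u Hu) (fun M =>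
  gen_fun_taylor x M Hx) (fun p => gen_fun_decay x p Hx) N s Hs) as [B2 [HB2 K2]].
  exists (B1 + B2). split; [lra|]. intros t Ht.
  destruct (K2 t Ht) as [I [HI1 HI2]]. destruct (K1 t I ltac:(lra) HI1) as [l [Hl1 Hl2]].
  assert (El : (RtoC t * lambert_series (exp (- t)) s x)%C = l).
  { assert (t <> 0) as Ht0 by lra. assert (L : is_cseries (fun k => (cpow (INR (S k)) s * RtoC
    (qpow (exp (- t)) (INR (S k) * x) / (1 - exp (- t) ^ (S k))))%C) (/ RtoC t * l)%C).
    { eapply is_cseries_ext; [|apply is_cseries_scal, Hl1]. intro k. cbv beta.
      rewrite <- lambert_term by (auto; lra). field. apply RtoC_neq0; auto. }
    unfold lambert_series. cbv zeta. rewrite (CSeries_unique _ _ L). field.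
    apply RtoC_neq0; auto. }
  rewrite El. rewrite (csum_ext _ (fun n => RtoC (gen_coef x n * t ^ n) * zeta_reg 1 (1 - s -
  RtoC (INR n)))%C) in Hl2.
  2:{ intros k _. do 2 f_equal. ring. }
  set (c1 := (cpow t (- s) * _)%C) in *.
  set (c2 := csum (fun n => RtoC (gen_coef x n * t ^ n) * zeta_reg 1 (1 - s - RtoC (INR n)))%C N)
  in *.
  replace (l - c1 - c2)%C with ((l - I - c2) + (I - c1))%C by ring.
  eapply Rle_trans; [apply Cmod_triangle|]. lra.
Qed.

(** An expansion with error O(t^N) for all large N has it for all N, as the terms
    in between are themselves O(t^N). This removes the condition 0 < Re s + N from
    the estimates above. *)
Lemma asym_descend (F : R -> C) (a : nat -> C) N0 :
  (forall N, (N0 <= N)%nat -> exists B, 0 <= B /\ forall t, 0 < t <= 1 ->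
  Cmod (F t - csum (fun k => a k * RtoC (t ^ k))%C N) <= B * t ^ N) ->
  forall N, exists B, 0 <= B /\ forall t, 0 < t <= 1 ->
  Cmod (F t - csum (fun k => a k * RtoC (t ^ k))%C N) <= B * t ^ N.
Proof.
  intros H N. destruct (Nat.le_ge_cases N0 N) as [h|h]; auto.
  remember (N0 - N)%nat as d eqn:Ed. revert N h Ed. induction d; intros N h Ed.
  - apply H. lia.
  - destruct (IHd (S N) ltac:(lia) ltac:(lia)) as [B [HB K]]. exists (B + Cmod (a N)).
    pose proof (Cmod_ge_0 (a N)). split; [lra|].
    intros t Ht. specialize (K t Ht). cbn [csum] in K. set (cs := csum _ N) in *.
    assert (0 < t ^ N) by (apply pow_lt; lra).
    replace (F t - cs)%C with ((F t - (cs + a N * RtoC (t ^ N))) + a N * RtoC (t ^ N))%C by ring.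
    eapply Rle_trans; [apply Cmod_triangle|]. rewrite Cmod_mult, Cmod_R, Rabs_pos_eq by lra.
    simpl in K. assert (B * (t * t ^ N) <= B * t ^ N) by (apply Rmult_le_compat_l; auto; nra).
    lra.
Qed.

Lemma powerRZ_pred x n : x <> 0 -> powerRZ x (Z.of_nat n - 1) = x ^ n / x.
Proof. intros Hx. unfold Z.sub. rewrite powerRZ_add by auto. rewrite <- pow_powerRZ. simpl.
  rewrite Rmult_1_r. reflexivity. Qed.

(** The change of variable q = e^(-t). The error O(t^(n+1)) after multiplication by
    t is o(t^(n-1)) before it. *)
Lemma expansion_intro f a N0 :
  (forall N, (N0 <= N)%nat -> exists B, 0 <= B /\ forall t, 0 < t <= 1 ->
  Cmod (RtoC t * f (exp (- t)) - csum (fun k => - a k * RtoC ((-1) ^ k) * RtoC (t ^ k))%C N) <= B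
  * t ^ N) -> expansion_at_1 f a.
Proof.
  intros H n [eps He]. destruct (asym_descend (fun t => RtoC t * f (exp (- t)))%C (fun k => - a k
  * RtoC ((-1) ^ k))%C N0 H (S n)) as [B [HB K]].
  set (d := Rmin 1 (eps / (B + 1))).
  assert (0 < d) as Hd. { apply Rmin_glb_lt; [lra|]. apply Rdiv_lt_0_compat; lra. }
  assert (0 < 1 - exp (- d)) as Hd1 by (apply one_minus_exp; auto).
  exists (mkposreal _ Hd1). intros q Hq Hq1. change (Rabs (q - 1) < 1 - exp (- d)) in Hq.
  apply Rabs_def2 in Hq.
  assert (Hq0 : 0 < q) by (pose proof (exp_pos (- d)); lra).
  set (t := - ln q). assert (Ht : 0 < t < d).
  { unfold t. split. - assert (ln q < ln 1) by (apply ln_increasing; lra). rewrite ln_1 in *; lra.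
    - assert (ln (exp (- d)) < ln q) by (apply ln_increasing; [apply exp_pos|lra]).
      rewrite ln_exp in *. lra. }
  assert (Eq : q = exp (- t)) by (unfold t; rewrite Ropp_involutive, exp_ln; auto).
  assert (El : ln q = - t) by (unfold t; ring).
  assert (d <= 1) by apply Rmin_l. assert (d <= eps / (B + 1)) by apply Rmin_r.
  specialize (K t ltac:(lra)). rewrite <- Eq in K.
  change (Cmod (f q - @sum_n C_AbelianMonoid (fun k => a k * RtoC (powerRZ (ln q) (Z.of_nat k -
  1)))%C n) <= eps * Rabs (powerRZ (ln q) (Z.of_nat n - 1))).
  rewrite <- csum_sum_n. rewrite El, powerRZ_pred by lra.
  set (S2 := csum _ (S n)). set (S1 := csum _ (S n)) in K.
  assert (E : (RtoC t * S2)%C = S1).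
  { unfold S1, S2. rewrite <- csum_scal. apply csum_ext. intros k _. rewrite powerRZ_pred by lra.
    assert (RtoC ((- t) ^ k / - t) = (- RtoC ((-1) ^ k) * RtoC (t ^ k) / RtoC t)%C) as ->.
    { replace (- t) with (-1 * t) at 1 by ring. rewrite Rpow_mult_distr.
      replace ((-1) ^ k * t ^ k / - t) with (- ((-1) ^ k) * t ^ k / t) by (field; lra).
      rewrite RtoC_div, RtoC_mult, RtoC_opp by lra. auto. }
    field. apply RtoC_neq0; lra. }
  rewrite <- E in K. replace (RtoC t * f q - RtoC t * S2)%C with (RtoC t * (f q - S2))%C in K by
  ring.
  rewrite Cmod_mult, Cmod_R, Rabs_pos_eq in K by lra.
  assert (0 < t ^ n) by (apply pow_lt; lra).
  replace (Rabs ((- t) ^ n / - t)) with (t ^ n / t).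
  2:{ unfold Rdiv. rewrite Rabs_mult, <- RPow_abs, Rabs_Ropp, Rabs_inv, Rabs_Ropp,
  (Rabs_pos_eq t) by lra. auto. }
  apply Rmult_le_reg_l with t; [lra|]. eapply Rle_trans; [exact K|]. simpl.
  replace (t * (eps * (t ^ n / t))) with (eps * t ^ n) by (field; lra). rewrite <- Rmult_assoc.
  apply Rmult_le_compat_r; [lra|].
  assert ((B + 1) * t <= (B + 1) * (eps / (B + 1))) by (apply Rmult_le_compat_l; lra).
  replace ((B + 1) * (eps / (B + 1))) with eps in * by (field; lra). nra.
Qed.

Lemma ln_inv_exp t : ln (1 / exp (- t)) = t.
Proof. unfold Rdiv. rewrite Rmult_1_l, exp_Ropp, Rinv_inv, ln_exp. auto. Qed.

Lemma riemann_zeta_reg (w : C) : w <> 1 -> riemann_zeta w = (/ (w - 1) + zeta_reg 1 w)%C.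
Proof.
  intros Hw. unfold riemann_zeta. rewrite hurwitz_zeta_em by (auto; lra). unfold zeta_em.
  rewrite cpow_1_l. unfold Cdiv. ring.
Qed.

Lemma gen_coef_C x k : RtoC (gen_coef x k) =
  (RtoC (bernoulli k x) * RtoC ((-1) ^ k) / RtoC (INR (fact k)))%C.
Proof. unfold gen_coef. rewrite RtoC_div, RtoC_mult by apply INR_fact_neq_0. unfold Cdiv. ring.
  Qed.

Lemma expansion_generic x s : 0 < x -> (forall n : nat, s <> RtoC (- INR n)) ->
  expansion_at_1 (fun q => lambert_series q s x - Gamma (1 + s) * hurwitz_zeta (1 + s) x / cpow
  (ln (1 / q)) (1 + s))%C (fun k => -
  (riemann_zeta (1 - s - RtoC (INR k)) / RtoC (INR (fact k)) * RtoC (bernoulli k x)))%C.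
Proof.
  intros Hx Hs. destruct (INR_unbounded (- Re s)) as [N1 HN1].
  assert (Hk : forall k, (s + RtoC (INR k))%C <> 0).
  { intros k E. apply (Hs k). rewrite RtoC_opp.
    replace s with (s + RtoC (INR k) - RtoC (INR k))%C by ring. rewrite E. ring. }
  assert (H1s : (1 + s)%C <> 1).
  { intro E. apply (Hs 0%nat). simpl. rewrite Ropp_0. replace s with (1 + s - 1)%C by ring.
    rewrite E. ring. }
  apply expansion_intro with (S N1). intros N HN.
  assert (0 < Re s + INR N) as HsN by (apply le_INR in HN; rewrite S_INR in HN; lra).
  destruct (lambert_asym x s N Hx HsN) as [B [HB K]]. exists B. split; auto. intros t Ht.
  specialize (K t Ht).
  rewrite ln_inv_exp, hurwitz_zeta_em, (Gamma_zeta_mellin x N s) by (auto; lia).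
  match type of K with Cmod ?u <= _ => match goal with |- Cmod ?v <= _ => replace v with u;
  [exact K|] end end.
  set (L := lambert_series _ _ _). set (M := mellin_gen x N s).
  assert (E1 : csum (fun n => RtoC (gen_coef x n) * power_int s n t)%C N = (csum (fun n => RtoC
  (gen_coef x n) / (s + RtoC (INR n)))%C N - cpow t s * csum (fun n => RtoC (gen_coef x n * t ^
  n) / (s + RtoC (INR n)))%C N)%C).
  { rewrite <- csum_scal. rewrite (csum_comb4 _ (fun n => RtoC (gen_coef x n) / (s + RtoC (INR
    n)))%C (fun k => cpow t s * (RtoC (gen_coef x k * t ^ k) / (s + RtoC (INR k))))%C (fun _ =>
    RtoC 0) 1 (-(1))%C 0); [ring|].
    intros k _. rewrite power_int_generic, cpow_plus, cpow_INR, RtoC_mult by (auto; lra). field.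
    auto. }
  assert (E2 : csum (fun k => - - (riemann_zeta (1 - s - RtoC (INR k)) / RtoC (INR (fact k)) *
  RtoC (bernoulli k x)) * RtoC ((-1) ^ k) * RtoC (t ^ k))%C N =
     (csum (fun n => RtoC (gen_coef x n * t ^ n) * zeta_reg 1 (1 - s - RtoC (INR n)))%C N - csum
     (fun n => RtoC (gen_coef x n * t ^ n) / (s + RtoC (INR n)))%C N)%C).
  { rewrite (csum_comb4 _ (fun n => RtoC (gen_coef x n * t ^ n) * zeta_reg 1 (1 - s - RtoC (INR
    n)))%C (fun n => RtoC (gen_coef x n * t ^ n) / (s + RtoC (INR n)))%C (fun _ => RtoC 0) 1
    (-(1))%C 0); [ring|].
    intros k _. rewrite riemann_zeta_reg.
    - rewrite RtoC_mult, gen_coef_C. replace (1 - s - RtoC (INR k) - 1)%C with (- (s + RtoC (INR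
      k)))%C by ring.
      field. split; [apply RtoC_fact_neq|auto].
    - intro E. apply (Hk k). replace (s + RtoC (INR k))%C with (1 - (1 - s - RtoC (INR k)))%C by
      ring. rewrite E. ring. }
  rewrite E1, E2.
  assert (E3 : cpow t (1 + s) = (RtoC t * cpow t s)%C) by (rewrite cpow_plus, cpow_1 by lra;
  auto).
  rewrite E3, cpow_opp. field. split; [apply cpow_neq0|apply RtoC_neq0; lra].
Qed.

(** At s = - m the integral power_int of index m is - ln t, and so it supplies no
    polar part to complete zeta_reg 1 1 to a zeta value. All other terms are as in
    the generic case. *)
Lemma lambert_asym_neg x m N : 0 < x -> (m < N)%nat -> exists B, 0 <= B /\
  forall t, 0 < t <= 1 -> Cmod
  (RtoC t * lambert_series (exp (- t)) (RtoC (- INR m)) x - RtoC (t ^ m) *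
  (reg_part x m N (RtoC (- INR m)) + RtoC (gen_coef x m) * zeta_reg 1 1 - RtoC (gen_coef x m) *
  RtoC (ln t)) - csum (fun n =>
  (if (n =? m)%nat then RtoC 0 else RtoC (gen_coef x n) * riemann_zeta
  (1 + RtoC (INR m) - RtoC (INR n))) * RtoC (t ^ n))%C N) <= B * t ^ N.
Proof.
  intros Hx HN. set (s := RtoC (- INR m)). assert (HsN : 0 < Re s + INR N) by (simpl;
  apply lt_INR in HN; lra).
  destruct (lambert_asym x s N Hx HsN) as [B [HB K]]. exists B. split; auto. intros t Ht.
  specialize (K t Ht).
  match type of K with Cmod ?u <= _ => match goal with |- Cmod ?v <= _ => replace v with u;
  [exact K|] end end.
  set (L := lambert_series _ _ _).
  assert (Hk : forall k, k <> m -> (s + RtoC (INR k))%C <> 0).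
  { intros k Hk. unfold s. rewrite <- RtoC_plus. apply RtoC_neq0. intro E. apply Hk.
    apply INR_eq. lra. }
  assert (Hp : cpow t (- s) = RtoC (t ^ m)).
  { unfold s. rewrite RtoC_opp. replace (- - RtoC (INR m))%C with (RtoC (INR m)) by ring.
    apply cpow_INR. lra. }
  assert (Ht0 : RtoC (t ^ m) <> 0) by (apply RtoC_neq0; apply Rgt_not_eq, pow_lt; lra).
  set (R1 := csum (fun n => if (n =? m)%nat then RtoC 0 else (RtoC (gen_coef x n) / (s + RtoC
  (INR n)))%C) N).
  set (R2 := csum (fun n => if (n =? m)%nat then RtoC 0 else (RtoC (gen_coef x n * t ^ n) / (s +
  RtoC (INR n)))%C) N).
  set (R3 := csum (fun n => if (n =? m)%nat then RtoC 0 else (RtoC (gen_coef x n * t ^ n) *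
  zeta_reg 1 (1 - s - RtoC (INR n)))%C) N).
  assert (E1 : csum (fun n => RtoC (gen_coef x n) * power_int s n t)%C N = (R1 - / RtoC (t ^ m) *
  R2 - RtoC (gen_coef x m) * RtoC (ln t))%C).
  { rewrite (csum_skip _ m N HN). replace (power_int s m t) with (RtoC (- ln t)) by (unfold s;
    rewrite (RtoC_opp (INR m)); symmetry; apply power_int_log; auto).
    rewrite (csum_comb4 _ (fun n => if (n =? m)%nat then RtoC 0 else (RtoC (gen_coef x n) / (s +
    RtoC (INR n)))%C) (fun n => if (n =? m)%nat then RtoC 0 else (RtoC (gen_coef x n * t ^ n) /
    (s + RtoC (INR n)))%C) (fun _ => RtoC 0) 1 (- / RtoC (t ^ m))%C 0).
    - fold R1 R2. rewrite RtoC_opp. ring.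
    - intros k _. destruct (Nat.eqb_spec k m) as [h|h]; [ring|].
      rewrite power_int_generic by auto.
      replace (cpow t (s + RtoC (INR k))) with (/ RtoC (t ^ m) * RtoC (t ^ k))%C.
      + rewrite RtoC_mult. field. auto.
      + rewrite cpow_plus, cpow_INR by lra. f_equal. rewrite <- Hp, cpow_opp. field.
        apply cpow_neq0. }
  assert (E2 : csum (fun n => RtoC (gen_coef x n * t ^ n) * zeta_reg 1 (1 - s - RtoC (INR n)))%C
  N = (R3 + RtoC (gen_coef x m) * RtoC (t ^ m) * zeta_reg 1 1)%C).
  { rewrite (csum_skip _ m N HN). fold R3. rewrite RtoC_mult.
    replace (1 - s - RtoC (INR m))%C with (RtoC 1) by (unfold s; rewrite RtoC_opp; ring). ring. }
  assert (E3 : csum (fun n => (if (n =? m)%nat then RtoC 0 else RtoC (gen_coef x n) *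
  riemann_zeta (1 + RtoC (INR m) - RtoC (INR n))) * RtoC (t ^ n))%C N = (R3 - R2)%C).
  { rewrite (csum_comb4 _ (fun n => if (n =? m)%nat then RtoC 0 else (RtoC (gen_coef x n * t ^ n)
    * zeta_reg 1 (1 - s - RtoC (INR n)))%C) (fun n => if (n =? m)%nat then RtoC 0 else (RtoC
    (gen_coef x n * t ^ n) / (s + RtoC (INR n)))%C) (fun _ => RtoC 0) 1 (-(1))%C 0).
    - fold R3 R2. ring.
    - intros k _. destruct (Nat.eqb_spec k m) as [h|h]; [ring|].
      replace (1 + RtoC (INR m) - RtoC (INR k))%C with (1 - s - RtoC (INR k))%C by (unfold s;
      rewrite RtoC_opp; ring).
      rewrite riemann_zeta_reg.
      + rewrite RtoC_mult. replace (1 - s - RtoC (INR k) - 1)%C with (- (s + RtoC (INR k)))%C by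
        ring. field. auto.
      + intro E. apply (Hk k h). replace (s + RtoC (INR k))%C with (1 - (1 - s - RtoC (INR k)))%C
        by ring. rewrite E. ring. }
  rewrite E1, E2, E3, Hp. unfold reg_part. fold R1. field. auto.
Qed.

Lemma expansion_0 x : 0 < x ->
  expansion_at_1 (fun q => lambert_series q 0 x - (digamma (RtoC x) + RtoC (ln (ln (1 / q)))) /
  RtoC (ln q))%C (fun k => if (k =? 0)%nat then RtoC 0 else
  (- (riemann_zeta (1 - RtoC (INR k)) / RtoC (INR (fact k)) * RtoC (bernoulli k x)))%C).
Proof.
  intros Hx. apply expansion_intro with 1%nat. intros N HN.
  destruct (lambert_asym_neg x 0 N Hx HN) as [B [HB K]]. exists B. split; auto. intros t Ht.
  specialize (K t Ht).
  destruct (finite_part_0 x N Hx HN) as [G1 G2]. rewrite G2, G1 in K.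
  match type of K with Cmod ?u <= _ => match goal with |- Cmod ?v <= _ => replace v with u;
  [exact K|] end end.
  rewrite ln_inv_exp, ln_exp. simpl (INR 0). rewrite Ropp_0. simpl (t ^ 0).
  rewrite (csum_ext (fun k => - (if (k =? 0)%nat then RtoC 0 else - (riemann_zeta (1 - RtoC (INR
  k)) / RtoC (INR (fact k)) * RtoC (bernoulli k x))) * RtoC ((-1) ^ k) * RtoC (t ^ k))%C
    (fun n => (if (n =? 0)%nat then RtoC 0 else RtoC (gen_coef x n) * riemann_zeta (1 + 0 - RtoC
    (INR n))) * RtoC (t ^ n))%C).
  - rewrite RtoC_opp. field. apply RtoC_neq0; lra.
  - intros k _. destruct (Nat.eqb_spec k 0) as [h|h]; [ring|]. rewrite gen_coef_C.
    replace (1 + 0 - RtoC (INR k))%C with (1 - RtoC (INR k))%C by ring. field.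
    apply RtoC_fact_neq.
Qed.

Lemma expansion_neg x m : 0 < x -> (1 <= m)%nat ->
  expansion_at_1 (fun q => lambert_series q (- RtoC (INR m)) x -
  (RtoC (INR m) * hurwitz_zeta' (1 - RtoC (INR m)) x + RtoC (ln (ln (1 / q)) - harmonic (m - 1))
  * RtoC (bernoulli m x)) * RtoC (ln q ^ (m - 1) / INR (fact m)))%C
  (fun k => if (k =? m)%nat then RtoC 0 else
  (- (riemann_zeta (1 + RtoC (INR m) - RtoC (INR k)) / RtoC (INR (fact k)) * RtoC
  (bernoulli k x)))%C).
Proof.
  intros Hx Hm. apply expansion_intro with (S m). intros N HN.
  destruct (lambert_asym_neg x m N Hx HN) as [B [HB K]]. exists B. split; auto. intros t Ht.
  specialize (K t Ht).
  rewrite (finite_part_neg x m N Hx Hm HN) in K.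
  match type of K with Cmod ?u <= _ => match goal with |- Cmod ?v <= _ => replace v with u;
  [exact K|] end end.
  rewrite ln_inv_exp, ln_exp, <- RtoC_opp.
  rewrite (csum_ext (fun k => - (if (k =? m)%nat then RtoC 0 else - (riemann_zeta (1 + RtoC (INR
  m) - RtoC (INR k)) / RtoC (INR (fact k)) * RtoC (bernoulli k x))) * RtoC ((-1) ^ k) * RtoC (t ^
  k))%C
    (fun n => (if (n =? m)%nat then RtoC 0 else RtoC (gen_coef x n) * riemann_zeta (1 + RtoC (INR
    m) - RtoC (INR n))) * RtoC (t ^ n))%C).
  - set (cs := csum _ N). set (L := lambert_series _ _ _). set (Z' := hurwitz_zeta' _ _).
    assert (E : (- t) ^ (m - 1) = - ((-1) ^ m) * t ^ m / t).
    { destruct m as [|k]; [lia|]. simpl (S k - 1)%nat. rewrite Nat.sub_0_r.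
      replace (- t) with (-1 * t) by ring. rewrite Rpow_mult_distr. simpl. field. lra. }
    rewrite E, gen_coef_C. pose proof (INR_fact_lt_0 m).
    replace (- (-1) ^ m * t ^ m / t / INR (fact m)) with (- ((-1) ^ m / INR (fact m)) * t ^ m /
    t) by (field; lra).
    rewrite (RtoC_div _ t), (RtoC_mult _ (t ^ m)), RtoC_opp, (RtoC_div ((-1) ^ m)), RtoC_minus,
    RtoC_mult by lra.
    field. split; [apply RtoC_fact_neq|apply RtoC_neq0; lra].
  - intros k _. destruct (Nat.eqb_spec k m) as [h|h]; [ring|]. rewrite gen_coef_C. field.
    apply RtoC_fact_neq.
Qed.

Theorem theorem2p2 (x : R) (hx : 0 < x) :
  (forall s : C, (forall n : nat, s <> RtoC (- INR n)) ->
     expansion_at_1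
       (fun q => lambert_series q s x
          - Gamma (1 + s) * hurwitz_zeta (1 + s) x / cpow (ln (1 / q)) (1 + s))%C
       (fun k => - (riemann_zeta (1 - s - INR k) / INR (fact k)
                    * bernoulli k x))%C)
  /\
  expansion_at_1
    (fun q => lambert_series q 0 x
       - (digamma x + RtoC (ln (ln (1 / q)))) / RtoC (ln q))%C
    (fun k => if (k =? 0)%nat then RtoC 0
              else (- (riemann_zeta (1 - INR k) / INR (fact k)
                       * bernoulli k x))%C)
  /\
  (forall m : nat, (1 <= m)%nat ->
     expansion_at_1
       (fun q => lambert_series q (- INR m) x
          - (INR m * hurwitz_zeta' (1 - INR m) x
             + RtoC (ln (ln (1 / q)) - harmonic (m - 1)) * bernoulli m x)
            * RtoC (ln q ^ (m - 1) / INR (fact m)))%C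
       (fun k => if (k =? m)%nat then RtoC 0
                 else (- (riemann_zeta (1 + INR m - INR k) / INR (fact k)
                          * bernoulli k x))%C)).
Proof.
  split; [|split].
  - intros s Hs. apply expansion_generic; auto.
  - apply expansion_0; auto.
  - intros m Hm. apply expansion_neg; auto.
Qed.
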